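(* Let $A$ be an $A_\infty$-algebra. Then the category $\mathrm{Mod}_\infty\text{-}A$ is additive with split idempotents. Let $\mathcal{E}_\infty$ be the class of composable pairs $(M,m^M)\xrightarrow{f}(E,m^E)\xrightarrow{g}(N,m^N)$ in $\mathrm{Mod}_\infty\text{-}A$ such that $g\circ f=0$ and $0\to M\xrightarrow{f_1}E\xrightarrow{g_1}N\to0$ is an exact sequence of graded right $S$-modules. Then: (1) The pair $(\mathrm{Mod}_\infty\text{-}A,\mathcal{E}_\infty)$ is an exact category. The class $\mathcal{E}_\infty$ coincides with the class of composable pairs of morphisms of $\mathrm{Mod}_\infty\text{-}A$ which become split exact pairs in $\mathrm{GMod}^0\text{-}A$ when the second components of the objects are forgotten. (2) A morphism $f:(M,m^M)\to(E,m^E)$ in $\mathrm{Mod}_\infty\text{-}A$ is an $\mathcal{E}_\infty$-inflation if and only if $f_1:M\to E$ is injective. (3) A morphism $g:(E,m^E)\to(N,m^N)$ in $\mathrm{Mod}_\infty\text{-}A$ is an $\mathcal{E}_\infty$-deflation if and only if $g_1:E\to N$ is surjective. (4) The functor $\mathbb{G}:(\mathrm{Mod}_\infty\text{-}A,\mathcal{E}_\infty)\to(\mathrm{TGMod}^0\text{-}\mathcal{B}_A,\mathcal{E})$ is an equivalence of exact categories.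
   Context: Conventions: $k$ is a field, $S$ is a finite-dimensional semisimple $k$-algebra such that $S\otimes_kS^{op}$ is semisimple; $k$ acts centrally on all algebras and bimodules; $S$ is graded concentrated in degree $0$. Graded means $\mathbb{Z}$-graded; a homogeneous morphism of degree $d$ shifts degrees by $d$; tensor products are over $S$ with the usual grading; $(f\otimes g)(x\otimes y)=(-1)^{|g||x|}f(x)\otimes g(y)$. $M[1]_i=M_{i+1}$ and $\sigma_M:M\to M[1]$ is the identity viewed as a map of degree $-1$; $\sigma=\sigma_A$. An $A_\infty$-algebra is a graded $S$-$S$-bimodule $A$ with bimodule morphisms $m_n:A^{\otimes n}\to A$ of degree $2-n$ ($n\ge1$) with $\sum_{r+s+t=n,\ s\ge1;\,r,t\ge0}(-1)^{r+st}m_{r+1+t}(id^{\otimes r}\otimes m_s\otimes id^{\otimes t})=0$ for all $n\ge1$. $\mathrm{Mod}_\infty\text{-}A$: a right $A_\infty$-module over $A$ is a graded right $S$-module $M$ with a family $m^M=\{m^M_n\}_{n\ge1}$ of morphisms of right $S$-modules $m_n^M:M\otimes A^{\otimes(n-1)}\to M$ of degree $2-n$ such that for all $n\ge1$: $\sum_{r+s+t=n;\,r,s\ge1,t\ge0}(-1)^{r+st}m^M_{r+1+t}(id^{\otimes r}\otimes m_s\otimes id^{\otimes t})+\sum_{s+t=n;\,s\ge1,t\ge0}(-1)^{st}m^M_{1+t}(m^M_s\otimes id^{\otimes t})=0$, where $id^{\otimes r}$ ($r\ge 1$) on the left abbreviates $id_M\otimes id_A^{\otimes(r-1)}$. A morphism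 $f:M\to N$ is a family of morphisms of graded right $S$-modules $f_n:M\otimes A^{\otimes(n-1)}\to N$ of degree $1-n$ with $\sum_{r+s+t=n;\,r,s\ge1,t\ge0}(-1)^{r+st}f_{r+1+t}(id^{\otimes r}\otimes m_s\otimes id^{\otimes t})+\sum_{s+t=n;\,s\ge1,t\ge0}(-1)^{st}f_{1+t}(m_s^M\otimes id^{\otimes t})-\sum_{r+s=n;\,r\ge1,s\ge0}(-1)^{(r+1)s}m^N_{1+s}(f_r\otimes id^{\otimes s})=0$ for all $n\ge1$; composition is $(g\circ f)_n=\sum_{r+s=n;\,r\ge1,s\ge0}(-1)^{(r+1)s}g_{1+s}(f_r\otimes id^{\otimes s})$; the identity is $h_1=id_M$, $h_n=0$ for $n\ge2$. $\mathrm{GMod}^0\text{-}A$: objects are graded right $S$-modules; morphisms $M\to N$ are families $\{f_n\}_{n\ge1}$ of homogeneous morphisms of right $S$-modules $f_n:M\otimes A^{\otimes(n-1)}\to N$ of degree $1-n$, with the same composition formula. $\mathcal{B}_A=(C,\mu,\epsilon,\delta)$: $C=T_S(A[1])=\bigoplus_{n\ge0}A[1]^{\otimes n}$; $\mu$ is deconcatenation ($\mu(1)=1\otimes1$, and on $A[1]^{\otimes n}$ it is the sum over all splittings, including $1\otimes x$ and $x\otimes1$); $\epsilon$ is the projection on $S$; $\delta(S)=0$ and $\delta$ on $A[1]^{\otimes n}$, $n\ge1$, is $\sum_{r+s+t=n;\,s\ge1}id^{\otimes r}\otimes\hat m_s\otimes id^{\otimes t}$ with $\hat m_s\sigma^{\otimes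 s}=\sigma m_s$. $\mathrm{GMod}\text{-}\mathcal{B}_A$: objects are graded right $S$-modules; degree $d$ morphisms $M\to N$ are degree $d$ right $S$-module morphisms $f:M\otimes C\to N$, with first component $f^0(m)=f(m\otimes1)$; $g*f=g(f\otimes id_C)(id_M\otimes\mu)$; $\hat\delta(f)=(-1)^{|f|+1}f(id_M\otimes\delta)$. $\mathrm{TGMod}^0\text{-}\mathcal{B}_A$: objects are $(M,u)$ with $|u|=1$ and $\hat\delta(u)+u*u=0$; morphisms $(M,u)\to(N,v)$ are degree $0$ morphisms $f$ with $\hat\delta(f)+v*f-f*u=0$. $\mathcal{E}$ is the class of composable pairs $(M,u)\xrightarrow{f}(E,v)\xrightarrow{g}(N,w)$ in $\mathrm{TGMod}^0\text{-}\mathcal{B}_A$ with $g*f=0$ and $0\to M\xrightarrow{f^0}E\xrightarrow{g^0}N\to0$ exact. $\mathbb{G}(M,m^M)=(M[1],\widehat{m^M})$ and $\mathbb{G}(f)=\hat f$, where for a family $f=\{f_n\}$ (of any degree) $\hat f:M[1]\otimes C\to N[1]$ has components $\hat f_n$ on $M[1]\otimes A[1]^{\otimes n}$ given by $\hat f_n(\sigma_M\otimes\sigma^{\otimes n})=\sigma_Nf_{n+1}$ ($n\ge1$) and $\hat f_0(\sigma_M(m)\otimes1)=\sigma_Nf_1(m)$. An inflation (deflation) is the first (second) morphism of a pair in the exact structure. Exact category is in Quillen's sense. *)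

(* Defs.v *)
Set Warnings "-notation-overridden,-ambiguous-paths,-redundant-canonical-projection,-notation-incompatible-prefix".
From HB Require Import structures.
From mathcomp Require Import all_boot all_order all_algebra all_field.
From mathcomp Require Import all_classical.

Set Implicit Arguments.
Unset Strict Implicit.
Unset Printing Implicit Defensive.

Import Order.TTheory GRing.Theory Num.Theory.
Local Open Scope ring_scope.
Local Open Scope quotient_scope.

Section TensorProduct.
Variables (R : Type) (M N : zmodType) (ra : M -> R -> M) (la : R -> N -> N).

(* A list of pairs stands for the sum of the corresponding pure tensors; since
   - (m (x) n) = (- m) (x) n, these lists already represent all elements. *)
Inductive teq : seq (M * N) -> seq (M * N) -> Prop :=
| teq_refl u : teq u u
| teq_sym u v : teq u v -> teq v u
| teq_trans u v w : teq u v -> teq v w -> teq u w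
| teq_cat u u' v v' : teq u u' -> teq v v' -> teq (u ++ v) (u' ++ v')
| teq_catC u v : teq (u ++ v) (v ++ u)
| teq_0l n : teq [:: (0, n)] [::]
| teq_0r m : teq [:: (m, 0)] [::]
| teq_Dl m m' n : teq [:: (m + m', n)] [:: (m, n); (m', n)]
| teq_Dr m n n' : teq [:: (m, n + n')] [:: (m, n); (m, n')]
| teq_bal m r n : teq [:: (ra m r, n)] [:: (m, la r n)].

Definition teqb (u v : seq (M * N)) : bool := `[< teq u v >].

Lemma teqb_refl : reflexive teqb.
Proof. by move=> u; apply/asboolP; exact: teq_refl. Qed.
Lemma teqb_sym : symmetric teqb.
Proof. by move=> u v; apply/asboolP/asboolP; exact: teq_sym. Qed.
Lemma teqb_trans : transitive teqb.
Proof. by move=> v u w /asboolP h /asboolP h'; apply/asboolP/(teq_trans h). Qed.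

Canonical teq_equiv := EquivRel teqb teqb_refl teqb_sym teqb_trans.

Definition tens := {eq_quot teq_equiv}.
HB.instance Definition _ := Choice.on tens.

Definition tpi (u : seq (M * N)) : tens := \pi_{eq_quot teq_equiv} u.
Definition trepr (x : tens) : seq (M * N) := repr (x : {eq_quot teq_equiv}).

Lemma treprK : cancel trepr tpi.
Proof. exact: reprK. Qed.

Lemma teqP u v : (tpi u = tpi v) <-> teq u v.
Proof.
by split=> [/eqmodP/asboolP//|h]; apply/eqmodP/asboolP.
Qed.

Lemma trepr_teq u : teq (trepr (tpi u)) u.
Proof. by apply/teqP; rewrite treprK. Qed.

Definition topp_seq (u : seq (M * N)) := [seq (- p.1, p.2) | p <- u].

Definition tadd (x y : tens) : tens := tpi (trepr x ++ trepr y).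
Definition topp (x : tens) : tens := tpi (topp_seq (trepr x)).
Definition tzero : tens := tpi [::].

Lemma topp_seqN u : teq (topp_seq u ++ u) [::].
Proof.
elim: u => [|[m n] u IH] /=; first exact: teq_refl.
have h : teq [:: (- m, n); (m, n)] [::].
  by apply: teq_trans (teq_0l n); rewrite -(addNr m); exact/teq_sym/teq_Dl.
apply: (@teq_trans _ (([:: (- m, n); (m, n)]) ++ (topp_seq u ++ u))).
  apply: (@teq_cat [:: (- m, n)] [:: (- m, n)]); first exact: teq_refl.
  have := teq_cat (teq_catC (topp_seq u) [:: (m, n)]) (teq_refl u).
  by rewrite -catA.
by rewrite -[[::]]cats0; apply: teq_cat.
Qed.

Lemma pi_tadd u v : tadd (tpi u) (tpi v) = tpi (u ++ v).
Proof. by apply/teqP/teq_cat; exact: trepr_teq. Qed.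

Lemma taddA : associative tadd.
Proof.
by move=> x y z; rewrite -[x]treprK -[y]treprK -[z]treprK !pi_tadd catA.
Qed.

Lemma taddC : commutative tadd.
Proof.
move=> x y; rewrite -[x]treprK -[y]treprK !pi_tadd.
apply/teqP; exact: teq_catC.
Qed.

Lemma tadd0 : left_id tzero tadd.
Proof. by move=> x; rewrite -[x]treprK pi_tadd. Qed.

Lemma taddN : left_inverse tzero topp tadd.
Proof.
by move=> x; rewrite -{2}[x]treprK pi_tadd; apply/teqP; exact: topp_seqN.
Qed.

HB.instance Definition _ := GRing.isZmodule.Build tens taddA taddC tadd0 taddN.

Definition tpure (m : M) (n : N) : tens := tpi [:: (m, n)].

(* [tlift phi] is defined for every function [phi]; it is the map induced by
   [phi] as soon as [phi] is balanced (lemma [tliftE]). *)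
Definition tlift (V : zmodType) (phi : M -> N -> V) (x : tens) : V :=
  \sum_(p <- trepr x) phi p.1 p.2.

Definition balanced (V : zmodType) (phi : M -> N -> V) :=
  [/\ forall m m' n, phi (m + m') n = phi m n + phi m' n,
      forall m n n', phi m (n + n') = phi m n + phi m n'
    & forall m r n, phi (ra m r) n = phi m (la r n)].

Lemma tpure_balanced : balanced tpure.
Proof.
split=> [m m' n|m n n'|m r n].
- by apply/esym; rewrite [LHS]pi_tadd; apply/teqP/teq_sym/teq_Dl.
- by apply/esym; rewrite [LHS]pi_tadd; apply/teqP/teq_sym/teq_Dr.
- exact/teqP/teq_bal.
Qed.

Lemma tpureDl m m' n : tpure (m + m') n = tpure m n + tpure m' n.
Proof. by case: tpure_balanced. Qed.
Lemma tpureDr m n n' : tpure m (n + n') = tpure m n + tpure m n'.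
Proof. by case: tpure_balanced. Qed.
Lemma tpure_bal m r n : tpure (ra m r) n = tpure m (la r n).
Proof. by case: tpure_balanced. Qed.
Lemma tpure0l n : tpure 0 n = 0.
Proof. exact/teqP/teq_0l. Qed.
Lemma tpure0r m : tpure m 0 = 0.
Proof. exact/teqP/teq_0r. Qed.
Lemma tpureNl m n : tpure (- m) n = - tpure m n.
Proof. by apply/eqP; rewrite -addr_eq0 -tpureDl addNr tpure0l. Qed.
Lemma tpureNr m n : tpure m (- n) = - tpure m n.
Proof. by apply/eqP; rewrite -addr_eq0 -tpureDr addNr tpure0r. Qed.
Lemma tpure_suml I (r : seq I) P (F : I -> M) n :
  tpure (\sum_(i <- r | P i) F i) n = \sum_(i <- r | P i) tpure (F i) n.
Proof.
exact: (big_morph (tpure^~ n) (fun a b => tpureDl a b n) (tpure0l n)).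
Qed.
Lemma tpure_sumr I (r : seq I) P m (F : I -> N) :
  tpure m (\sum_(i <- r | P i) F i) = \sum_(i <- r | P i) tpure m (F i).
Proof. exact: (big_morph _ (tpureDr m) (tpure0r m)). Qed.

Lemma tens_sum (x : tens) : x = \sum_(p <- trepr x) tpure p.1 p.2.
Proof.
rewrite -{1}[x]treprK; elim: (trepr x) => [|[m n] u IH]; first by rewrite big_nil.
by rewrite big_cons -IH [RHS]pi_tadd.
Qed.

Lemma tens_ind (P : tens -> Prop) :
  P 0 -> (forall m n x, P x -> P (tpure m n + x)) -> forall x, P x.
Proof.
move=> P0 PD x; rewrite [x]tens_sum; elim: (trepr x) => [|p u IH].
  by rewrite big_nil.
by rewrite big_cons; apply: PD.
Qed.

Lemma tens_ext (V : zmodType) (f g : tens -> V) :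
  {morph f : x y / x + y} -> {morph g : x y / x + y} ->
  (forall m n, f (tpure m n) = g (tpure m n)) -> f =1 g.
Proof.
move=> fD gD fg.
have f0 : f 0 = 0 by apply: (addrI (f 0)); rewrite -fD !addr0.
have g0 : g 0 = 0 by apply: (addrI (g 0)); rewrite -gD !addr0.
by apply: tens_ind => [|m n x IH]; rewrite ?f0 ?g0 // fD gD fg IH.
Qed.

Section Lift.
Variables (V : zmodType) (phi : M -> N -> V).
Hypothesis phiB : balanced phi.

Lemma tlift_pi u : tlift phi (tpi u) = \sum_(p <- u) phi p.1 p.2.
Proof.
case: phiB => phiDl phiDr phiA; rewrite /tlift.
have phi0l n : phi 0 n = 0.
  by apply: (addrI (phi 0 n)); rewrite -phiDl !addr0.
have phi0r m : phi m 0 = 0.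
  by apply: (addrI (phi m 0)); rewrite -phiDr !addr0.
suff sumE a b : teq a b ->
    \sum_(p <- a) phi p.1 p.2 = \sum_(p <- b) phi p.1 p.2.
  exact/sumE/trepr_teq.
elim=> {a b} //.
- by move=> a b c _ -> _ ->.
- by move=> a a' b b' _ Ea _ Eb; rewrite !big_cat /= Ea Eb.
- by move=> a b; rewrite !big_cat /= addrC.
- by move=> n; rewrite big_seq1 big_nil phi0l.
- by move=> n; rewrite big_seq1 big_nil phi0r.
- by move=> m m' n; rewrite !big_cons !big_nil !addr0 phiDl.
- by move=> m n n'; rewrite !big_cons !big_nil !addr0 phiDr.
- by move=> m r n; rewrite !big_seq1 phiA.
Qed.

Lemma tliftE m n : tlift phi (tpure m n) = phi m n.
Proof. by rewrite tlift_pi big_seq1. Qed.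

Lemma tliftD : {morph tlift phi : x y / x + y}.
Proof.
move=> x y; rewrite -[x]treprK -[y]treprK [in LHS]/GRing.add /= pi_tadd.
by rewrite !tlift_pi big_cat.
Qed.

Lemma tlift0 : tlift phi 0 = 0.
Proof. by apply: (addrI (tlift phi 0)); rewrite -tliftD !addr0. Qed.
End Lift.

End TensorProduct.

Lemma eq_tlift (R : Type) (M N V : zmodType) (ra : M -> R -> M)
    (la : R -> N -> N) (phi psi : M -> N -> V) (x : tens ra la) :
  (forall m n, phi m n = psi m n) -> tlift phi x = tlift psi x.
Proof. by move=> h; apply: eq_bigr => p _. Qed.

Lemma tlift_addf (R : Type) (M N V : zmodType) (ra : M -> R -> M)
    (la : R -> N -> N) (phi psi : M -> N -> V) (x : tens ra la) :
  tlift (fun m n => phi m n + psi m n) x = tlift phi x + tlift psi x.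
Proof. exact: big_split. Qed.

Section Semisimple.
Variable R : pzRingType.

Definition right_ideal (I : set R) : Prop :=
  [/\ I 0, forall x y, I x -> I y -> I (x + y)
    & forall x r, I x -> I (x * r)].

(* The regular right module is semisimple: each submodule is a summand. *)
Definition semisimple_ring : Prop :=
  forall I : set R, right_ideal I -> exists J : set R,
    [/\ right_ideal J, forall x, I x -> J x -> x = 0
      & forall x, exists a b, [/\ I a, J b & x = a + b]].
End Semisimple.

Section EnvelopingAlgebra.
Variables (k : fieldType) (S : algType k).

(* S (x)_k S^op *)
Definition envalg : Type :=
  tens (fun (a : S) (c : k) => c *: a) (fun (c : k) (b : S) => c *: b).
HB.instance Definition _ := GRing.Zmodule.on envalg.

Definition env_pure (a b : S) : envalg := tpure _ _ a b.
Definition env_one : envalg := env_pure 1 1.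

(* (a (x) b) (c (x) d) = a c (x) d b, as the second factor is opposite. *)
Definition env_mul (x y : envalg) : envalg :=
  tlift (fun a b => tlift (fun c d => env_pure (a * c) (d * b)) y) x.

Lemma env_mul_inner a b :
  balanced (fun (a : S) (c : k) => c *: a) (fun (c : k) (b : S) => c *: b)
    (fun c d => env_pure (a * c) (d * b)).
Proof.
split=> [m m' n|m n n'|m r n]; rewrite /env_pure.
- by rewrite mulrDr tpureDl.
- by rewrite mulrDl tpureDr.
- by rewrite -scalerAr -scalerAl tpure_bal.
Qed.

Lemma env_mul_outer y :
  balanced (fun (a : S) (c : k) => c *: a) (fun (c : k) (b : S) => c *: b)
    (fun a b => tlift (fun c d => env_pure (a * c) (d * b)) (y : envalg)).
Proof.
split=> [m m' n|m n n'|m r n]; rewrite /env_pure -?tlift_addf;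
  apply: eq_tlift => c d.
- by rewrite mulrDl tpureDl.
- by rewrite mulrDr tpureDr.
- by rewrite -scalerAr -scalerAl tpure_bal.
Qed.

Lemma env_mulDl : left_distributive env_mul +%R.
Proof. by move=> x y z; exact: (tliftD (env_mul_outer z)). Qed.

Lemma env_mulDr : right_distributive env_mul +%R.
Proof.
move=> x y z; rewrite /env_mul -tlift_addf; apply: eq_tlift => a b.
exact: (tliftD (env_mul_inner a b)).
Qed.

Lemma env_mulE a b c d :
  env_mul (env_pure a b) (env_pure c d) = env_pure (a * c) (d * b).
Proof.
by rewrite /env_mul (tliftE (env_mul_outer _)) (tliftE (env_mul_inner _ _)).
Qed.

Lemma env_ext (f g : envalg -> envalg) :
  {morph f : x y / x + y} -> {morph g : x y / x + y} ->
  (forall m n, f (env_pure m n) = g (env_pure m n)) -> f =1 g.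
Proof. exact: tens_ext. Qed.

Lemma env_mulA : associative env_mul.
Proof.
move=> x y z; apply: (env_ext (f := fun x => env_mul x (env_mul y z))
  (g := fun x => env_mul (env_mul x y) z)) x => [u v|u v|a b].
- exact: env_mulDl.
- by rewrite !env_mulDl.
apply: (env_ext (f := fun y => env_mul (env_pure a b) (env_mul y z))
  (g := fun y => env_mul (env_mul (env_pure a b) y) z)) y => [u v|u v|c d].
- by rewrite env_mulDl env_mulDr.
- by rewrite env_mulDr env_mulDl.
apply: (env_ext (f := fun z => env_mul (env_pure a b) (env_mul (env_pure c d) z))
  (g := fun z => env_mul (env_mul (env_pure a b) (env_pure c d)) z)) z
  => [u v|u v|e f].
- by rewrite !env_mulDr.
- by rewrite !env_mulDr.
by rewrite !env_mulE !mulrA.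
Qed.

Lemma env_mul1 : left_id env_one env_mul.
Proof.
apply: env_ext => [u v|//|a b]; first exact: env_mulDr.
by rewrite env_mulE mul1r mulr1.
Qed.

Lemma env_mulr1 : right_id env_one env_mul.
Proof.
apply: (env_ext (f := fun x => env_mul x env_one) (g := id)) => [u v|//|a b].
  exact: env_mulDl.
by rewrite env_mulE mul1r mulr1.
Qed.

HB.instance Definition _ := GRing.Zmodule_isPzRing.Build envalg
  env_mulA env_mul1 env_mulr1 env_mulDl env_mulDr.
End EnvelopingAlgebra.

Section Graded.
Variables (k : fieldType) (S : falgType k).

(* Right S-modules are left modules over the converse ring S^c. *)
Definition rmul (M : lmodType S^c) (m : M) (s : S) : M := (s : S^c) *: m.

(* A graded right S-module M = (+)_i M_i, given by the projections onto the
   homogeneous components; M_i is the set of m with [gpr i m = m]. *)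
Record gmod := GMod {
  gcar :> lmodType S^c;
  gpr : int -> gcar -> gcar;
  gpr_linear : forall i, linear (gpr i);
  gprK : forall i j m, gpr i (gpr j m) = if i == j then gpr j m else 0;
  gpr_sum : forall m, exists2 s : seq int, uniq s & m = \sum_(i <- s) gpr i m
}.

Definition homog (M : gmod) (i : int) (m : M) : Prop := gpr i m = m.

(* A graded S-S-bimodule on which k acts centrally. *)
Record gbimod := GBimod {
  bcar :> gmod;
  lmul : S -> bcar -> bcar;
  lmulA : forall s t b, lmul s (lmul t b) = lmul (s * t) b;
  lmul1 : forall b, lmul 1 b = b;
  lmulDr : forall s, {morph lmul s : b c / b + c};
  lmulDl : forall b s t, lmul (s + t) b = lmul s b + lmul t b;
  lmul_rmul : forall s b t, lmul s (rmul b t) = rmul (lmul s b) t;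
  lmul_central : forall (c : k) b, lmul c%:A b = rmul b c%:A;
  gpr_lmul : forall i s b, gpr i (lmul s b) = lmul s (gpr i b)
}.
Arguments lmul {_}.

Section GradedTheory.
Variable M : gmod.
Implicit Types (m : M) (i j : int).

Lemma gprD i : {morph @gpr M i : x y / x + y}.
Proof. by move=> x y; have := gpr_linear i 1 x y; rewrite !scale1r. Qed.
Lemma gpr0 i : gpr i (0 : M) = 0.
Proof. by apply: (addrI (gpr i 0)); rewrite -gprD !addr0. Qed.
Lemma gprZ i (s : S^c) m : gpr i (s *: m) = s *: gpr i m.
Proof. by have := gpr_linear i s m 0; rewrite gpr0 !addr0. Qed.
Lemma gpr_rmul i m s : gpr i (rmul m s) = rmul (gpr i m) s.
Proof. exact: gprZ. Qed.
Lemma gpr_big i I (r : seq I) P (F : I -> M) :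
  gpr i (\sum_(j <- r | P j) F j) = \sum_(j <- r | P j) gpr i (F j).
Proof. exact: (big_morph _ (gprD i) (gpr0 i)). Qed.

Definition gsupp m : seq int := projT1 (cid2 (gpr_sum m)).
Lemma gsupp_uniq m : uniq (gsupp m).
Proof. by rewrite /gsupp; case: cid2. Qed.
Lemma gsuppE m : m = \sum_(i <- gsupp m) gpr i m.
Proof. by rewrite /gsupp; case: cid2. Qed.

Lemma gpr_out i (s : seq int) m :
  m = \sum_(j <- s) gpr j m -> i \notin s -> gpr i m = 0.
Proof.
move=> -> /negP si; rewrite gpr_big big_seq big1 // => j js.
by rewrite gprK; case: eqP => // ij; rewrite ij in si.
Qed.

(* [Phi i] is applied to the component of degree i. *)
Definition gsumf (V : zmodType) (Phi : int -> M -> V) m : V :=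
  \sum_(i <- gsupp m) Phi i (gpr i m).

Section GSum.
Variables (V : zmodType) (Phi : int -> M -> V).
Hypothesis PhiD : forall i, {morph Phi i : x y / x + y}.

Lemma Phi0 i : Phi i 0 = 0.
Proof. by apply: (addrI (Phi i 0)); rewrite -PhiD !addr0. Qed.

Lemma gsumf_sub (s : seq int) m : uniq s -> {subset gsupp m <= s} ->
  gsumf Phi m = \sum_(i <- s) Phi i (gpr i m).
Proof.
move=> us sub; rewrite [RHS](bigID (mem (gsupp m))) /=.
rewrite [X in _ + X]big1 ?addr0 => [|i ni]; last first.
  by rewrite (gpr_out (gsuppE m) ni) Phi0.
rewrite -big_filter; apply: perm_big; apply: uniq_perm.
- exact: gsupp_uniq.
- exact: filter_uniq.
move=> i; rewrite mem_filter /=.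
by case: (boolP (i \in gsupp m)) => //= /sub ->.
Qed.

Lemma gsumfD : {morph gsumf Phi : x y / x + y}.
Proof.
move=> x y; set s := undup (gsupp x ++ gsupp y ++ gsupp (x + y)).
have us : uniq s by exact: undup_uniq.
have sub m : {subset gsupp m <= gsupp x ++ gsupp y ++ gsupp (x + y)} ->
    gsumf Phi m = \sum_(i <- s) Phi i (gpr i m).
  by move=> h; apply: gsumf_sub => // i /h; rewrite mem_undup.
rewrite !sub -?big_split /=; last 3 first.
- by move=> i hi; rewrite !mem_cat hi !orbT.
- by move=> i hi; rewrite !mem_cat hi.
- by move=> i hi; rewrite !mem_cat hi !orbT.
by apply: eq_bigr => i _; rewrite gprD PhiD.
Qed.

Lemma gsumf_homog i m : homog i m -> gsumf Phi m = Phi i m.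
Proof.
rewrite /homog => him; set s := undup (i :: gsupp m).
have us : uniq s by exact: undup_uniq.
have ss : {subset gsupp m <= s}.
  by move=> j; rewrite mem_undup inE => ->; rewrite orbT.
have si : i \in s by rewrite mem_undup inE eqxx.
rewrite (gsumf_sub us ss) (bigD1_seq i si us) /= him big1 ?addr0 // => j ji.
by rewrite -him gprK (negPf ji) Phi0.
Qed.
End GSum.

Lemma homog_gpr i m : homog i (gpr i m).
Proof. by rewrite /homog gprK eqxx. Qed.
End GradedTheory.

(* (-1)^d x *)
Definition ksign (V : zmodType) (d : int) (x : V) : V :=
  if odd `|d|%N then - x else x.

(* x |-> (-1)^{d |x|} x for homogeneous x, extended additively *)
Definition koszul (M : gmod) (d : int) : M -> M :=
  gsumf (fun i m => ksign (d * i) m).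

Lemma ksignD (V : zmodType) d : {morph @ksign V d : x y / x + y}.
Proof. by move=> x y; rewrite /ksign; case: ifP; rewrite ?opprD. Qed.

Lemma koszulD (M : gmod) d : {morph @koszul M d : x y / x + y}.
Proof. by apply: gsumfD => i; exact: ksignD. Qed.

Lemma koszulE (M : gmod) d i (m : M) :
  homog i m -> koszul d m = ksign (d * i) m.
Proof. by apply: gsumf_homog => j; exact: ksignD. Qed.

(* M[1]_i = M_{i+1}, with the same underlying module. *)
Section Shift.
Variable M : gmod.
Lemma shift_linear i : linear (@gpr M (i + 1)).
Proof. exact: gpr_linear. Qed.
Lemma shift_gprK i j (m : M) :
  gpr (i + 1) (gpr (j + 1) m) = if i == j then gpr (j + 1) m else 0.
Proof. by rewrite gprK (inj_eq (addIr 1)). Qed.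
Lemma shift_sum (m : M) :
  exists2 s : seq int, uniq s & m = \sum_(i <- s) gpr (i + 1) m.
Proof.
exists [seq i - 1 | i <- gsupp m].
  by rewrite (map_inj_uniq (addIr _)) gsupp_uniq.
rewrite big_map {1}(gsuppE m); apply: eq_bigr => i _.
by rewrite subrK.
Qed.
Definition gshift : gmod := GMod shift_linear shift_gprK shift_sum.
Definition sigma (m : M) : gshift := m.
End Shift.

Section BShift.
Variable B : gbimod.
Definition bshift : gbimod :=
  @GBimod (gshift B) (@lmul B) (@lmulA B) (@lmul1 B) (@lmulDr B) (@lmulDl B)
    (@lmul_rmul B) (@lmul_central B) (fun i => @gpr_lmul B (i + 1)).
End BShift.

(* S as a bimodule over itself, concentrated in degree 0 *)
Section Regular.
Let car : lmodType S^c := (S^c)^o.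
Definition reg_pr (i : int) (x : car) : car := if i == 0 then x else 0.
Lemma reg_pr_linear i : linear (reg_pr i).
Proof.
by move=> a x y; rewrite /reg_pr; case: eqP; rewrite // scaler0 addr0.
Qed.
Lemma reg_prK i j x : reg_pr i (reg_pr j x) = if i == j then reg_pr j x else 0.
Proof.
rewrite /reg_pr; case: (eqVneq j 0) => [->|j0]; first by case: (i == 0).
by case: ifP; case: ifP.
Qed.
Lemma reg_pr_sum x :
  exists2 s : seq int, uniq s & x = \sum_(i <- s) reg_pr i x.
Proof. by exists [:: 0] => //; rewrite big_seq1 /reg_pr eqxx. Qed.
Definition greg : gmod := GMod reg_pr_linear reg_prK reg_pr_sum.
Definition reg_lmul (s : S) (x : greg) : greg := s * (x : S).
Lemma reg_lmulA s t b : reg_lmul s (reg_lmul t b) = reg_lmul (s * t) b.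
Proof. exact: (@mulrA S). Qed.
Lemma reg_lmul1 b : reg_lmul 1 b = b.
Proof. exact: (@mul1r S). Qed.
Lemma reg_lmulDr s : {morph reg_lmul s : b c / b + c}.
Proof. exact: (@mulrDr S s). Qed.
Lemma reg_lmulDl b s t : reg_lmul (s + t) b = reg_lmul s b + reg_lmul t b.
Proof. exact: (@mulrDl S). Qed.
Lemma reg_lmul_rmul s b t : reg_lmul s (rmul b t) = rmul (reg_lmul s b) t.
Proof. exact: (@mulrA S). Qed.
Lemma reg_central (c : k) b : reg_lmul c%:A b = rmul b c%:A.
Proof.
by rewrite /reg_lmul mulr_algl; apply: esym; exact: (mulr_algr c (b : S)).
Qed.
Lemma reg_gpr_lmul i s (b : greg) : gpr i (reg_lmul s b) = reg_lmul s (gpr i b).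
Proof. by rewrite /= /reg_pr; case: eqP => // _; rewrite /reg_lmul mulr0. Qed.
Definition breg : gbimod :=
  GBimod reg_lmulA reg_lmul1 reg_lmulDr reg_lmulDl reg_lmul_rmul reg_central
    reg_gpr_lmul.
End Regular.

Section TensorModule.
Variables (M : gmod) (B : gbimod).

(* M (x)_S B *)
Definition mtens : Type := tens (@rmul M) (@lmul B).
HB.instance Definition _ := GRing.Zmodule.on mtens.

Definition pt (m : M) (b : B) : mtens := tpure _ _ m b.

Notation balancedS := (balanced (@rmul M) (@lmul B)).

Lemma rmulDl (N : lmodType S^c) s : {morph @rmul N ^~ s : x y / x + y}.
Proof. by move=> x y; rewrite /rmul scalerDr. Qed.
Lemma rmulDr (N : lmodType S^c) (x : N) s t :
  rmul x (s + t) = rmul x s + rmul x t.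
Proof. exact: scalerDl. Qed.
Lemma rmulA (N : lmodType S^c) (x : N) s t :
  rmul (rmul x s) t = rmul x (s * t).
Proof. by rewrite /rmul scalerA. Qed.
Lemma rmul1 (N : lmodType S^c) (x : N) : rmul x 1 = x.
Proof. exact: scale1r. Qed.

(* (m (x) b) s = m (x) b s *)
Definition mt_scale (s : S^c) (x : mtens) : mtens :=
  tlift (fun m b => pt m (s *: b)) x.

Lemma mt_scale_bal (s : S^c) : balancedS (fun m b => pt m (s *: b)).
Proof.
split=> [m m' n|m n n'|m r n]; rewrite /pt.
- exact: tpureDl.
- by rewrite scalerDr tpureDr.
- by rewrite tpure_bal -[s *: n]/(rmul n s) lmul_rmul.
Qed.

Lemma mt_scaleE s m b : mt_scale s (pt m b) = pt m (s *: b).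
Proof. exact: (tliftE (mt_scale_bal s)). Qed.

Lemma mt_scaleDr : right_distributive mt_scale +%R.
Proof. by move=> s; exact: (tliftD (mt_scale_bal s)). Qed.

Lemma mt_ext (V : zmodType) (f g : mtens -> V) :
  {morph f : x y / x + y} -> {morph g : x y / x + y} ->
  (forall m n, f (pt m n) = g (pt m n)) -> f =1 g.
Proof. exact: tens_ext. Qed.

Lemma mt_scaleA s t x : mt_scale s (mt_scale t x) = mt_scale (s * t) x.
Proof.
apply: (mt_ext (f := mt_scale s \o mt_scale t)) x => [x y|x y|m b] /=.
- by rewrite !mt_scaleDr.
- by rewrite !mt_scaleDr.
- by rewrite !mt_scaleE scalerA.
Qed.

Lemma mt_scale1 : left_id 1 mt_scale.
Proof.
apply: mt_ext => // [x y|m b]; first by rewrite mt_scaleDr.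
by rewrite mt_scaleE scale1r.
Qed.

Lemma mt_scaleDl x : {morph mt_scale^~ x : s t / s + t}.
Proof.
move=> s t; rewrite /mt_scale -tlift_addf; apply: eq_tlift => m b.
by rewrite scalerDl /pt tpureDr.
Qed.

HB.instance Definition _ := GRing.Zmodule_isLmodule.Build S^c mtens
  mt_scaleA mt_scale1 mt_scaleDr mt_scaleDl.

Lemma mtZ (s : S^c) m b : s *: pt m b = pt m (s *: b).
Proof. exact: mt_scaleE. Qed.

(* (M (x) B)_n is the sum of the M_i (x) B_{n-i}. *)
Definition mt_pr (n : int) (x : mtens) : mtens :=
  tlift (fun m b => gsumf (fun i m' => pt m' (gpr (n - i) b)) m) x.

Lemma mt_pr_bal n :
  balancedS (fun m b => gsumf (fun i m' => pt m' (gpr (n - i) b)) m).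
Proof.
split=> [m m' b|m b b'|m s b].
- by apply: gsumfD => i x y; rewrite /pt tpureDl.
- rewrite /gsumf -big_split; apply: eq_bigr => i _.
  by rewrite gprD /pt tpureDr.
set t := undup (gsupp (rmul m s) ++ gsupp m).
have sub x Phi : {subset gsupp x <= gsupp (rmul m s) ++ gsupp m} ->
    (forall i, {morph Phi i : x y / x + y}) ->
    gsumf Phi x = \sum_(i <- t) Phi i (gpr i x) :> mtens.
  move=> h PhiD; apply: gsumf_sub => //; first exact: undup_uniq.
  by move=> i /h; rewrite mem_undup.
rewrite !sub; last 4 first.
- by move=> i hi; rewrite mem_cat hi orbT.
- by move=> i x y; rewrite /pt tpureDl.
- by move=> i hi; rewrite mem_cat hi.
- by move=> i x y; rewrite /pt tpureDl.
by apply: eq_bigr => i _; rewrite gpr_rmul gpr_lmul /pt tpure_bal.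
Qed.

Lemma mt_prD n : {morph mt_pr n : x y / x + y}.
Proof. exact: (tliftD (mt_pr_bal n)). Qed.

Lemma mt_pr0 n : mt_pr n 0 = 0.
Proof. exact: (tlift0 (mt_pr_bal n)). Qed.

Lemma mt_prE n m b :
  mt_pr n (pt m b) = gsumf (fun i m' => pt m' (gpr (n - i) b)) m.
Proof. exact: (tliftE (mt_pr_bal n)). Qed.

Lemma mt_pr_homog n i j m b : homog i m -> homog j b ->
  mt_pr n (pt m b) = if n == i + j then pt m b else 0.
Proof.
move=> hm hb; rewrite mt_prE (gsumf_homog _ hm); last first.
  by move=> l x y; rewrite /pt tpureDl.
rewrite -hb gprK subr_eq [j + i]addrC; case: eqP => // _.
by rewrite /pt tpure0r.
Qed.

Lemma mt_homog_ind (P : mtens -> Prop) :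
  P 0 -> (forall i j m b x, homog i m -> homog j b -> P x -> P (pt m b + x)) ->
  forall x, P x.
Proof.
move=> P0 PD; apply: tens_ind => // m b.
rewrite (gsuppE m) tpure_suml; elim: (gsupp m) => [|i s IH] x Px.
  by rewrite big_nil add0r.
rewrite big_cons -addrA; have {IH Px} := IH _ Px; move: (_ + x) => {}x.
rewrite {1}(gsuppE b) tpure_sumr; elim: (gsupp b) => [|j t IH] Px.
  by rewrite big_nil add0r.
rewrite big_cons -addrA; apply: (PD i j) (IH Px); exact: homog_gpr.
Qed.

Lemma mt_pr_linear n : linear (mt_pr n).
Proof.
move=> s x y; rewrite mt_prD; congr (_ + _); move: x.
apply: (mt_ext (f := mt_pr n \o *:%R s) (g := *:%R s \o mt_pr n)) =>
  [u v|u v|m b] /=.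
- by rewrite scalerDr mt_prD.
- by rewrite mt_prD scalerDr.
rewrite mtZ !mt_prE scaler_sumr; apply: eq_bigr => i _.
by rewrite gprZ mtZ.
Qed.

Lemma mt_prK i j x :
  mt_pr i (mt_pr j x) = if i == j then mt_pr j x else 0.
Proof.
move: x; apply: mt_homog_ind => [|p q m b x hm hb IH].
  by rewrite !mt_pr0; case: ifP.
rewrite !mt_prD IH (mt_pr_homog _ hm hb).
case: (altP (j =P p + q)) => [->|jpq]; last by rewrite mt_pr0 !add0r.
by rewrite (mt_pr_homog _ hm hb); case: eqP => _ //; rewrite addr0.
Qed.

Lemma mt_pr_sum x :
  exists2 s : seq int, uniq s & x = \sum_(i <- s) mt_pr i x.
Proof.
suff [s hs] : exists s : seq int, forall t, uniq t -> {subset s <= t} ->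
    x = \sum_(i <- t) mt_pr i x.
  exists (undup s); first exact: undup_uniq.
  by apply: hs; [exact: undup_uniq | move=> i; rewrite mem_undup].
move: x; apply: mt_homog_ind => [|p q m b x hm hb [s IH]].
  by exists [::] => t _ _; rewrite big1 // => i _; rewrite mt_pr0.
exists (p + q :: s) => t ut st.
rewrite (eq_bigr (fun i => mt_pr i (pt m b) + mt_pr i x)) => [|i _];
  last exact: mt_prD.
rewrite big_split /= -IH // => [|i si]; last by rewrite st // inE si orbT.
congr (_ + _); rewrite (bigD1_seq (p + q)) //=; last by rewrite st // inE eqxx.
rewrite (mt_pr_homog _ hm hb) eqxx big1 ?addr0 // => i /negPf ipq.
by rewrite (mt_pr_homog _ hm hb) ipq.
Qed.

Definition gtens : gmod := GMod mt_pr_linear mt_prK mt_pr_sum.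
End TensorModule.

Section TensorBimodule.
Variables A B : gbimod.

(* s (a (x) b) = (s a) (x) b *)
Definition bt_lmul (s : S) (x : gtens A B) : gtens A B :=
  tlift (fun a b => pt (lmul s a) b) (x : mtens A B).

Lemma bt_lmul_bal s :
  balanced (@rmul A) (@lmul B) (fun a b => pt (B := B) (lmul s a) b).
Proof.
split=> [m m' n|m n n'|m r n]; rewrite /pt.
- by rewrite lmulDr tpureDl.
- exact: tpureDr.
- by rewrite lmul_rmul tpure_bal.
Qed.

Lemma bt_lmulDr s : {morph bt_lmul s : b c / b + c}.
Proof. exact: (tliftD (bt_lmul_bal s)). Qed.

Lemma bt_lmulE s a b :
  bt_lmul s (pt a b : mtens A B) = (pt (lmul s a) b : mtens A B).
Proof. exact: (tliftE (bt_lmul_bal s)). Qed.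

Lemma bt_lmul_0 s : bt_lmul s 0 = 0.
Proof. exact: (tlift0 (bt_lmul_bal s)). Qed.

Lemma bt_lmulA s t b : bt_lmul s (bt_lmul t b) = bt_lmul (s * t) b.
Proof.
move: b; apply: (mt_ext (f := bt_lmul s \o bt_lmul t)) => [u v|u v|m n] /=.
- by rewrite !bt_lmulDr.
- by rewrite bt_lmulDr.
- by rewrite !bt_lmulE lmulA.
Qed.

Lemma bt_lmul1 b : bt_lmul 1 b = b.
Proof.
move: b; apply: mt_ext => // [u v|m n]; first by rewrite bt_lmulDr.
by rewrite bt_lmulE lmul1.
Qed.

Lemma bt_lmulDl b s t : bt_lmul (s + t) b = bt_lmul s b + bt_lmul t b.
Proof.
rewrite /bt_lmul -tlift_addf; apply: eq_tlift => m n.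
by rewrite lmulDl /pt tpureDl.
Qed.

Lemma bt_lmul_rmul s b t : bt_lmul s (rmul b t) = rmul (bt_lmul s b) t.
Proof.
move: b; apply: (mt_ext (f := fun b => bt_lmul s (rmul b t))
  (g := fun b => rmul (bt_lmul s b) t)) => [u v|u v|m n].
- by rewrite rmulDl bt_lmulDr.
- by rewrite bt_lmulDr rmulDl.
- by rewrite bt_lmulE /rmul !mtZ bt_lmulE.
Qed.

Lemma bt_central (c : k) b : bt_lmul c%:A b = rmul b c%:A.
Proof.
move: b; apply: (mt_ext (g := (@rmul (gtens A B))^~ c%:A)) => [u v|u v|m n].
- by rewrite bt_lmulDr.
- by rewrite rmulDl.
rewrite bt_lmulE lmul_central /pt tpure_bal lmul_central.
by rewrite /rmul [in RHS]mtZ.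
Qed.

Lemma bt_gpr_lmul i s (b : gtens A B) :
  gpr i (bt_lmul s b) = bt_lmul s (gpr i b).
Proof.
move: b; apply: mt_homog_ind => [|p q m n x hm hn IH].
  by rewrite gpr0 bt_lmul_0 gpr0.
rewrite bt_lmulDr !gprD IH bt_lmulDr; congr (_ + _).
have hsm : homog p (lmul s m) by rewrite /homog gpr_lmul hm.
rewrite bt_lmulE /= (mt_pr_homog i hsm hn) (mt_pr_homog i hm hn).
by case: eqP => _; rewrite ?bt_lmulE ?bt_lmul_0.
Qed.

Definition btens : gbimod :=
  GBimod bt_lmulA bt_lmul1 bt_lmulDr bt_lmulDl bt_lmul_rmul bt_central
    bt_gpr_lmul.
End TensorBimodule.

(* (+)_n F_n, as the finitely supported families *)
Section DirectSum.
Variable F : nat -> gbimod.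

Record dsum : Type := DSum {
  dval :> forall n, F n;
  dval_fin : exists N, forall n, (N <= n)%N -> dval n = 0
}.

HB.instance Definition _ := gen_eqMixin dsum.
HB.instance Definition _ := gen_choiceMixin dsum.

Lemma dsum_ext (x y : dsum) : (forall n, x n = y n) -> x = y.
Proof.
case: x y => [x hx] [y hy] /= xy.
have {}xy : x = y by apply: functional_extensionality_dep.
by case: _ / xy hy => hy; congr DSum; exact: Prop_irrelevance.
Qed.

Lemma dadd_fin (x y : dsum) :
  exists N, forall n, (N <= n)%N -> x n + y n = 0.
Proof.
case: (dval_fin x) (dval_fin y) => N hN [N' hN']; exists (maxn N N') => n.
by rewrite geq_max => /andP[/hN -> /hN' ->]; rewrite addr0.
Qed.
Definition dadd (x y : dsum) : dsum := DSum (dadd_fin x y).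

Lemma dzero_fin : exists N, forall n, (N <= n)%N -> (0 : F n) = 0.
Proof. by exists 0%N. Qed.
Definition dzero : dsum := DSum dzero_fin.

Section Map.
Variable phi : forall n, F n -> F n.
Hypothesis phi0 : forall n, phi (0 : F n) = 0.
Lemma dmap_fin (x : dsum) :
  exists N, forall n, (N <= n)%N -> phi (x n) = 0.
Proof. by case: (dval_fin x) => N hN; exists N => n /hN ->. Qed.
Definition dmap (x : dsum) : dsum := DSum (dmap_fin x).
End Map.

Definition dopp : dsum -> dsum := 
  dmap (phi := fun n => -%R) (fun n => oppr0 (F n)).
Lemma dopE x n : dopp x n = - x n.
Proof. by []. Qed.

Lemma daddA : associative dadd.
Proof. by move=> x y z; apply: dsum_ext => n /=; rewrite addrA. Qed.
Lemma daddC : commutative dadd.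
Proof. by move=> x y; apply: dsum_ext => n /=; rewrite addrC. Qed.
Lemma dadd0 : left_id dzero dadd.
Proof. by move=> x; apply: dsum_ext => n /=; rewrite add0r. Qed.
Lemma daddN : left_inverse dzero dopp dadd.
Proof. by move=> x; apply: dsum_ext => n; exact: addNr. Qed.

HB.instance Definition _ := GRing.isZmodule.Build dsum daddA daddC dadd0 daddN.

Definition dscale (s : S^c) : dsum -> dsum := 
  dmap (phi := fun n => *:%R s) (fun n => scaler0 (F n) s).
Lemma dscaleE s x n : dscale s x n = s *: x n.
Proof. by []. Qed.
Lemma dscaleA s t x : dscale s (dscale t x) = dscale (s * t) x.
Proof. by apply: dsum_ext => n; rewrite !dscaleE scalerA. Qed.
Lemma dscale1 : left_id 1 dscale.
Proof. by move=> x; apply: dsum_ext => n; rewrite dscaleE scale1r. Qed.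
Lemma dscaleDr : right_distributive dscale +%R.
Proof.
by move=> s x y; apply: dsum_ext => n; exact: scalerDr.
Qed.
Lemma dscaleDl x : {morph dscale^~ x : s t / s + t}.
Proof.
by move=> s t; apply: dsum_ext => n; exact: scalerDl.
Qed.

HB.instance Definition _ := GRing.Zmodule_isLmodule.Build S^c dsum
  dscaleA dscale1 dscaleDr dscaleDl.

Lemma dvalD (x y : dsum) n : (x + y) n = x n + y n. Proof. by []. Qed.
Lemma dval0 n : (0 : dsum) n = 0. Proof. by []. Qed.
Lemma dvalZ (s : S^c) (x : dsum) n : (s *: x) n = s *: x n.
Proof. exact: dscaleE. Qed.
Lemma dval_sum I (r : seq I) (G : I -> dsum) n :
  (\sum_(i <- r) G i) n = \sum_(i <- r) G i n.
Proof. exact: (big_morph (fun x : dsum => x n) (fun x y => dvalD x y n)). Qed.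

Definition dpr (i : int) : dsum -> dsum := 
  dmap (phi := fun n => gpr i) (fun n => gpr0 (F n) i).
Lemma dprE i x n : dpr i x n = gpr i (x n).
Proof. by []. Qed.
Lemma dpr_linear i : linear (dpr i).
Proof.
move=> s x y; apply: dsum_ext => n.
by rewrite dprE !dvalD !dvalZ !dprE; exact: gpr_linear.
Qed.
Lemma dprK i j x : dpr i (dpr j x) = if i == j then dpr j x else 0.
Proof.
by apply: dsum_ext => n; rewrite !dprE gprK; case: ifP; rewrite ?dprE.
Qed.
Lemma dpr_sum x : exists2 s : seq int, uniq s & x = \sum_(i <- s) dpr i x.
Proof.
case: (dval_fin x) => N hN.
set s := undup (flatten [seq gsupp (x n) | n <- iota 0 N]).
exists s; first exact: undup_uniq.
apply: dsum_ext => n; rewrite dval_sum (eq_bigr (fun i => gpr i (x n))) =>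
  [|i _]; last exact: dprE.
have [/hN ->|nN] := leqP N n; first by rewrite big1 // => i _; rewrite gpr0.
rewrite {1}(gsuppE (x n)) -/(gsumf (fun i y => y) (x n)).
apply: gsumf_sub => //; first exact: undup_uniq.
move=> i hi; rewrite mem_undup; apply/flattenP; exists (gsupp (x n)) => //.
by apply/mapP; exists n => //; rewrite mem_iota.
Qed.
Definition dsum_gmod : gmod := GMod dpr_linear dprK dpr_sum.

Lemma lmul0 (B : gbimod) s : lmul s (0 : B) = 0.
Proof. by apply: (addrI (lmul s 0)); rewrite -lmulDr !addr0. Qed.
Definition dlmul (s : S) : dsum_gmod -> dsum_gmod := 
  dmap (phi := fun n => lmul s) (fun n => lmul0 (F n) s).
Lemma dlmulE s (x : dsum) n : (dlmul s x : dsum) n = lmul s (x n).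
Proof. by []. Qed.
Lemma dlmulA s t b : dlmul s (dlmul t b) = dlmul (s * t) b.
Proof. by apply: dsum_ext => n; rewrite !dlmulE lmulA. Qed.
Lemma dlmul1 b : dlmul 1 b = b.
Proof. by apply: dsum_ext => n; rewrite dlmulE lmul1. Qed.
Lemma dlmulDr s : {morph dlmul s : b c / b + c}.
Proof.
by move=> b c; apply: dsum_ext => n; rewrite dvalD !dlmulE -lmulDr.
Qed.
Lemma dlmulDl b s t : dlmul (s + t) b = dlmul s b + dlmul t b.
Proof. by apply: dsum_ext => n; rewrite dvalD !dlmulE lmulDl. Qed.
Lemma dlmul_rmul s b t : dlmul s (rmul b t) = rmul (dlmul s b) t.
Proof.
apply: dsum_ext => n.
by rewrite [in RHS]/rmul dvalZ !dlmulE [in LHS]/rmul dvalZ; exact: lmul_rmul.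
Qed.
Lemma dlmul_central (c : k) b : dlmul c%:A b = rmul b c%:A.
Proof.
by apply: dsum_ext => n; rewrite dlmulE lmul_central [in RHS]/rmul dvalZ.
Qed.
Lemma dpr_lmul i s (b : dsum_gmod) : gpr i (dlmul s b) = dlmul s (gpr i b).
Proof.
by apply: dsum_ext => n; exact: gpr_lmul.
Qed.

Definition bdsum : gbimod :=
  GBimod dlmulA dlmul1 dlmulDr dlmulDl dlmul_rmul dlmul_central dpr_lmul.

(* transport along n = n' (and 0 if n <> n') *)
Definition fcast (n n' : nat) (x : F n) : F n' :=
  match @eqP _ n n' with
  | ReflectT e => eq_rect n (fun i => F i) x n' e
  | ReflectF _ => 0
  end.

Lemma fcast_id n (x : F n) : fcast n x = x.
Proof. by rewrite /fcast; case: eqP => // e; rewrite (eq_axiomK e). Qed.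

Lemma fcast_neq n n' (x : F n) : n <> n' -> fcast n' x = 0.
Proof. by rewrite /fcast; case: eqP. Qed.

Lemma din_fin n (x : F n) :
  exists N, forall m, (N <= m)%N -> fcast m x = 0.
Proof.
by exists n.+1 => m nm; rewrite fcast_neq // => e; rewrite e ltnn in nm.
Qed.
Definition din n (x : F n) : bdsum := DSum (din_fin x).

Definition dbound (x : bdsum) : nat := projT1 (cid (dval_fin x)).

Lemma dboundP (x : bdsum) n : (dbound x <= n)%N -> (x : dsum) n = 0.
Proof. by rewrite /dbound; case: cid => N /= hN; exact: hN. Qed.

(* the map induced by additive maps defined on the summands *)
Definition dlift (V : zmodType) (phi : forall n, F n -> V) (x : bdsum) : V :=
  \sum_(n < dbound x) phi n ((x : dsum) n).

Lemma dliftE (V : zmodType) (phi : forall n, F n -> V) n (x : F n) :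
  (forall n, phi n 0 = 0) -> dlift phi (din x) = phi n x.
Proof.
move=> phi0; rewrite /dlift; have [lt_n|le_n] := ltnP n (dbound (din x)).
  rewrite (bigD1 (Ordinal lt_n)) //= fcast_id big1 ?addr0 // => m /eqP mn.
  by rewrite /= fcast_neq ?phi0 // => e; apply: mn; apply: val_inj.
rewrite big1 => [|m _]; last first.
  rewrite /= fcast_neq ?phi0 // => e.
  by have := leq_trans (ltn_ord m) le_n; rewrite -e ltnn.
by have := dboundP le_n; rewrite /= fcast_id => ->; rewrite phi0.
Qed.
End DirectSum.

(* f (x) g for g of degree 0 *)
Definition tmap (M M' : gmod) (B B' : gbimod) (f : M -> M') (g : B -> B')
    (x : gtens M B) : gtens M' B' :=
  tlift (fun m b => pt (f m) (g b)) (x : mtens M B).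

(* f (x) g for g of degree d: (f (x) g)(x (x) y) = (-1)^{d |x|} f x (x) g y *)
Definition ktens (d : int) (M M' : gmod) (B B' : gbimod) (f : M -> M')
    (g : B -> B') : gtens M B -> gtens M' B' :=
  tmap (fun m => f (koszul d m)) g.

(* m (x) (a (x) b) |-> (m (x) a) (x) b *)
Definition tassoc (M : gmod) (A B : gbimod) (x : gtens M (btens A B)) :
    gtens (gtens M A) B :=
  tlift (fun m (z : btens A B) =>
      tlift (fun a b => pt (pt m a : gtens M A) b) (z : mtens A B) :
        mtens (gtens M A) B)
    (x : mtens M (btens A B)).

Lemma tmapE (M M' : gmod) (B B' : gbimod) (f : M -> M') (g : B -> B') m b :
  linear f -> {morph g : x y / x + y} ->
  (forall s b, g (lmul s b) = lmul s (g b)) ->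
  tmap f g (pt m b) = pt (f m) (g b).
Proof.
move=> fL gD gS.
have fD : {morph f : x y / x + y}.
  by move=> x y; have := fL 1 x y; rewrite !scale1r.
have f0 : f 0 = 0 by apply: (addrI (f 0)); rewrite -fD !addr0.
have fZ s x : f (rmul x s) = rmul (f x) s.
  by have := fL s x 0; rewrite f0 !addr0.
apply: (tliftE (phi := fun m b => pt (f m) (g b))); split=> [x y c|x c d|x s c];
  rewrite /pt.
- by rewrite fD tpureDl.
- by rewrite gD tpureDr.
- by rewrite fZ gS tpure_bal.
Qed.

Lemma koszul_linear (M : gmod) d : linear (@koszul M d).
Proof.
move=> s x y; rewrite koszulD; congr (_ + _).
rewrite {1}(gsuppE x) scaler_sumr.
have k0 : koszul d (0 : M) = 0.
  by apply: (addrI (koszul d 0)); rewrite -koszulD !addr0.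
rewrite (big_morph _ (koszulD d) k0) {2}/koszul /gsumf scaler_sumr.
apply: eq_bigr => i _; rewrite (@koszulE M d i); last first.
  by rewrite /homog gprZ gprK eqxx.
by rewrite /ksign; case: ifP; rewrite ?scalerN.
Qed.

Lemma ktensE d (M M' : gmod) (B B' : gbimod) (f : M -> M') (g : B -> B')
    i m b :
  linear f -> {morph g : x y / x + y} ->
  (forall s b, g (lmul s b) = lmul s (g b)) -> homog i m ->
  ktens d f g (pt m b) = ksign (d * i) (pt (f m) (g b) : gtens M' B').
Proof.
move=> fL gD gS hm; rewrite /ktens tmapE //; last first.
  by move=> s x y; rewrite koszul_linear fL.
rewrite (koszulE _ hm) /ksign; case: ifP => // _.
have fN : f (- m) = - f m.
  have f0 : f 0 = 0.
    by apply: (addrI (f 0)); have := fL 1 0 0; rewrite !scale1r !addr0 => <-.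
  by have := fL (-1) m 0; rewrite f0 !addr0 !scaleN1r.
by rewrite fN /pt tpureNl.
Qed.

Lemma tassoc_inner (M : gmod) (A B : gbimod) (m : M) :
  balanced (@rmul A) (@lmul B)
    (fun a b => pt (pt m a : gtens M A) b : mtens (gtens M A) B).
Proof.
split=> [a a' b|a b b'|a s b]; rewrite /pt.
- by rewrite tpureDr tpureDl.
- by rewrite tpureDr.
- by rewrite -tpure_bal [in RHS]/rmul [in RHS]mtZ.
Qed.

Lemma tassocE (M : gmod) (A B : gbimod) (m : M) (a : A) (b : B) :
  tassoc (pt m (pt a b : btens A B)) = pt (pt m a : gtens M A) b.
Proof.
suff bal : balanced (@rmul M) (@lmul (btens A B))
    (fun m (z : btens A B) => tlift (fun a b => pt (pt m a : gtens M A) b)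
      (z : mtens A B) : mtens (gtens M A) B).
  rewrite /tassoc; have -> := tliftE bal m (pt a b : btens A B).
  exact: (tliftE (tassoc_inner _ _ m)).
split=> [x y z|x z w|x s z].
- rewrite -tlift_addf; apply: eq_tlift => c d.
  by rewrite /pt tpureDl tpureDl.
- exact: (tliftD (tassoc_inner _ _ x)).
move: z; apply: (mt_ext (f := fun z : mtens A B => tlift
    (fun a b => pt (pt (rmul x s) a : gtens M A) b : mtens (gtens M A) B) z)
  (g := fun z : mtens A B => tlift
    (fun a b => pt (pt x a : gtens M A) b : mtens (gtens M A) B)
    (bt_lmul s z))) => [u v|u v|c d].
- exact: (tliftD (tassoc_inner _ _ (rmul x s))).
- by rewrite bt_lmulDr; exact: (tliftD (tassoc_inner _ _ x)).
rewrite bt_lmulE [LHS](tliftE (tassoc_inner _ _ _)) [RHS](tliftE (tassoc_inner _ _ _)).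
by rewrite /pt tpure_bal.
Qed.

(* right S-module morphisms of degree d *)
Definition rmor (d : int) (M N : gmod) (f : M -> N) : Prop :=
  linear f /\ forall i m, homog i m -> homog (i + d) (f m).

(* bimodule morphisms of degree d *)
Definition bmor (d : int) (A B : gbimod) (f : A -> B) : Prop :=
  rmor d f /\ forall s a, f (lmul s a) = lmul s (f a).

Section TensorPowers.
Variable A : gbimod.

Fixpoint tpow (n : nat) : gbimod :=
  if n is n'.+1 then btens A (tpow n') else breg.

(* the canonical isomorphism A^{p+q} -> A^p (x) A^q *)
Fixpoint tsplit (p q : nat) : tpow (p + q) -> btens (tpow p) (tpow q) :=
  match p with
  | 0 => fun x => pt (1 : breg) x
  | p'.+1 => fun x => tassoc (tmap (fun a => a) (@tsplit p' q) x)
  end.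

Arguments tsplit : clear implicits.

(* id^r (x) phi, for phi of degree d *)
Fixpoint idtens (r : nat) (d : int) (p q : nat) (phi : tpow p -> tpow q) :
    tpow (r + p) -> tpow (r + q) :=
  match r with
  | 0 => phi
  | r'.+1 => ktens d (fun a => a) (@idtens r' d p q phi)
  end.

(* id^r (x) phi (x) id^t on A^n, for phi : A^s -> A of degree d, n = r+s+t *)
Definition insert (r s t : nat) (d : int) (phi : tpow s -> A) (n : nat)
    (x : tpow n) : tpow (r + t.+1) :=
  @idtens r d (s + t) t.+1
    (fun y => tmap phi (fun b => b) (tsplit s t y))
    (@fcast tpow n (r + (s + t)) x).

(* M (x) A^n -> (M (x) A^p) (x) A^q, for n = p + q *)
Definition msplit (M : gmod) (p q n : nat) (x : gtens M (tpow n)) :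
    gtens (gtens M (tpow p)) (tpow q) :=
  tassoc (tmap (fun m => m) (fun y => tsplit p q (@fcast tpow n (p + q) y)) x).
End TensorPowers.
Arguments tsplit {A} p q x.

(* sum over r + s + t = n with s >= 1 *)
Definition sum3 (V : zmodType) (n : nat) (G : nat -> nat -> nat -> V) : V :=
  \sum_(r < n.+1) \sum_(s < n.+1 | (0 < s)%N)
    \sum_(t < n.+1 | (r + s + t)%N == n) G r s t.

(* sum over r + s = n *)
Definition sum2 (V : zmodType) (n : nat) (G : nat -> nat -> V) : V :=
  \sum_(r < n.+1) \sum_(s < n.+1 | (r + s)%N == n) G r s.

(* Only the operations [ainf_op n] with n >= 1 are part of the structure: the
   value at n = 0 is never used. *)
Record ainf_alg := AInfAlg {
  acar :> gbimod;
  ainf_op : forall n, tpow acar n -> acar;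
  ainf_op_mor : forall n, (0 < n)%N -> bmor (2 - n%:Z) (@ainf_op n);
  ainf_rel : forall n, (0 < n)%N -> forall x : tpow acar n,
    sum3 n (fun r s t => ksign (r + s * t)%N
      (ainf_op (insert r t (2 - s%:Z) (@ainf_op s) x))) = 0
}.

(* the inverse of a bijection *)
Definition inv_map (V W : zmodType) (f : V -> W) (y : W) : V :=
  xget 0 [set x | f x = y]%classic.

Section OverA.
Variable A : ainf_alg.

(* Families f_n : M (x) A^(n-1) -> N, n >= 1; the member with index j here is
   the map f_{j+1} defined on M (x) A^j. *)
Definition mfamily (M N : gmod) : Type := forall j, gtens M (tpow A j) -> N.

Section FamilyZmod.
Variables M N : gmod.
HB.instance Definition _ := gen_eqMixin (mfamily M N).
HB.instance Definition _ := gen_choiceMixin (mfamily M N).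
Definition fam_add (f g : mfamily M N) : mfamily M N := fun j x => f j x + g j x.
Definition fam_zero : mfamily M N := fun j x => 0.
Definition fam_opp (f : mfamily M N) : mfamily M N := fun j x => - f j x.
Lemma fam_ext (f g : mfamily M N) : (forall j x, f j x = g j x) -> f = g.
Proof.
by move=> fg; apply: functional_extensionality_dep => j; exact/funext/fg.
Qed.
Lemma fam_addA : associative fam_add.
Proof. by move=> f g h; apply: fam_ext => j x; exact: addrA. Qed.
Lemma fam_addC : commutative fam_add.
Proof. by move=> f g; apply: fam_ext => j x; exact: addrC. Qed.
Lemma fam_add0 : left_id fam_zero fam_add.
Proof. by move=> f; apply: fam_ext => j x; exact: add0r. Qed.
Lemma fam_addN : left_inverse fam_zero fam_opp fam_add.
Proof. by move=> f; apply: fam_ext => j x; exact: addNr. Qed.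
HB.instance Definition _ := GRing.isZmodule.Build (mfamily M N)
  fam_addA fam_addC fam_add0 fam_addN.
End FamilyZmod.

(* f_n has degree d + 1 - n *)
Definition fam_deg (d : int) (M N : gmod) (f : mfamily M N) : Prop :=
  forall j, rmor (d - j%:Z) (f j).

(* (g o f)_n = sum_{r+s=n, r>=1, s>=0} (-1)^{(r+1)s} g_{1+s} (f_r (x) id^s).
   Here and in [fam_alg] the variable r of the code is r - 1 of the formula; in
   [fam_mod] the variable s of the code is s - 1 of the formula. *)
Definition fam_comp (M N P : gmod) (g : mfamily N P) (f : mfamily M N) :
    mfamily M P := fun j x =>
  sum2 j (fun r s => ksign (r.+2 * s)%N
    (g s (tmap (f r) (fun b => b) (msplit r s x)))).

Arguments fam_comp {M N P} g f j x.

Definition fam_id (M : gmod) : mfamily M M := fun j =>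
  match j with
  | 0 => fun x => tlift (fun m s => rmul m (s : S)) (x : mtens M breg)
  | _.+1 => fun _ => 0
  end.

(* sum_{r+s+t=n, r,s>=1, t>=0} (-1)^{r+st} f_{r+1+t} (id^r (x) m_s (x) id^t) *)
Definition fam_alg (M N : gmod) (f : mfamily M N) : mfamily M N := fun j x =>
  sum3 j (fun r s t => ksign (r.+1 + s * t)%N
    (f _ (ktens (2 - s%:Z) (fun m => m)
            (@insert A r s t (2 - s%:Z) (@ainf_op A s) j) x))).

Arguments fam_alg {M N} f j x.

(* sum_{s+t=n, s>=1, t>=0} (-1)^{st} f_{1+t} (m^M_s (x) id^t) *)
Definition fam_mod (M N : gmod) (f : mfamily M N) (m : mfamily M M) :
    mfamily M N := fun j x =>
  sum2 j (fun s t => ksign (s.+1 * t)%N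
    (f t (tmap (m s) (fun b => b) (msplit s t x)))).

Arguments fam_mod {M N} f m j x.

Record ainf_mod := AInfMod {
  mcar :> gmod;
  mop : mfamily mcar mcar;
  mop_deg : fam_deg 1 mop;
  mop_rel : forall j x, fam_alg mop j x + fam_mod mop mop j x = 0
}.

Arguments mop : clear implicits.

Definition ainf_mor (M N : ainf_mod) (f : mfamily M N) : Prop :=
  fam_deg 0 f /\ forall j x,
    fam_alg f j x + fam_mod f (mop M) j x - fam_comp (mop N) f j x = 0.

(* f_1 : M -> N *)
Definition fam_first (M N : gmod) (f : mfamily M N) (m : M) : N :=
  f 0%N (pt m (1 : breg)).

(* sigma^{(x) n} : A^n -> A[1]^n, of degree -n *)
Fixpoint sigpow (n : nat) : tpow A n -> tpow (bshift A) n :=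
  match n with
  | 0 => fun x => x
  | n'.+1 => ktens (- n'%:Z) (@sigma A) (@sigpow n')
  end.

(* \hat m_s sigma^{(x) s} = sigma m_s *)
Definition hat_op (s : nat) (y : tpow (bshift A) s) : bshift A :=
  sigma (ainf_op (inv_map (@sigpow s) y)).

Definition bar : gbimod := bdsum (tpow (bshift A)).

Definition bar_mu : bar -> btens bar bar :=
  dlift (fun n x => sum2 n (fun p q =>
    tmap (@din (tpow (bshift A)) p) (@din (tpow (bshift A)) q)
      (tsplit p q (@fcast (tpow (bshift A)) n (p + q) x)))).

Definition bar_eps (c : bar) : S := (c : dsum (tpow (bshift A))) 0%N.

Definition bar_delta : bar -> bar :=
  dlift (fun n x => sum3 n (fun r s t =>
    @din (tpow (bshift A)) _ (insert r t 1 (@hat_op s) x))).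

Definition bar_arr (M N : gmod) : zmodType := gtens M bar -> N.

(* f^0 *)
Definition bar_first (M N : gmod) (f : bar_arr M N) (m : M) : N :=
  f (pt m (@din (tpow (bshift A)) 0 (1 : breg) : bar)).

Definition bar_comp (M N P : gmod) (g : bar_arr N P) (f : bar_arr M N) :
    bar_arr M P := fun x =>
  g (tmap f (fun c => c) (tassoc (tmap (fun m => m) bar_mu x))).

Definition bar_id (M : gmod) : bar_arr M M := fun x =>
  tlift (fun m c => rmul m (bar_eps c)) (x : mtens M bar).

(* \hat\delta (f), for f of degree d *)
Definition bar_diff (d : int) (M N : gmod) (f : bar_arr M N) : bar_arr M N :=
  fun x => ksign (d + 1) (f (ktens 1 (fun m => m) bar_delta x)).

Definition twisted (M : gmod) (u : bar_arr M M) : Prop :=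
  rmor 1 u /\ forall x, bar_diff 1 u x + bar_comp u u x = 0.

Record tgmod := TGMod {
  tcar :> gmod;
  tdiff : bar_arr tcar tcar;
  tdiffP : twisted tdiff
}.

Arguments tdiff : clear implicits.

Definition tg_mor (M N : tgmod) (f : bar_arr M N) : Prop :=
  rmor 0 f /\ forall x,
    bar_diff 0 f x + bar_comp (tdiff N) f x - bar_comp f (tdiff M) x = 0.

(* \hat f_n (sigma_M (x) sigma^{(x) n}) = sigma_N f_{n+1} *)
Definition hat_comp (M N : gmod) (f : mfamily M N) (n : nat)
    (y : gtens (gshift M) (tpow (bshift A) n)) : gshift N :=
  sigma (f n (inv_map (ktens (- n%:Z) (@sigma M) (@sigpow n)) y)).

Definition hat (M N : gmod) (f : mfamily M N) :
    bar_arr (gshift M) (gshift N) := fun x =>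
  tlift (fun m (c : bar) => dlift (fun n b => hat_comp f (pt m b)) c)
    (x : mtens (gshift M) bar).

Definition short_exact (M E N : gmod) (f : M -> E) (g : E -> N) : Prop :=
  [/\ injective f, forall e, g e = 0 <-> exists m, f m = e
    & forall n, exists e, g e = n].
End OverA.
End Graded.

Arguments mop {k S A} a j x.
Arguments tdiff {k S A} t x.
Arguments fam_comp {k S A M N P} g f j x.
Arguments fam_alg {k S A M N} f j x.
Arguments fam_mod {k S A M N} f m j x.

Section Categories.

(* A category enriched in abelian groups is presented by its objects, by
   ambient groups of arrows, and by the predicate [cmor] singling out the
   morphisms; [preadditive] states the laws for the morphisms. *)
Record catdata := CatData {
  ob : Type;
  arr : ob -> ob -> zmodType;
  cmor : forall X Y, arr X Y -> Prop;
  cidm : forall X, arr X X;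
  ccomp : forall X Y Z, arr Y Z -> arr X Y -> arr X Z
}.

Arguments cmor {c X Y} f.
Arguments cidm {c} X.
Arguments ccomp {c X Y Z} g f.

Record chom (C : catdata) (X Y : ob C) := CHom {
  harr :> arr X Y;
  harrP : cmor harr
}.

(* a class of composable pairs of arrows *)
Definition pair_class (C : catdata) : Type :=
  forall X Y Z : ob C, arr X Y -> arr Y Z -> Prop.

Section Cat.
Variable C : catdata.
Implicit Types X Y Z : ob C.

Record preadditive : Prop := Preadditive {
  cmor_id : forall X, cmor (cidm X);
  cmor_comp : forall X Y Z (g : arr Y Z) (f : arr X Y),
    cmor g -> cmor f -> cmor (ccomp g f);
  cmor0 : forall X Y, cmor (0 : arr X Y);
  cmorB : forall X Y (f g : arr X Y), cmor f -> cmor g -> cmor (f - g);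
  ccompA : forall X Y Z W (h : arr Z W) (g : arr Y Z) (f : arr X Y),
    cmor h -> cmor g -> cmor f ->
    ccomp h (ccomp g f) = ccomp (ccomp h g) f;
  ccomp1l : forall X Y (f : arr X Y), cmor f -> ccomp (cidm Y) f = f;
  ccomp1r : forall X Y (f : arr X Y), cmor f -> ccomp f (cidm X) = f;
  ccompDl : forall X Y Z (g g' : arr Y Z) (f : arr X Y),
    cmor g -> cmor g' -> cmor f ->
    ccomp (g + g') f = ccomp g f + ccomp g' f;
  ccompDr : forall X Y Z (g : arr Y Z) (f f' : arr X Y),
    cmor g -> cmor f -> cmor f' ->
    ccomp g (f + f') = ccomp g f + ccomp g f'
}.

Definition zero_object Z : Prop :=
  forall X, (forall f : chom X Z, f = 0 :> arr X Z) /\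
            (forall f : chom Z X, f = 0 :> arr Z X).

Definition biproduct X Y P : Prop :=
  exists (i : chom X P) (j : chom Y P) (p : chom P X) (q : chom P Y),
    [/\ ccomp p i = cidm X, ccomp q j = cidm Y, ccomp p j = 0, ccomp q i = 0
      & ccomp i p + ccomp j q = cidm P].

Definition additive_category : Prop :=
  [/\ preadditive, exists Z, zero_object Z
    & forall X Y, exists P, biproduct X Y P].

Definition split_idempotents : Prop :=
  forall X (e : chom X X), ccomp e e = e ->
    exists Y (p : chom X Y) (i : chom Y X),
      ccomp i p = e /\ ccomp p i = cidm Y.

Definition isom X Y (f : arr X Y) : Prop :=
  cmor f /\ exists g : chom Y X, ccomp g f = cidm X /\ ccomp f g = cidm Y.

Definition is_kernel X Y Z (f : arr X Y) (g : arr Y Z) : Prop :=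
  ccomp g f = 0 /\ forall W (h : chom W Y), ccomp g h = 0 ->
    exists h' : chom W X, ccomp f h' = h /\
      forall h'' : chom W X, ccomp f h'' = h -> h'' = h' :> arr W X.

Definition is_cokernel X Y Z (f : arr X Y) (g : arr Y Z) : Prop :=
  ccomp g f = 0 /\ forall W (h : chom Y W), ccomp h f = 0 ->
    exists h' : chom Z W, ccomp h' g = h /\
      forall h'' : chom Z W, ccomp h'' g = h -> h'' = h' :> arr Z W.

(* Isomorphic to the pair X -> X (+) Z -> Z *)
Definition split_exact X Y Z (f : arr X Y) (g : arr Y Z) : Prop :=
  [/\ cmor f, cmor g, ccomp g f = 0
    & exists (r : chom Y X) (s : chom Z Y),
        [/\ ccomp r f = cidm X, ccomp g s = cidm Z
          & ccomp f r + ccomp s g = cidm Y]].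

(* f' h = h' f is a pushout of f and h *)
Definition is_pushout X Y X' Y' (f : arr X Y) (h : arr X X')
    (f' : arr X' Y') (h' : arr Y Y') : Prop :=
  ccomp f' h = ccomp h' f /\
  forall W (a : chom X' W) (b : chom Y W), ccomp a h = ccomp b f ->
    exists c : chom Y' W, (ccomp c f' = a /\ ccomp c h' = b) /\
      forall d : chom Y' W, ccomp d f' = a /\ ccomp d h' = b ->
        d = c :> arr Y' W.

(* g h' = h g' is a pullback of g and h *)
Definition is_pullback Y Z Y' Z' (g : arr Y Z) (h : arr Z' Z)
    (g' : arr Y' Z') (h' : arr Y' Y) : Prop :=
  ccomp g h' = ccomp h g' /\
  forall W (a : chom W Z') (b : chom W Y), ccomp h a = ccomp g b ->
    exists c : chom W Y', (ccomp g' c = a /\ ccomp h' c = b) /\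
      forall d : chom W Y', ccomp g' d = a /\ ccomp h' d = b ->
        d = c :> arr W Y'.

Section Exact.
Variable E : pair_class C.

Definition inflation X Y (f : arr X Y) : Prop :=
  exists Z (g : arr Y Z), E f g.

Definition deflation Y Z (g : arr Y Z) : Prop :=
  exists X (f : arr X Y), E f g.

Record exact_category : Prop := ExactCategory {
  exact_additive : additive_category;
  exact_mor : forall X Y Z (f : arr X Y) (g : arr Y Z),
    E f g -> cmor f /\ cmor g;
  exact_ker : forall X Y Z (f : arr X Y) (g : arr Y Z),
    E f g -> is_kernel f g;
  exact_coker : forall X Y Z (f : arr X Y) (g : arr Y Z),
    E f g -> is_cokernel f g;
  exact_iso : forall X Y Z (f : arr X Y) (g : arr Y Z)
      X' Y' Z' (f' : chom X' Y') (g' : chom Y' Z')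
      (a : arr X X') (b : arr Y Y') (c : arr Z Z'),
    E f g -> isom a -> isom b -> isom c ->
    ccomp b f = ccomp f' a -> ccomp c g = ccomp g' b -> E f' g';
  exact_infl_id : forall X, inflation (cidm X);
  exact_defl_id : forall X, deflation (cidm X);
  exact_infl_comp : forall X Y Z (f : arr X Y) (g : arr Y Z),
    inflation f -> inflation g -> inflation (ccomp g f);
  exact_defl_comp : forall X Y Z (f : arr X Y) (g : arr Y Z),
    deflation f -> deflation g -> deflation (ccomp g f);
  exact_pushout : forall X Y X' (f : arr X Y) (h : chom X X'), inflation f ->
    exists Y' (f' : chom X' Y') (h' : chom Y Y'),
      is_pushout f h f' h' /\ inflation f';
  exact_pullback : forall Y Z Z' (g : arr Y Z) (h : chom Z' Z), deflation g ->
    exists Y' (g' : chom Y' Z') (h' : chom Y' Y),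
      is_pullback g h g' h' /\ deflation g'
}.
End Exact.
End Cat.

Record functor_data (C D : catdata) := FunctorData {
  fob :> ob C -> ob D;
  farr : forall X Y, arr X Y -> arr (fob X) (fob Y)
}.
Arguments farr {C D} F {X Y} f : rename.

Definition id_functor (C : catdata) : functor_data C C :=
  @FunctorData C C (fun X => X) (fun X Y f => f).

Definition comp_functor (C D B : catdata) (G : functor_data D B)
    (F : functor_data C D) : functor_data C B :=
  @FunctorData C B (fun X => G (F X)) (fun X Y f => farr G (farr F f)).

Record additive_functor (C D : catdata) (F : functor_data C D) : Prop :=
  AdditiveFunctor {
    farr_mor : forall (X Y : ob C) (f : arr X Y),
      cmor f -> cmor (farr F f);
    farr_id : forall X : ob C, farr F (cidm X) = cidm (F X);
    farr_comp : forall (X Y Z : ob C) (g : arr Y Z) (f : arr X Y),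
      cmor g -> cmor f -> farr F (ccomp g f) = ccomp (farr F g) (farr F f);
    farrD : forall (X Y : ob C) (f g : arr X Y),
      cmor f -> cmor g -> farr F (f + g) = farr F f + farr F g
  }.

Definition exact_functor (C D : catdata) (EC : pair_class C)
    (ED : pair_class D) (F : functor_data C D) : Prop :=
  additive_functor F /\
  forall (X Y Z : ob C) (f : arr X Y) (g : arr Y Z),
    EC _ _ _ f g -> ED _ _ _ (farr F f) (farr F g).

Definition naturally_isomorphic (C D : catdata) (F G : functor_data C D) :
    Prop :=
  exists eta : forall X : ob C, arr (F X) (G X),
    (forall X, isom (eta X)) /\
    forall (X Y : ob C) (f : chom X Y),
      ccomp (eta Y) (farr F f) = ccomp (farr G f) (eta X).

Definition exact_equivalence (C D : catdata) (EC : pair_class C)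
    (ED : pair_class D) (F : functor_data C D) : Prop :=
  [/\ exact_category EC, exact_category ED, exact_functor EC ED F
    & exists G : functor_data D C,
        [/\ exact_functor ED EC G,
            naturally_isomorphic (comp_functor G F) (id_functor C)
          & naturally_isomorphic (comp_functor F G) (id_functor D)]].
End Categories.

Section TheCategories.
Variables (k : fieldType) (S : falgType k) (A : ainf_alg S).

Definition Mod_inf : catdata :=
  @CatData (ainf_mod A) (fun M N => mfamily A M N)
    (fun M N => @ainf_mor k S A M N) (fun M => @fam_id k S A M)
    (fun M N P => @fam_comp k S A M N P).

Definition GMod0 : catdata :=
  @CatData (gmod S) (fun M N => mfamily A M N)
    (fun M N => @fam_deg k S A 0 M N) (fun M => @fam_id k S A M)
    (fun M N P => @fam_comp k S A M N P).

Definition TGMod0 : catdata :=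
  @CatData (tgmod A) (fun M N => bar_arr A M N)
    (fun M N => @tg_mor k S A M N) (fun M => @bar_id k S A M)
    (fun M N P => @bar_comp k S A M N P).

Definition E_inf : pair_class Mod_inf := fun M E N f g =>
  [/\ @cmor Mod_inf M E f, @cmor Mod_inf E N g, @ccomp Mod_inf M E N g f = 0
    & short_exact (fam_first f) (fam_first g)].

Definition E_tw : pair_class TGMod0 := fun M E N f g =>
  [/\ @cmor TGMod0 M E f, @cmor TGMod0 E N g, @ccomp TGMod0 M E N g f = 0
    & short_exact (bar_first f) (bar_first g)].

(* The pairs of morphisms of Mod_inf which become split exact in GMod0 when
   the module operations are forgotten *)
Definition E_forget_split : pair_class Mod_inf := fun M E N f g =>
  [/\ @cmor Mod_inf M E f, @cmor Mod_inf E N g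
    & @split_exact GMod0 M E N f g].

(* [wd] states that (M[1], \hat{m^M}) is an object of TGMod0 *)
Definition functor_G
    (wd : forall M : ainf_mod A, twisted (hat (mop M))) :
    functor_data Mod_inf TGMod0 :=
  @FunctorData Mod_inf TGMod0 (fun M => TGMod (wd M))
    (fun M N f => @hat k S A M N f).
End TheCategories.

Arguments E_inf {k S} A [X Y Z] f g.
Arguments E_tw {k S} A [X Y Z] f g.
Arguments E_forget_split {k S} A [X Y Z] f g.

(* Main.v *)
Require Import Defs.
Set Warnings "-redundant-canonical-projection,-notation-overridden,-ambiguous-paths,-notation-incompatible-prefix".
From HB Require Import structures.
From mathcomp Require Import all_boot all_order all_algebra all_field.
From mathcomp Require Import all_classical.
From mathcomp Require Import zify ring.

(* Under the identification f |-> \hat f, A_infinity-modules, their morphisms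
   and the composition of families become twisted objects, closed arrows of
   degree 0 and the convolution product of the bar construction, so that G is
   fully faithful and surjective on objects; everything is therefore proved for
   TGMod^0-B_A and pulled back along G.

   Over any differential graded category with sums and split idempotents in
   degree 0, the pairs of closed arrows which split in degree 0 form an exact
   structure: a retraction of a closed f yields an idempotent whose image
   inherits a twist, and pushouts are cokernels of maps X -> Y (+) X'. For the
   bar construction an arrow v with v^0 = id is invertible, since id - v lowers
   word length; as graded S-modules are semisimple, f has a retraction
   (a section) in degree 0 exactly when f^0 is injective (surjective).

   Identities between maps on tensor powers are checked on words of homogeneous
   letters, where they become sums over factorizations of the word. *)

Set Implicit Arguments.
Unset Strict Implicit.
Unset Printing Implicit Defensive.

Import Order.TTheory GRing.Theory Num.Theory.
Local Open Scope ring_scope.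

(** The pairs are specified through first components, but the exactness axioms need the arrows
    themselves to split, and a splitting of [f_1] is only a map of graded modules. It is promoted by
    reading it as an arrow supported on the empty word: composed with [f], it gives an endomorphism
    whose first component is the identity, whose inverse is the needed correction. The same device
    lifts a splitting of e^0 to one of an idempotent e. Where two idempotents then remain to be
    compared, their difference is an idempotent with first component 0, and it vanishes. None of
    these splittings need be closed. This is why the exact structure is set up for pairs that split
    in degree 0, the twist of the third object being solved for from the closedness equation.
    Passing to A[1] settles the signs: there every operation has degree 1, and (-1)^{r+st} together
    with the Koszul signs becomes (-1) to the degree of the letters left of the window. Objects are
    transferred along equalities, not isomorphisms, which rests on unshifting graded modules and on
    proof irrelevance. *)

Record dgdata := DGData {
  dgob : Type;
  dghom : dgob -> dgob -> zmodType;
  dgid : forall X, dghom X X;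
  dgcomp : forall X Y Z, dghom Y Z -> dghom X Y -> dghom X Z;
  dgdeg : int -> forall X Y, dghom X Y -> Prop;
  dgd : forall X Y, dghom X Y -> dghom X Y
}.
Arguments dgid {d} X.
Arguments dgcomp {d X Y Z} g f.
Arguments dgdeg {d} i {X Y} f.
Arguments dgd {d X Y} f.

Local Notation "g ** f" := (dgcomp g f) (at level 40, left associativity).

(** [dgd] stands for precomposition with id (x) delta, without the sign of \hat\delta. The sign in
    the Leibniz rule therefore depends on the degree of the inner factor [f] alone, and the degrees
    0 and 1 of morphisms and twists suffice. *)
Record dglaws (C : dgdata) : Prop := DGLaws {
  dgA : forall (X Y Z W : dgob C) (h : dghom Z W) (g : dghom Y Z)
    (f : dghom X Y), h ** (g ** f) = h ** g ** f;
  dg1l : forall (X Y : dgob C) (f : dghom X Y), dgid Y ** f = f;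
  dg1r : forall (X Y : dgob C) (f : dghom X Y), f ** dgid X = f;
  dgDl : forall (X Y Z : dgob C) (g g' : dghom Y Z) (f : dghom X Y),
    (g + g') ** f = g ** f + g' ** f;
  dgDr : forall (X Y Z : dgob C) (g : dghom Y Z) (f f' : dghom X Y),
    g ** (f + f') = g ** f + g ** f';
  dgdeg_id : forall X : dgob C, dgdeg 0 (dgid X);
  dgdeg0 : forall i (X Y : dgob C), dgdeg i (0 : dghom X Y);
  dgdegB : forall i (X Y : dgob C) (f g : dghom X Y),
    dgdeg i f -> dgdeg i g -> dgdeg i (f - g);
  dgdeg_comp : forall i j (X Y Z : dgob C) (g : dghom Y Z) (f : dghom X Y),
    dgdeg i g -> dgdeg j f -> dgdeg (i + j) (g ** f);
  dgdeg_d : forall (X Y : dgob C) (f : dghom X Y), dgdeg 0 f -> dgdeg 1 (dgd f);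
  dgdD : forall (X Y : dgob C) (f g : dghom X Y), dgd (f + g) = dgd f + dgd g;
  dgdM0 : forall (X Y Z : dgob C) (g : dghom Y Z) (f : dghom X Y),
    dgdeg 0 f -> dgd (g ** f) = g ** dgd f + dgd g ** f;
  dgdM1 : forall (X Y Z : dgob C) (g : dghom Y Z) (f : dghom X Y),
    dgdeg 1 f -> dgd (g ** f) = g ** dgd f - dgd g ** f;
  dgdd : forall (X Y : dgob C) (f : dghom X Y), dgd (dgd f) = 0
}.

(** * Twisted objects over a differential graded category *)

Lemma cmorD (C : catdata) (PA : preadditive C) (X Y : ob C) (f g : arr X Y) :
  cmor f -> cmor g -> cmor (f + g).
Proof.
move=> cf cg; rewrite -[g]opprK; apply: (cmorB PA) => //.
by rewrite -sub0r; apply: (cmorB PA) => //; exact: (cmor0 PA).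
Qed.

Section Twisted.
Variables (C : dgdata) (CL : dglaws C).

Lemma dg0l (X Y Z : dgob C) (f : dghom X Y) : (0 : dghom Y Z) ** f = 0.
Proof. by apply: (addrI (0 ** f)); rewrite -(dgDl CL) !addr0. Qed.
Lemma dg0r (X Y Z : dgob C) (g : dghom Y Z) : g ** (0 : dghom X Y) = 0.
Proof. by apply: (addrI (g ** 0)); rewrite -(dgDr CL) !addr0. Qed.
Lemma dgNl (X Y Z : dgob C) (g : dghom Y Z) (f : dghom X Y) : (- g) ** f = - (g ** f).
Proof. by apply: (addrI (g ** f)); rewrite -(dgDl CL) !subrr dg0l. Qed.
Lemma dgNr (X Y Z : dgob C) (g : dghom Y Z) (f : dghom X Y) : g ** (- f) = - (g ** f).
Proof. by apply: (addrI (g ** f)); rewrite -(dgDr CL) !subrr dg0r. Qed.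
Lemma dgd0 (X Y : dgob C) : dgd (0 : dghom X Y) = 0.
Proof. by apply: (addrI (dgd (0 : dghom X Y))); rewrite -(dgdD CL) !addr0. Qed.
Lemma dgdN (X Y : dgob C) (f : dghom X Y) : dgd (- f) = - dgd f.
Proof. by apply: (addrI (dgd f)); rewrite -(dgdD CL) !subrr dgd0. Qed.
Lemma dgd_id (X : dgob C) : dgd (dgid X) = 0.
Proof.
have := dgdM0 CL (dgid X) (dgdeg_id CL X).
rewrite !(dg1l CL) (dg1r CL) => h.
by apply: (addrI (dgd (dgid X))); rewrite -h addr0.
Qed.
Lemma dgdegN i (X Y : dgob C) (f : dghom X Y) : dgdeg i f -> dgdeg i (- f).
Proof. by move=> hf; rewrite -sub0r; apply: (dgdegB CL) => //; exact: dgdeg0. Qed.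
Lemma dgdegD i (X Y : dgob C) (f g : dghom X Y) :
  dgdeg i f -> dgdeg i g -> dgdeg i (f + g).
Proof. by move=> hf hg; rewrite -[g]opprK; apply: (dgdegB CL) => //; exact: dgdegN. Qed.
Lemma dgdeg00 (X Y Z : dgob C) (g : dghom Y Z) (f : dghom X Y) :
  dgdeg 0 g -> dgdeg 0 f -> dgdeg 0 (g ** f).
Proof. by move=> hg hf; exact: (dgdeg_comp CL hg hf). Qed.
Lemma dgdeg01 (X Y Z : dgob C) (g : dghom Y Z) (f : dghom X Y) :
  dgdeg 0 g -> dgdeg 1 f -> dgdeg 1 (g ** f).
Proof. by move=> hg hf; exact: (dgdeg_comp CL hg hf). Qed.
Lemma dgdeg10 (X Y Z : dgob C) (g : dghom Y Z) (f : dghom X Y) :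
  dgdeg 1 g -> dgdeg 0 f -> dgdeg 1 (g ** f).
Proof. by move=> hg hf; exact: (dgdeg_comp CL hg hf). Qed.

Record dgtw := DGTw {
  twob :> dgob C;
  twu : dghom twob twob;
  twu_deg : dgdeg 1 twu;
  twu_mc : dgd twu + twu ** twu = 0
}.
Arguments twu : clear implicits.

(* With the unsigned [dgd], the condition
   \hat\delta(f) + v f - f u = 0 for f of degree 0 reads d f = v f - f u. *)
Definition TW : catdata :=
  @CatData dgtw (fun X Y => dghom X Y)
    (fun X Y f => dgdeg 0 f /\ dgd f = twu Y ** f - f ** twu X)
    (fun X => dgid X) (fun X Y Z g f => g ** f).

Lemma TW_preadditive : preadditive TW.
Proof.
split=> /=.
- move=> X; split; first exact: dgdeg_id.
  by rewrite (dg1l CL) (dg1r CL) subrr dgd_id.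
- move=> X Y Z g f [hg dg] [hf df]; split; first exact: dgdeg00.
  rewrite (dgdM0 CL) // df dg (dgDr CL) (dgDl CL) dgNr dgNl !(dgA CL).
  by rewrite addrC addrA subrK.
- move=> X Y; split; first exact: dgdeg0.
  by rewrite dg0l dg0r subrr dgd0.
- move=> X Y f g [hf df] [hg dg]; split; first exact: dgdegB.
  rewrite (dgdD CL) dgdN df dg (dgDr CL) (dgDl CL) dgNr dgNl.
  by rewrite opprB opprD opprK addrACA [- _ + _]addrC [X in _ + X]addrC addrACA.
- by move=> *; exact: dgA.
- by move=> *; exact: dg1l.
- by move=> *; exact: dg1r.
- by move=> *; exact: dgDl.
- by move=> *; exact: dgDr.
Qed.

Lemma dgK (X Y Z W : dgob C) (g : dghom Y Z) (f : dghom X Y) (k : dghom X Z)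
    (h : dghom Z W) : g ** f = k -> h ** g ** f = h ** k.
Proof. by move=> <-; rewrite (dgA CL). Qed.

Lemma dgBl (X Y Z : dgob C) (g g' : dghom Y Z) (f : dghom X Y) :
  (g - g') ** f = g ** f - g' ** f.
Proof. by rewrite (dgDl CL) dgNl. Qed.
Lemma dgBr (X Y Z : dgob C) (g : dghom Y Z) (f f' : dghom X Y) :
  g ** (f - f') = g ** f - g ** f'.
Proof. by rewrite (dgDr CL) dgNr. Qed.
Lemma dgdB (X Y : dgob C) (f g : dghom X Y) : dgd (f - g) = dgd f - dgd g.
Proof. by rewrite (dgdD CL) dgdN. Qed.

(** The splittings [r] and [s] have degree 0 but need not be closed; closed ones would split the
    pair in [TW] itself. *)
Definition dgsplit (X Y Z : dgob C) (f : dghom X Y) (g : dghom Y Z) : Prop :=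
  g ** f = 0 /\ exists (r : dghom Y X) (s : dghom Z Y),
    [/\ dgdeg 0 r, dgdeg 0 s, r ** f = dgid X, g ** s = dgid Z
      & f ** r + s ** g = dgid Y].

Lemma dg_mono (X Y : dgob C) (f : dghom X Y) (r : dghom Y X) (W : dgob C)
    (a b : dghom W X) : r ** f = dgid X -> f ** a = f ** b -> a = b.
Proof.
by move=> rf ab; rewrite -[a](dg1l CL) -[b](dg1l CL) -rf -!(dgA CL) ab.
Qed.
Lemma dg_epi (X Y : dgob C) (g : dghom X Y) (s : dghom Y X) (W : dgob C)
    (a b : dghom Y W) : g ** s = dgid Y -> a ** g = b ** g -> a = b.
Proof.
by move=> gs ab; rewrite -[a](dg1r CL) -[b](dg1r CL) -gs !(dgA CL) ab.
Qed.

(** By the Leibniz rule, [f] composed with the defect of closedness of [h] is 0. The retraction only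
    cancels [f], so it need not be closed. *)
Lemma closed_cancel_l (W X Y : dgtw) (f : @arr TW X Y) (r : dghom Y X)
    (h : dghom W X) : @cmor TW X Y f -> r ** f = dgid X -> dgdeg 0 h ->
  @cmor TW W Y (f ** h) -> @cmor TW W X h.
Proof.
move=> [hf df] rf hh [_]; rewrite (dgdM0 CL) // df dgBl => e; split=> //.
apply: (dg_mono rf); rewrite dgBr !(dgA CL).
move: e; rewrite !(dgA CL) => /(canRL (addrK _)) ->.
by rewrite opprB addrC addrA subrK.
Qed.

Lemma closed_cancel_r (X Y W : dgtw) (g : @arr TW X Y) (s : dghom Y X)
    (h : dghom Y W) : @cmor TW X Y g -> g ** s = dgid Y -> dgdeg 0 h ->
  @cmor TW X W (h ** g) -> @cmor TW Y W h.
Proof.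
move=> [hg dg] gs hh [_]; rewrite (dgdM0 CL) // dg dgBr => e; split=> //.
apply: (dg_epi gs); rewrite dgBl.
move: e; rewrite !(dgA CL) => /(canRL (addKr _)) ->.
by rewrite opprB addrC addrA subrK.
Qed.

(** The twist U on Z is forced: [g] is closed exactly when U g = d g + g u, with u the twist of Y,
    and the right side vanishes on [f], so it factors through [g]. No equation r f = id is assumed,
    so that [f] may also be the complement of an idempotent. *)
Lemma twist_coker (X Y : dgtw) (Z : dgob C) (f : @arr TW X Y) (r : dghom Y X)
    (g : dghom Y Z) (s : dghom Z Y) :
  @cmor TW X Y f -> dgdeg 0 g -> dgdeg 0 s ->
  g ** f = 0 -> g ** s = dgid Z -> f ** r + s ** g = dgid Y ->
  exists T : dgtw, exists (g' : @chom TW Y T) (s' : dghom T Y),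
    [/\ dgdeg 0 s', harr g' ** f = 0, harr g' ** s' = dgid T
      & f ** r + s' ** g' = dgid Y].
Proof.
move=> [hf df] hg hs gf gs e; set D := dgd g + g ** twu Y.
have hD : dgdeg 1 D.
  by apply: dgdegD; [exact: dgdeg_d | apply: dgdeg01 => //; exact: twu_deg].
(* This is d (g f) = 0 combined with the closedness of [f]. *)
have Df : D ** f = 0.
  have := dgdM0 CL g hf; rewrite gf dgd0 df dgBr !(dgA CL) gf dg0l subr0 => d0.
  by rewrite (dgDl CL) addrC -d0.
have Dsg : D ** s ** g = D.
  rewrite -(dgA CL) -[s ** g](addKr (f ** r)) e (dgDr CL) (dg1r CL) dgNr.
  by rewrite (dgA CL) Df dg0l oppr0 add0r.
have hu : dgdeg 1 (D ** s) by exact: dgdeg10.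
move: (D ** s) hu Dsg => U hu Ug.
have mc : dgd U + U ** U = 0.
  (* Composed with [g], the left side becomes d D + D u, which is g (d u + u u). *)
  apply: (dg_epi gs); rewrite dg0l (dgDl CL) -(dgA CL) Ug.
  have /eqP := dgdM0 CL U hg; rewrite Ug addrC -subr_eq => /eqP <-.
  rewrite {2}/D (dgDr CL) (dgA CL) Ug addrA subrK.
  rewrite /D (dgdD CL) (dgdd CL) add0r (dgdM1 CL) ?(dgDl CL); last exact: twu_deg.
  by rewrite addrA subrK -(dgA CL) -(dgDr CL) twu_mc dg0r.
have cl : @cmor TW Y (DGTw hu mc) g.
  by split=> //; rewrite /= Ug /D addrK.
by exists (DGTw hu mc), (CHom cl), s.
Qed.

(** Dual to [twist_coker]: closedness of [f] forces f U = u f - d f, and the right side is killed by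
    [g], so it factors through [f]. *)
Lemma twist_ker (Y Z : dgtw) (X : dgob C) (f : dghom X Y) (r : dghom Y X)
    (g : @arr TW Y Z) (s : dghom Z Y) :
  @cmor TW Y Z g -> dgdeg 0 f -> dgdeg 0 r ->
  g ** f = 0 -> r ** f = dgid X -> f ** r + s ** g = dgid Y ->
  exists T : dgtw, exists (f' : @chom TW T Y) (r' : dghom Y T),
    [/\ dgdeg 0 r', g ** harr f' = 0, r' ** harr f' = dgid T
      & harr f' ** r' + s ** g = dgid Y].
Proof.
move=> [hg dg] hf hr gf rf e; set D := twu Y ** f - dgd f.
have hD : dgdeg 1 D.
  apply: (dgdegB CL); last exact: dgdeg_d.
  by apply: dgdeg10 => //; exact: twu_deg.
have gD : g ** D = 0.
  have := dgdM0 CL g hf; rewrite gf dgd0 dg dgBl -!(dgA CL) gf dg0r sub0r => d0.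
  by apply: oppr_inj; rewrite dgBr oppr0 opprB.
have frD : f ** (r ** D) = D.
  rewrite (dgA CL) -[f ** r](addrK (s ** g)) e dgBl (dg1l CL).
  by rewrite -(dgA CL) gD dg0r subr0.
have hu : dgdeg 1 (r ** D) by exact: dgdeg01.
move: (r ** D) hu frD => U hu fU.
have mc : dgd U + U ** U = 0.
  apply: (dg_mono rf); rewrite dg0r (dgDr CL) (dgA CL) fU.
  have /eqP := dgdM1 CL f hu; rewrite fU eq_sym subr_eq => /eqP ->.
  rewrite {2}/D dgBl -(dgA CL) fU addrA addrAC addrK.
  rewrite /D dgdB (dgdd CL) subr0 (dgdM0 CL) // dgBr addrC addrA subrK.
  by rewrite (dgA CL) -(dgDl CL) addrC twu_mc dg0l.
have cl : @cmor TW (DGTw hu mc) Y f.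
  by split=> //; rewrite /= fU /D subKr.
by exists (DGTw hu mc), (CHom cl), r.
Qed.

(** * The exact structure of pairs split in degree 0 *)

Definition Esplit : pair_class TW := fun X Y Z f g =>
  [/\ @cmor TW X Y f, @cmor TW Y Z g & dgsplit f g].

Hypothesis dg_inhabited : exists X : dgob C, True.
Hypothesis dg_split : forall (X : dgob C) (e : dghom X X),
  dgdeg 0 e -> e ** e = e ->
  exists (Z : dgob C) (p : dghom X Z) (i : dghom Z X),
    [/\ dgdeg 0 p, dgdeg 0 i, i ** p = e & p ** i = dgid Z].
Hypothesis dg_sum : forall X Y : dgob C, exists (P : dgob C) (i : dghom X P)
    (j : dghom Y P) (p : dghom P X) (q : dghom P Y),
  [/\ [/\ dgdeg 0 i, dgdeg 0 j, dgdeg 0 p & dgdeg 0 q],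
      [/\ dgd i = 0, dgd j = 0, dgd p = 0 & dgd q = 0]
    & [/\ p ** i = dgid X, q ** j = dgid Y, p ** j = 0, q ** i = 0
        & i ** p + j ** q = dgid P]].

Lemma inflationP (X Y : dgtw) (f : @arr TW X Y) :
  inflation Esplit f <->
  @cmor TW X Y f /\ exists r : dghom Y X, dgdeg 0 r /\ r ** f = dgid X.
Proof.
split=> [[Z [g [hf hg [gf [r [s [hr hs rf gs e]]]]]]]|[cf [r [hr rf]]]].
  by split=> //; exists r.
have hf : dgdeg 0 f by case: cf.
have frfr : f ** r ** (f ** r) = f ** r.
  by rewrite (dgA CL) (dgK _ rf) (dg1r CL).
(* The image of 1 - f r is a cokernel of [f] in degree 0; [twist_coker] then supplies its twist. *)
have [||Z [p [i [hp hi ip pi]]]] := @dg_split Y (dgid Y - f ** r).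
- by apply: (dgdegB CL); [exact: dgdeg_id | exact: dgdeg00].
- by rewrite dgBl (dg1l CL) dgBr (dg1r CL) frfr subrr subr0.
have pf : p ** f = 0.
  apply: (dg_mono pi); rewrite (dgA CL) ip dgBl (dg1l CL) (dgK _ rf).
  by rewrite (dg1r CL) subrr dg0r.
have [|T [g [s [hs gf gs e]]]] := twist_coker cf hp hi pf pi (r := r).
  by rewrite ip addrC subrK.
exists T, (harr g); split=> //; first exact: harrP.
by split=> //; exists r, s.
Qed.

Lemma deflationP (Y Z : dgtw) (g : @arr TW Y Z) :
  deflation Esplit g <->
  @cmor TW Y Z g /\ exists s : dghom Z Y, dgdeg 0 s /\ g ** s = dgid Z.
Proof.
split=> [[X [f [hf hg [gf [r [s [hr hs rf gs e]]]]]]]|[cg [s [hs gs]]]].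
  by split=> //; exists s.
have hg : dgdeg 0 g by case: cg.
have sgsg : s ** g ** (s ** g) = s ** g.
  by rewrite (dgA CL) (dgK _ gs) (dg1r CL).
have [||X [p [i [hp hi ip pi]]]] := @dg_split Y (dgid Y - s ** g).
- by apply: (dgdegB CL); [exact: dgdeg_id | exact: dgdeg00].
- by rewrite dgBl (dg1l CL) dgBr (dg1r CL) sgsg subrr subr0.
have gi : g ** i = 0.
  apply: (dg_epi pi); rewrite -(dgA CL) ip dgBr (dg1r CL) (dgA CL) gs.
  by rewrite (dg1l CL) subrr dg0l.
have [|T [f [r [hr gf rf e]]]] := twist_ker cg hi hp gi pi (s := s).
  by rewrite ip subrK.
exists T, (harr f); split=> //; first exact: harrP.
by split=> //; exists r, s.
Qed.

Lemma Esplit_kernel (X Y Z : dgtw) (f : @arr TW X Y) (g : @arr TW Y Z) :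
  Esplit f g -> is_kernel f g.
Proof.
move=> [cf cg [gf [r [s [hr hs rf gs e]]]]]; split=> // W [h ch] /= gh.
have frh : f ** (r ** h) = h.
  rewrite (dgA CL) -[f ** r](addrK (s ** g)) e dgBl (dg1l CL).
  by rewrite -(dgA CL) gh dg0r subr0.
have crh : @cmor TW W X (r ** h).
  apply: (closed_cancel_l cf rf); last by rewrite frh.
  by apply: dgdeg00 => //; case: ch.
exists (CHom crh); split=> // h'' fh''; apply: (dg_mono rf).
by rewrite /= frh.
Qed.

Lemma Esplit_cokernel (X Y Z : dgtw) (f : @arr TW X Y) (g : @arr TW Y Z) :
  Esplit f g -> is_cokernel f g.
Proof.
move=> [cf cg [gf [r [s [hr hs rf gs e]]]]]; split=> // W [h ch] /= hf.
have hsg : h ** s ** g = h.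
  rewrite -(dgA CL) -[s ** g](addKr (f ** r)) e (dgDr CL) (dg1r CL) dgNr.
  by rewrite (dgA CL) hf dg0l oppr0 add0r.
have chs : @cmor TW Z W (h ** s).
  apply: (closed_cancel_r cg gs); last by rewrite hsg.
  by apply: dgdeg00 => //; case: ch.
exists (CHom chs); split=> // h'' fh''; apply: (dg_epi gs).
by rewrite /= hsg.
Qed.

(** The image of [e] is the cokernel of 1 - e, so [twist_coker] applies to 1 - e with r = id. The
    inclusion [s] is closed because s g = e is and [g] has a section. *)
Lemma TW_split_idempotents : split_idempotents TW.
Proof.
move=> X [e ce] /= ee; have he : dgdeg 0 e by case: ce.
have [Z [p [i [hp hi ip pi]]]] := @dg_split X e he ee.
have c1e : @cmor TW X X (dgid X - e).
  apply: (cmorB TW_preadditive) => //; exact: (cmor_id TW_preadditive X).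
have [||T [g [s [hs gf gs e1]]]] := twist_coker c1e hp hi _ pi (r := dgid X).
- apply: (dg_mono pi); rewrite (dgA CL) ip dgBr (dg1r CL) ee subrr.
  by rewrite dg0r.
- by rewrite ip (dg1r CL) subrK.
have sg : s ** g = e.
  by move: e1; rewrite (dg1r CL) -[RHS](subrK e) => /addrI.
have cs : @cmor TW T X s.
  apply: (closed_cancel_r (harrP g) gs) => //.
  by have := ce; rewrite -sg.
by exists T, g, (CHom cs).
Qed.

(** The zero idempotent of any object with twist 0 splits, and the identity of its image factors
    through 0. *)
Lemma TW_zero : exists Z : ob TW, zero_object Z.
Proof.
have [X _] := dg_inhabited.
have mc : dgd (0 : dghom X X) + (0 : dghom X X) ** (0 : dghom X X) = 0.
  by rewrite dgd0 add0r; exact: dg0l.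
pose T := DGTw (dgdeg0 CL 1 X X) mc.
have [|Z [p [i [ip pi]]]] := @TW_split_idempotents T (CHom (cmor0 TW_preadditive T T)).
  exact: dg0l.
have id0 : dgid Z = 0.
  have ip0 : harr i ** harr p = 0 := ip.
  move: pi => /= pi.
  by rewrite -[dgid Z](dg1l CL) -pi -(dgA CL) [harr i ** _](dgA CL) ip0 dg0l dg0r.
exists Z => Y; split=> f.
  by rewrite -[harr f](dg1l CL) id0 dg0l.
by rewrite -[harr f](dg1r CL) id0 dg0r.
Qed.

(** The twist of the sum is diagonal. The structure maps are closed for it because [dg_sum] provides
    them as cycles. *)
Lemma TW_biproduct (X Y : ob TW) : exists P, biproduct X Y P.
Proof.
have [P [i [j [p [q [[hi hj hp hq] [di dj dp dq] [pi qj pj qi e]]]]]]] :=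
  dg_sum (twob X) (twob Y).
set u := i ** twu X ** p + j ** twu Y ** q.
have hu : dgdeg 1 u.
  by apply: dgdegD; apply: dgdeg10 => //; apply: dgdeg01 => //; exact: twu_deg.
have ui : u ** i = i ** twu X.
  by rewrite (dgDl CL) (dgK _ pi) (dgK _ qi) (dg1r CL) dg0r addr0.
have uj : u ** j = j ** twu Y.
  by rewrite (dgDl CL) (dgK _ pj) (dgK _ qj) (dg1r CL) dg0r add0r.
have pu : p ** u = twu X ** p.
  by rewrite (dgDr CL) !(dgA CL) pi pj (dg1l CL) !dg0l addr0.
have qu : q ** u = twu Y ** q.
  by rewrite (dgDr CL) !(dgA CL) qi qj (dg1l CL) !dg0l add0r.
have mc : dgd u + u ** u = 0.
  rewrite {1}/u (dgdD CL) (dgdM0 CL _ hp) (dgdM0 CL _ hq) dp dq !dg0r !add0r.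
  rewrite !(dgdM1 CL); try exact: twu_deg.
  rewrite di dj !dg0l !subr0 {2}/u (dgDr CL) !(dgA CL) ui uj.
  rewrite addrACA -!(dgDl CL) -!(dgA CL) -!(dgDr CL) !twu_mc.
  by rewrite !dg0r !dg0l addr0.
pose T := DGTw hu mc.
have ci : @cmor TW X T i by split=> //=; rewrite ui subrr.
have cj : @cmor TW Y T j by split=> //=; rewrite uj subrr.
have cp : @cmor TW T X p by split=> //=; rewrite pu subrr.
have cq : @cmor TW T Y q by split=> //=; rewrite qu subrr.
by exists T, (CHom ci), (CHom cj), (CHom cp), (CHom cq).
Qed.

Lemma TW_additive : additive_category TW.
Proof.
split; [exact: TW_preadditive | exact: TW_zero | exact: TW_biproduct].
Qed.

(** The pushout is the cokernel of (f, -h) from X to the sum of Y and X'. This arrow is an inflation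
    because its component [f] already has a retraction. *)
Lemma TW_pushout (X Y X' : ob TW) (f : arr X Y) (h : chom X X') :
  inflation Esplit f -> exists Y' (f' : chom X' Y') (h' : chom Y Y'),
    is_pushout f h f' h' /\ inflation Esplit f'.
Proof.
move=> /inflationP [cf [r [hr rf]]].
have hf : dgdeg 0 f by case: cf.
have [P [i [j [p [q [/= pi qj pj qi e]]]]]] := TW_biproduct Y X'.
have PA := TW_preadditive.
have ca : @cmor TW X P (i ** f - j ** h).
  by apply: (cmorB PA); apply: (cmor_comp PA) => //; exact: harrP.
have [hi _] := harrP i; have [hj _] := harrP j; have [hh _] := harrP h.
have [hp _] := harrP p; have [hq _] := harrP q.
have pa : p ** (i ** f - j ** h) = f.
  by rewrite dgBr !(dgA CL) pi pj (dg1l CL) dg0l subr0.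
have qa : q ** (i ** f - j ** h) = - harr h.
  by rewrite dgBr !(dgA CL) qi qj (dg1l CL) dg0l sub0r.
have [Y' [c Ec]] : inflation Esplit (i ** f - j ** h : @arr TW X P).
  apply/inflationP; split=> //; exists (r ** p); split.
    by apply: dgdeg00.
  by rewrite -(dgA CL) pa.
have [_ univ] := Esplit_cokernel Ec.
case: Ec => _ cc [ca0 [ra [s [hra hs raa cs es]]]].
have c1 : @cmor TW X' Y' (c ** j) by apply: (cmor_comp PA) => //; exact: harrP.
have c2 : @cmor TW Y Y' (c ** i) by apply: (cmor_comp PA) => //; exact: harrP.
have sq : c ** j ** h = c ** i ** f.
  by move: ca0; rewrite dgBr !(dgA CL) => /subr0_eq ->.
exists Y', (CHom c1), (CHom c2); split; first split=> //= W a b ab.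
  have cb : @cmor TW P W (b ** p + a ** q).
    by apply: (cmorD PA); apply: (cmor_comp PA); exact: harrP.
  have [|d [dc du]] := univ W (CHom cb).
    by rewrite /= (dgDl CL) -!(dgA CL) pa qa dgNr ab subrr.
  move: dc => /= dc; exists d; split; first split.
  - by rewrite (dgA CL) dc (dgDl CL) -!(dgA CL) pj qj (dg1r CL) dg0r add0r.
  - by rewrite (dgA CL) dc (dgDl CL) -!(dgA CL) pi qi (dg1r CL) dg0r addr0.
  move=> d' [d'1 d'2]; apply: du => /=.
  rewrite -[harr d' ** c](dg1r CL) -e (dgDr CL) !(dgA CL) addrC.
  by move: d'1 d'2; rewrite !(dgA CL) => -> ->; rewrite addrC.
(* Since r f = id, the arrow h r p + q kills (f, -h) and so factors through the cokernel [c]; on X'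
   it restricts to q j = id. The factorization is therefore a retraction of c j. *)
apply/inflationP; split=> //; exists ((h ** r ** p + harr q) ** s); split.
  by apply: dgdeg00 => //; apply: dgdegD => //; do 2?apply: dgdeg00.
have kill : (h ** r ** p + harr q) ** (i ** f - j ** h) = 0.
  by rewrite (dgDl CL) -(dgA CL) pa qa -(dgA CL) rf (dg1r CL) subrr.
have sc : (h ** r ** p + harr q) ** s ** c = h ** r ** p + harr q.
  rewrite -(dgA CL) -[s ** c](addKr ((i ** f - j ** h) ** ra)) es.
  by rewrite (dgDr CL) (dg1r CL) dgNr (dgA CL) kill dg0l oppr0 add0r.
by rewrite /= (dgA CL) sc (dgDl CL) -(dgA CL) pj qj dg0r add0r.
Qed.

Lemma TW_pullback (Y Z Z' : ob TW) (g : arr Y Z) (h : chom Z' Z) :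
  deflation Esplit g -> exists Y' (g' : chom Y' Z') (h' : chom Y' Y),
    is_pullback g h g' h' /\ deflation Esplit g'.
Proof.
move=> /deflationP [cg [s [hs gs]]].
have hg : dgdeg 0 g by case: cg.
have [P [i [j [p [q [/= pi qj pj qi e]]]]]] := TW_biproduct Y Z'.
have PA := TW_preadditive.
have ca : @cmor TW P Z (g ** p - h ** q).
  by apply: (cmorB PA); apply: (cmor_comp PA) => //; exact: harrP.
have [hi _] := harrP i; have [hj _] := harrP j; have [hh _] := harrP h.
have [hp _] := harrP p; have [hq _] := harrP q.
have ai : (g ** p - h ** q) ** i = g.
  by rewrite dgBl -!(dgA CL) pi qi (dg1r CL) dg0r subr0.
have aj : (g ** p - h ** q) ** j = - harr h.
  by rewrite dgBl -!(dgA CL) pj qj (dg1r CL) dg0r sub0r.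
have [Y' [c Ec]] : deflation Esplit (g ** p - h ** q : @arr TW P Z).
  apply/deflationP; split=> //; exists (i ** s); split.
    by apply: dgdeg00.
  by rewrite (dgA CL) ai.
have [_ univ] := Esplit_kernel Ec.
case: Ec => cc _ [ac0 [r [sa [hr hsa rc asa es]]]].
have c1 : @cmor TW Y' Z' (q ** c) by apply: (cmor_comp PA) => //; exact: harrP.
have c2 : @cmor TW Y' Y (p ** c) by apply: (cmor_comp PA) => //; exact: harrP.
have sq : g ** (p ** c) = h ** (q ** c).
  by move: ac0; rewrite dgBl -!(dgA CL) => /subr0_eq ->.
exists Y', (CHom c1), (CHom c2); split; first split=> //= W a b ab.
  have cb : @cmor TW W P (i ** b + j ** a).
    by apply: (cmorD PA); apply: (cmor_comp PA); exact: harrP.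
  have [|d [dc du]] := univ W (CHom cb).
    by rewrite /= (dgDr CL) !(dgA CL) ai aj dgNl ab subrr.
  move: dc => /= dc; exists d; split; first split.
  - by rewrite -(dgA CL) dc (dgDr CL) !(dgA CL) qi qj (dg1l CL) dg0l add0r.
  - by rewrite -(dgA CL) dc (dgDr CL) !(dgA CL) pi pj (dg1l CL) dg0l addr0.
  move=> d' [d'1 d'2]; apply: du => /=.
  rewrite -[c ** harr d'](dg1l CL) -e (dgDl CL) -!(dgA CL).
  by move: d'1 d'2; rewrite -!(dgA CL) => -> ->.
(* Since g s = id, the arrow i s h + j is killed by g p - h q and so factors through the kernel [c];
   its component on Z' is q j = id. *)
apply/deflationP; split=> //; exists (r ** (i ** s ** h + harr j)); split.
  by apply: dgdeg00 => //; apply: dgdegD => //; do 2?apply: dgdeg00.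
have kill : (g ** p - h ** q) ** (i ** s ** h + harr j) = 0.
  by rewrite (dgDr CL) !(dgA CL) ai aj gs (dg1l CL) subrr.
have sc : c ** (r ** (i ** s ** h + harr j)) = i ** s ** h + harr j.
  rewrite (dgA CL) -[c ** r](addrK (sa ** (g ** p - h ** q))) es.
  by rewrite dgBl (dg1l CL) -!(dgA CL) [(g ** p - _) ** _](_ : _ = 0) ?dg0r ?subr0 // !(dgA CL) kill.
by rewrite /= -(dgA CL) sc (dgDr CL) !(dgA CL) qi qj !dg0l add0r.
Qed.

Lemma Esplit_exact : exact_category Esplit.
Proof.
have PA := TW_preadditive.
split.
- exact: TW_additive.
- by move=> X Y Z f g [].
- exact: Esplit_kernel.
- exact: Esplit_cokernel.
- move=> X Y Z f g X' Y' Z' f' g' a b c [cf cg [gf [r [s [hr hs rf gs e]]]]].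
  move=> [[ha _] [a' /= [a'a aa']]] [[hb _] [b' /= [b'b bb']]].
  move=> [[hc _] [c' /= [c'c cc']]] bf cg'.
  have [ha' _] := harrP a'; have [hb' _] := harrP b'; have [hc' _] := harrP c'.
  have ef : harr f' = b ** f ** a' by rewrite bf -(dgA CL) aa' (dg1r CL).
  have eg : harr g' = c ** g ** b' by rewrite cg' -(dgA CL) bb' (dg1r CL).
  split; [exact: harrP | exact: harrP | split].
    by rewrite ef eg !(dgA CL) (dgK _ b'b) (dg1r CL) (dgK _ gf) dg0r dg0l.
  exists (a ** r ** b'), (b ** s ** c'); split.
  - by do 2?apply: dgdeg00.
  - by do 2?apply: dgdeg00.
  - by rewrite ef !(dgA CL) (dgK _ b'b) (dg1r CL) (dgK _ rf) (dg1r CL).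
  - by rewrite eg !(dgA CL) (dgK _ b'b) (dg1r CL) (dgK _ gs) (dg1r CL).
  - rewrite ef eg !(dgA CL) (dgK _ a'a) (dgK _ c'c) !(dg1r CL).
    by rewrite -(dgDl CL) -[b ** f ** r](dgA CL) -[b ** s ** g](dgA CL) -(dgDr CL) e (dg1r CL) bb'.
- move=> X; apply/inflationP; split; first exact: (cmor_id PA X).
  by exists (dgid X); split; [exact: dgdeg_id | exact: (dg1l CL)].
- move=> X; apply/deflationP; split; first exact: (cmor_id PA X).
  by exists (dgid X); split; [exact: dgdeg_id | exact: (dg1l CL)].
- move=> X Y Z f g /inflationP [cf [r [hr rf]]] /inflationP [cg [t [ht tg]]].
  apply/inflationP; split; first exact: (cmor_comp PA).
  exists (r ** t); split; first exact: dgdeg00.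
  by rewrite /= (dgA CL) (dgK _ tg) (dg1r CL).
- move=> X Y Z f g /deflationP [cf [r [hr fr]]] /deflationP [cg [t [ht gt]]].
  apply/deflationP; split; first exact: (cmor_comp PA).
  exists (r ** t); split; first exact: dgdeg00.
  by rewrite /= (dgA CL) (dgK _ fr) (dg1r CL).
- exact: TW_pushout.
- exact: TW_pullback.
Qed.
End Twisted.

(** * Exact structures along fully faithful functors *)

(** [C] is not assumed preadditive: closure of its morphisms is required here, and the laws follow
    from those of [D] by faithfulness. Objects are reached up to equality, so that a diagram in [D]
    lifts by case analysis, without conjugation by isomorphisms. *)
Record ff_surjection (C D : catdata) (F : functor_data C D) : Prop :=
  FFSurjection {
  ffs_id : forall X : ob C, cmor (cidm X);
  ffs_comp : forall (X Y Z : ob C) (g : arr Y Z) (f : arr X Y),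
    cmor g -> cmor f -> cmor (ccomp g f);
  ffs_0 : forall X Y : ob C, cmor (0 : arr X Y);
  ffs_B : forall (X Y : ob C) (f g : arr X Y), cmor f -> cmor g -> cmor (f - g);
  ffs_functor : additive_functor F;
  ffs_full : forall (X Y : ob C) (g : arr (fob F X) (fob F Y)), cmor g ->
    exists2 f : arr X Y, cmor f & farr F f = g;
  ffs_faithful : forall (X Y : ob C) (f g : arr X Y), cmor f -> cmor g ->
    farr F f = farr F g -> f = g;
  ffs_ob : forall T : ob D, exists X, fob F X = T
}.

Section Transfer.
Variables (C D : catdata) (F : functor_data C D) (FF : ff_surjection F).
Hypothesis PD : preadditive D.

Let FA := ffs_functor FF.

Lemma ffs_farr0 (X Y : ob C) : farr F (0 : arr X Y) = 0.
Proof.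
apply: (addrI (farr F (0 : arr X Y))).
by rewrite -(farrD FA) ?addr0 //; exact: (ffs_0 FF).
Qed.

Lemma ffs_D (X Y : ob C) (f g : arr X Y) : cmor f -> cmor g -> cmor (f + g).
Proof.
move=> cf cg; rewrite -[g]opprK; apply: (ffs_B FF) => //.
by rewrite -sub0r; apply: (ffs_B FF) => //; exact: (ffs_0 FF).
Qed.

Lemma ffs_preadditive : preadditive C.
Proof.
split; [exact: (ffs_id FF) | exact: (ffs_comp FF) | exact: (ffs_0 FF) | exact: (ffs_B FF) | ..].
- move=> X Y Z W h g f ch cg cf; have Fm := farr_mor FA.
  have cgf := ffs_comp FF cg cf; have chg := ffs_comp FF ch cg.
  apply: (ffs_faithful FF); try by apply: (ffs_comp FF).
  by rewrite !(farr_comp FA) //; apply: (ccompA PD); exact: Fm.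
- move=> X Y f cf; have ci := ffs_id FF Y.
  apply: (ffs_faithful FF) => //; first by apply: (ffs_comp FF).
  by rewrite (farr_comp FA) // (farr_id FA) (ccomp1l PD) //; exact: farr_mor.
- move=> X Y f cf; have ci := ffs_id FF X.
  apply: (ffs_faithful FF) => //; first by apply: (ffs_comp FF).
  by rewrite (farr_comp FA) // (farr_id FA) (ccomp1r PD) //; exact: farr_mor.
- move=> X Y Z g g' f cg cg' cf; have Fm := farr_mor FA.
  have cgg := ffs_D cg cg'; have c1 := ffs_comp FF cg cf.
  have c2 := ffs_comp FF cg' cf.
  apply: (ffs_faithful FF); [by apply: (ffs_comp FF) | exact: ffs_D |].
  by rewrite (farrD FA) // !(farr_comp FA) // (farrD FA) // (ccompDl PD) //; exact: Fm.
- move=> X Y Z g f f' cg cf cf'; have Fm := farr_mor FA.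
  have cgg := ffs_D cf cf'; have c1 := ffs_comp FF cg cf.
  have c2 := ffs_comp FF cg cf'.
  apply: (ffs_faithful FF); [by apply: (ffs_comp FF) | exact: ffs_D |].
  by rewrite (farrD FA) // !(farr_comp FA) // (farrD FA) // (ccompDr PD) //; exact: Fm.
Qed.

Let PC := ffs_preadditive.

Definition fhom (X Y : ob C) (f : chom X Y) : chom (fob F X) (fob F Y) :=
  CHom (farr_mor FA (harrP f)).

Lemma fhom_lift (X Y : ob C) (g : chom (fob F X) (fob F Y)) :
  exists f : chom X Y, farr F f = g.
Proof. by case: (ffs_full FF (harrP g)) => f cf e; exists (CHom cf). Qed.

Lemma ffs_comp_eq (X Y Z : ob C) (g : chom Y Z) (f : chom X Y) (h : arr X Z) :
  cmor h -> (ccomp g f = h <-> ccomp (farr F g) (farr F f) = farr F h).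
Proof.
move=> ch; rewrite -(farr_comp FA); [|exact: harrP..].
split=> [->//|]; apply: (ffs_faithful FF) => //.
by apply: (ffs_comp FF); exact: harrP.
Qed.

Lemma ffs_comp_eq2 (X Y Y' Z : ob C) (g : chom Y Z) (f : chom X Y)
    (g' : chom Y' Z) (f' : chom X Y') :
  ccomp g f = ccomp g' f' <->
  ccomp (farr F g) (farr F f) = ccomp (farr F g') (farr F f').
Proof.
rewrite -[X in _ <-> _ = X](farr_comp FA); [|exact: harrP..].
by apply: ffs_comp_eq; apply: (ffs_comp FF); exact: harrP.
Qed.

Lemma ffs_zero_object Z : zero_object (fob F Z) -> zero_object Z.
Proof.
move=> hZ X; split=> f; apply: (ffs_faithful FF); try exact: harrP;
  try exact: (ffs_0 FF); rewrite ffs_farr0; case: (hZ (fob F X)) => h1 h2.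
- exact: (h1 (fhom f)).
- exact: (h2 (fhom f)).
Qed.

Lemma ffs_biproduct X Y P :
  biproduct (fob F X) (fob F Y) (fob F P) -> biproduct X Y P.
Proof.
move=> [i' [j' [p' [q' []]]]].
have [i <-] := fhom_lift i'; have [j <-] := fhom_lift j'.
have [p <-] := fhom_lift p'; have [q <-] := fhom_lift q'.
rewrite -!(farr_id FA) => e1 e2 e3 e4 e5; exists i, j, p, q.
have c1 := ffs_comp FF (harrP i) (harrP p).
have c2 := ffs_comp FF (harrP j) (harrP q).
split.
- by apply/ffs_comp_eq => //; exact: (ffs_id FF).
- by apply/ffs_comp_eq => //; exact: (ffs_id FF).
- by apply/ffs_comp_eq; [exact: (ffs_0 FF) | rewrite ffs_farr0].
- by apply/ffs_comp_eq; [exact: (ffs_0 FF) | rewrite ffs_farr0].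
- apply: (ffs_faithful FF); [exact: ffs_D | exact: (ffs_id FF) |].
  by rewrite (farrD FA) // !(farr_comp FA) //; exact: harrP.
Qed.

Lemma ffs_additive : additive_category D -> additive_category C.
Proof.
move=> [_ [Z hZ] hP]; split; first exact: PC.
  by case: (ffs_ob FF Z) hZ => Z' <- hZ; exists Z'; exact: ffs_zero_object.
move=> X Y; case: (hP (fob F X) (fob F Y)) => P; case: (ffs_ob FF P) => P' <-.
by move=> hP'; exists P'; exact: ffs_biproduct.
Qed.

Lemma ffs_split_idempotents : split_idempotents D -> split_idempotents C.
Proof.
move=> hD X e ee.
have [|Y [p' [i' []]]] := hD (fob F X) (fhom e).
  by apply/(ffs_comp_eq e e (harrP e)).
case: (ffs_ob FF Y) p' i' => Z <- p' i'.
have [i <-] := fhom_lift i'; have [p <-] := fhom_lift p'.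
rewrite -(farr_id FA) => e1 e2; exists Z, p, i.
split; apply/ffs_comp_eq => //; [exact: harrP | exact: (ffs_id FF)].
Qed.

Lemma ffs_isom X Y (f : arr X Y) : isom f -> isom (farr F f).
Proof.
move=> [cf [g [gf fg]]]; split; first exact: (farr_mor FA).
exists (fhom g); rewrite /= -!(farr_id FA) -gf -fg.
by rewrite !(farr_comp FA) //; exact: harrP.
Qed.

Lemma ffs_kernel X Y Z (f : chom X Y) (g : chom Y Z) :
  is_kernel (farr F f) (farr F g) -> is_kernel f g.
Proof.
move=> [gf univ]; split.
  by apply/ffs_comp_eq; [exact: (ffs_0 FF) | rewrite ffs_farr0].
move=> W h gh; have [|h1' []] := univ (fob F W) (fhom h).
  by rewrite -(ffs_farr0 W Z); apply/ffs_comp_eq => //; exact: (ffs_0 FF).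
have [h' <-] := fhom_lift h1' => fh' uniq; exists h'; split.
  by apply/ffs_comp_eq => //; exact: harrP.
move=> h'' fh''; apply: (ffs_faithful FF); try exact: harrP.
by apply: (uniq (fhom h'')); apply/ffs_comp_eq => //; exact: harrP.
Qed.

Lemma ffs_cokernel X Y Z (f : chom X Y) (g : chom Y Z) :
  is_cokernel (farr F f) (farr F g) -> is_cokernel f g.
Proof.
move=> [gf univ]; split.
  by apply/ffs_comp_eq; [exact: (ffs_0 FF) | rewrite ffs_farr0].
move=> W h hf; have [|h1' []] := univ (fob F W) (fhom h).
  by rewrite -(ffs_farr0 X W); apply/ffs_comp_eq => //; exact: (ffs_0 FF).
have [h' <-] := fhom_lift h1' => fh' uniq; exists h'; split.
  by apply/ffs_comp_eq => //; exact: harrP.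
move=> h'' fh''; apply: (ffs_faithful FF); try exact: harrP.
by apply: (uniq (fhom h'')); apply/ffs_comp_eq => //; exact: harrP.
Qed.

Lemma ffs_pushout X Y X' Y' (f : chom X Y) (h : chom X X') (f' : chom X' Y')
    (h' : chom Y Y') :
  is_pushout (farr F f) (farr F h) (farr F f') (farr F h') ->
  is_pushout f h f' h'.
Proof.
move=> [sq univ]; split; first exact/ffs_comp_eq2.
move=> W a b ab; have [|c1 []] := univ (fob F W) (fhom a) (fhom b).
  exact/ffs_comp_eq2.
have [c <-] := fhom_lift c1 => -[e1 e2] uniq; exists c; split.
  by split; apply/ffs_comp_eq => //; exact: harrP.
move=> d [d1 d2]; apply: (ffs_faithful FF); try exact: harrP.
by apply: (uniq (fhom d)); split; apply/ffs_comp_eq => //; exact: harrP.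
Qed.

Lemma ffs_pullback Y Z Y' Z' (g : chom Y Z) (h : chom Z' Z) (g' : chom Y' Z')
    (h' : chom Y' Y) :
  is_pullback (farr F g) (farr F h) (farr F g') (farr F h') ->
  is_pullback g h g' h'.
Proof.
move=> [sq univ]; split; first exact/ffs_comp_eq2.
move=> W a b ab; have [|c1 []] := univ (fob F W) (fhom a) (fhom b).
  exact/ffs_comp_eq2.
have [c <-] := fhom_lift c1 => -[e1 e2] uniq; exists c; split.
  by split; apply/ffs_comp_eq => //; exact: harrP.
move=> d [d1 d2]; apply: (ffs_faithful FF); try exact: harrP.
by apply: (uniq (fhom d)); split; apply/ffs_comp_eq => //; exact: harrP.
Qed.

(** * Transfer of the exact structure, and the quasi-inverse *)

Section Exact.
Variables (EC : pair_class C) (ED : pair_class D).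
Hypothesis ECD : forall (X Y Z : ob C) (f : arr X Y) (g : arr Y Z),
  EC f g <-> [/\ cmor f, cmor g & ED (farr F f) (farr F g)].
Hypothesis XD : exact_category ED.

Lemma ffs_inflation X Y (f : arr X Y) :
  inflation EC f <-> cmor f /\ inflation ED (farr F f).
Proof.
split=> [[Z [g /ECD [cf cg e]]]|[cf [Z]]].
  by split=> //; exists (fob F Z), (farr F g).
case: (ffs_ob FF Z) => Z' <- [g1 h].
have [_ /(ffs_full FF) [g cg e]] := exact_mor XD h.
by exists Z', g; apply/ECD; rewrite e.
Qed.

Lemma ffs_deflation Y Z (g : arr Y Z) :
  deflation EC g <-> cmor g /\ deflation ED (farr F g).
Proof.
split=> [[X [f /ECD [cf cg e]]]|[cg [X]]].
  by split=> //; exists (fob F X), (farr F f).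
case: (ffs_ob FF X) => X' <- [f1 h].
have [/(ffs_full FF) [f cf e] _] := exact_mor XD h.
by exists X', f; apply/ECD; rewrite e.
Qed.

Lemma ffs_exact : exact_category EC.
Proof.
have Fm := farr_mor FA; have Cc := ffs_comp FF; have h := harrP.
split.
- exact/ffs_additive/(exact_additive XD).
- by move=> X Y Z f g /ECD [].
- move=> X Y Z f g /ECD [cf cg e].
  exact: (@ffs_kernel X Y Z (CHom cf) (CHom cg) (exact_ker XD e)).
- move=> X Y Z f g /ECD [cf cg e].
  exact: (@ffs_cokernel X Y Z (CHom cf) (CHom cg) (exact_coker XD e)).
- move=> X Y Z f g X' Y' Z' f' g' a b c /ECD [cf cg e] ia ib ic e1 e2.
  apply/ECD; split; try exact: harrP.
  have [ca _] := ia; have [cb _] := ib; have [cc _] := ic.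
  apply: (@exact_iso _ _ XD _ _ _ _ _ _ _ _ (fhom f') (fhom g') _ _ _ e
    (ffs_isom ia) (ffs_isom ib) (ffs_isom ic)) => /=.
    by rewrite -!(farr_comp FA) ?e1 //; exact: harrP.
  by rewrite -!(farr_comp FA) ?e2 //; exact: harrP.
- move=> X; apply/ffs_inflation; split; first exact: (ffs_id FF).
  by rewrite (farr_id FA); exact: exact_infl_id.
- move=> X; apply/ffs_deflation; split; first exact: (ffs_id FF).
  by rewrite (farr_id FA); exact: exact_defl_id.
- move=> X Y Z f g /ffs_inflation [cf If] /ffs_inflation [cg Ig].
  apply/ffs_inflation; split; first exact: Cc.
  by rewrite (farr_comp FA) //; exact: exact_infl_comp.
- move=> X Y Z f g /ffs_deflation [cf If] /ffs_deflation [cg Ig].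
  apply/ffs_deflation; split; first exact: Cc.
  by rewrite (farr_comp FA) //; exact: exact_defl_comp.
- move=> X Y X' f k /ffs_inflation [cf If].
  have [Y1] := exact_pushout XD (fhom k) If.
  case: (ffs_ob FF Y1) => Y' <- [f1 [h1 []]].
  have [f' <-] := fhom_lift f1; have [h' <-] := fhom_lift h1 => po I1.
  exists Y', f', h'; split; first exact: (@ffs_pushout X Y X' Y' (CHom cf)).
  by apply/ffs_inflation; split=> //; exact: harrP.
- move=> Y Z Z' g k /ffs_deflation [cg Ig].
  have [Y1] := exact_pullback XD (fhom k) Ig.
  case: (ffs_ob FF Y1) => Y' <- [g1 [h1 []]].
  have [g' <-] := fhom_lift g1; have [h' <-] := fhom_lift h1 => po I1.
  exists Y', g', h'; split; first exact: (@ffs_pullback Y Z Y' Z' (CHom cg)).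
  by apply/ffs_deflation; split=> //; exact: harrP.
Qed.

(** Trades the equality of objects for mutually inverse isomorphisms, so that the quasi-inverse is
    defined on arrows by conjugation and not by transport. *)
Lemma ffs_ess_surj (T : ob D) : exists X : ob C,
  exists (i : chom (fob F X) T) (j : chom T (fob F X)),
    ccomp j i = cidm (fob F X) /\ ccomp i j = cidm T.
Proof.
case: (ffs_ob FF T) => X <-; exists X.
pose i := CHom (cmor_id PD (fob F X)); exists i, i.
by rewrite /= (ccomp1l PD) //; exact: cmor_id.
Qed.

Lemma ffs_equivalence : exact_equivalence EC ED F.
Proof.
have [X hX] := choice ffs_ess_surj.
pose i T := projT1 (cid (hX T)); pose hi T := projT2 (cid (hX T)).
pose j T := projT1 (cid (hi T)).
have ij T : ccomp (j T) (i T) = cidm _ /\ ccomp (i T) (j T) = cidm T.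
  exact: (projT2 (cid (hi T))).
(* The condition is vacuous for an arrow that is not a morphism, which makes [Ga] total on the
   ambient groups. *)
have lift S T (f : arr S T) : exists h : arr (X S) (X T),
    cmor f -> cmor h /\ farr F h = ccomp (j T) (ccomp f (i S)).
  case: (pselect (cmor f)) => [cf|//]; last by exists 0.
  have [h ch <-] : exists2 h : arr (X S) (X T), cmor h &
      farr F h = ccomp (j T) (ccomp f (i S)).
    by apply: (ffs_full FF); do 2?apply: (cmor_comp PD) => //; exact: harrP.
  by exists h.
pose Ga S T (f : arr S T) := projT1 (cid (lift S T f)).
have GaP S T (f : arr S T) : cmor f ->
    cmor (Ga S T f) /\ farr F (Ga S T f) = ccomp (j T) (ccomp f (i S)).
  by rewrite /Ga; case: cid.
pose G : functor_data D C := FunctorData Ga.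
have ci T := harrP (i T); have cj T := harrP (j T).
have cid_ := cmor_id PD; have cc := cmor_comp PD.
have iGa S T (f : arr S T) : cmor f ->
    ccomp (i T) (farr F (Ga S T f)) = ccomp f (i S).
  move=> cf; have [_ ->] := GaP _ _ _ cf.
  rewrite (ccompA PD) //; last by apply: cc.
  by have [_ ->] := ij T; rewrite (ccomp1l PD) //; apply: cc.
have GA : additive_functor G.
  split=> /=.
  - by move=> S T f /GaP [].
  - move=> T; have [c1 e1] := GaP _ _ _ (cid_ T).
    apply: (ffs_faithful FF) => //; first exact: (ffs_id FF).
    by rewrite e1 (ccomp1l PD) // (farr_id FA); case: (ij T).
  - move=> R S T g f cg cf; have [cGg eg] := GaP _ _ _ cg.
    have [cGf ef] := GaP _ _ _ cf; have [c1 e1] := GaP _ _ _ (cc _ _ _ _ _ cg cf).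
    apply: (ffs_faithful FF) => //; first by apply: (ffs_comp FF).
    have cFGf := farr_mor FA cGf.
    rewrite (farr_comp FA) // e1 eg -[RHS](ccompA PD) //; last exact: cc.
    congr (ccomp _ _); rewrite -[RHS](ccompA PD) // iGa //.
    by rewrite (ccompA PD).
  - move=> S T f g cf cg; have [c1 e1] := GaP _ _ _ cf.
    have [c2 e2] := GaP _ _ _ cg; have cfg := cmorD PD cf cg.
    have [c3 e3] := GaP _ _ _ cfg.
    apply: (ffs_faithful FF) => //; first exact: ffs_D.
    rewrite (farrD FA) // e1 e2 e3 (ccompDl PD) // (ccompDr PD) //; by apply: cc.
split=> //; first exact: ffs_exact.
  by split=> // S T R f g /ECD [].
exists G; split.
- split=> // R S T f g e; have [cf cg] := exact_mor XD e.
  have [cGf ef] := GaP _ _ _ cf; have [cGg eg] := GaP _ _ _ cg.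
  apply/ECD; split=> //.
  (* The pair obtained in [C] belongs to [EC] because its image under [F] is isomorphic, through
     [j], to the given pair. *)
  have ji T' : isom (j T' : arr _ _).
    by split=> //; exists (i T'); case: (ij T').
  apply: (@exact_iso _ _ XD _ _ _ _ _ _ _ _ (CHom (farr_mor FA cGf))
    (CHom (farr_mor FA cGg)) _ _ _ e (ji R) (ji S) (ji T)) => /=.
    rewrite ef -!(ccompA PD) //; last by apply: cc.
    by have [_ ->] := ij R; rewrite (ccomp1r PD).
  rewrite eg -!(ccompA PD) //; last by apply: cc.
  by have [_ ->] := ij S; rewrite (ccomp1r PD).
- have lift1 Y : exists f : chom (X (fob F Y)) Y, farr F f = i (fob F Y).
    exact: fhom_lift.
  pose eta Y := projT1 (cid (lift1 Y)).
  have heta Y : farr F (eta Y) = i (fob F Y) := projT2 (cid (lift1 Y)).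
  exists (fun Y => harr (eta Y)); split=> [Y|Y Z f] /=.
    split; first exact: harrP.
    have [th hth] := fhom_lift (j (fob F Y)); exists th.
    have [e1 e2] := ij (fob F Y).
    split; apply/ffs_comp_eq; try exact: (ffs_id FF).
      by rewrite heta hth (farr_id FA).
    by rewrite heta hth (farr_id FA).
  have [cG eG] := GaP _ _ _ (farr_mor FA (harrP f)).
  apply: (ffs_faithful FF); try by apply: (ffs_comp FF) => //; exact: harrP.
  rewrite !(farr_comp FA) //; try exact: harrP.
  by rewrite heta iGa //; [rewrite heta | exact: (farr_mor FA (harrP f))].
- exists (fun T => harr (i T)); split=> [T|S T f] /=.
    by split=> //; exists (j T); case: (ij T).
  by apply: iGa; exact: harrP.
Qed.
End Exact.
End Transfer.

(** * Linear maps between tensor products *)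

Section Sign.
Variable V : zmodType.
Implicit Types (x y : V) (d e : int).

Lemma ksign0 x : ksign 0 x = x. Proof. by []. Qed.
Lemma ksign_0r d : ksign d (0 : V) = 0.
Proof. by rewrite /ksign oppr0 if_same. Qed.
Lemma ksign1 x : ksign 1 x = - x. Proof. by []. Qed.
Lemma ksign_odd d e x : odd (absz (d)) = odd (absz (e)) -> ksign d x = ksign e x.
Proof. by rewrite /ksign => ->. Qed.

Lemma odd_absD d e : odd (absz (d + e)) = odd (absz (d)) (+) odd (absz (e)).
Proof. lia. Qed.
Lemma odd_absM d e : odd (absz (d * e)) = odd (absz d) && odd (absz e).
Proof. by rewrite abszM oddM. Qed.

Lemma ksign_add d e x : ksign (d + e) x = ksign d (ksign e x).
Proof.
by rewrite /ksign odd_absD; case: odd; case: odd => //=; rewrite opprK.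
Qed.
Lemma ksignN d x : ksign d (- x) = - ksign d x.
Proof. by rewrite /ksign; case: odd. Qed.
Lemma ksignK d x : ksign d (ksign d x) = x.
Proof. by rewrite /ksign; case: odd; rewrite ?opprK. Qed.
Lemma ksignS d x : ksign (d + 1) x = - ksign d x.
Proof. by rewrite ksign_add ksign1 ksignN. Qed.
Lemma ksign_sum d I (r : seq I) P (G : I -> V) :
  ksign d (\sum_(i <- r | P i) G i) = \sum_(i <- r | P i) ksign d (G i).
Proof. exact: (big_morph _ (ksignD d) (ksign_0r d)). Qed.
End Sign.

Lemma morph_ksign (V W : zmodType) (f : V -> W) d x :
  {morph f : x y / x + y} -> f (ksign d x) = ksign d (f x).
Proof.
move=> fD; have f0 : f 0 = 0 by apply: (addrI (f 0)); rewrite -fD !addr0.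
rewrite /ksign; case: odd => //.
by apply: (addrI (f x)); rewrite -fD !subrr.
Qed.

Section LinearMaps.
Variables (k : fieldType) (S : falgType k).
Implicit Types (M N : gmod S) (A B C : gbimod S).

Section Lin.
Variables (U V : lmodType S^c) (f : U -> V).
Hypothesis fL : linear f.
Lemma linD : {morph f : x y / x + y}.
Proof. by move=> x y; have := fL 1 x y; rewrite !scale1r. Qed.
Lemma lin0 : f 0 = 0.
Proof. by apply: (addrI (f 0)); rewrite -linD !addr0. Qed.
Lemma linZ s x : f (s *: x) = s *: f x.
Proof. by have := fL s x 0; rewrite lin0 !addr0. Qed.
Lemma lin_rmul s x : f (rmul x s) = rmul (f x) s.
Proof. exact: linZ. Qed.
Lemma linN x : f (- x) = - f x.
Proof. by apply: (addrI (f x)); rewrite -linD !subrr lin0. Qed.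
Lemma linB : {morph f : x y / x - y}.
Proof. by move=> x y; rewrite linD linN. Qed.
Lemma lin_sum I (r : seq I) P (F : I -> U) :
  f (\sum_(i <- r | P i) F i) = \sum_(i <- r | P i) f (F i).
Proof. exact: (big_morph f linD lin0). Qed.
Lemma lin_ksign d x : f (ksign d x) = ksign d (f x).
Proof. by apply: morph_ksign; exact: linD. Qed.
End Lin.

Lemma linear_intro (U V : lmodType S^c) (f : U -> V) :
  {morph f : x y / x + y} -> (forall s x, f (s *: x) = s *: f x) -> linear f.
Proof. by move=> fD fZ s x y; rewrite fD fZ. Qed.

Lemma linear_id (U : lmodType S^c) : linear (fun x : U => x).
Proof. by []. Qed.
Lemma linear_zero (U V : lmodType S^c) : linear (fun _ : U => 0 : V).
Proof. by move=> s x y; rewrite scaler0 addr0. Qed.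
Lemma linear_comp (U V W : lmodType S^c) (g : V -> W) (f : U -> V) :
  linear g -> linear f -> linear (fun x => g (f x)).
Proof. by move=> gL fL s x y; rewrite fL gL. Qed.
Lemma linear_add (U V : lmodType S^c) (f g : U -> V) :
  linear f -> linear g -> linear (fun x => f x + g x).
Proof. by move=> fL gL s x y; rewrite fL gL scalerDr addrACA. Qed.
Lemma linear_opp (U V : lmodType S^c) (f : U -> V) :
  linear f -> linear (fun x => - f x).
Proof. by move=> fL s x y; rewrite fL opprD scalerN. Qed.
Lemma linear_ksign (U V : lmodType S^c) d (f : U -> V) :
  linear f -> linear (fun x => ksign d (f x)).
Proof. by move=> fL; rewrite /ksign; case: odd => //; exact: linear_opp. Qed.
Lemma linear_bigsum (U V : lmodType S^c) I (r : seq I) (P : pred I) (F : I -> U -> V) :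
  (forall i, P i -> linear (F i)) -> linear (fun x => \sum_(i <- r | P i) F i x).
Proof.
move=> FL s x y; rewrite scaler_sumr -big_split.
by apply: eq_bigr => i Pi; rewrite FL.
Qed.

(** Bimodule morphisms stripped of their degree: enough for [tmap] and [ktens] to compute on pure
    tensors, and stable under the constructions below. *)
Definition bml (A B : gbimod S) (f : A -> B) : Prop :=
  linear f /\ forall s a, f (lmul s a) = lmul s (f a).

Lemma bml_id A : bml (fun x : A => x). Proof. by []. Qed.
Lemma bml_comp A B C (g : B -> C) (f : A -> B) :
  bml g -> bml f -> bml (fun x => g (f x)).
Proof.
by move=> [gL gS] [fL fS]; split=> [|s a]; rewrite ?fS ?gS //; exact: linear_comp.
Qed.
Lemma bml_zero A B : bml (fun _ : A => 0 : B).
Proof. by split=> [|s a]; [exact: linear_zero | rewrite lmul0]. Qed.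
Lemma bml_sum A B I (r : seq I) (P : pred I) (F : I -> A -> B) :
  (forall i, P i -> bml (F i)) -> bml (fun x => \sum_(i <- r | P i) F i x).
Proof.
move=> h; split=> [|s a]; first by apply: linear_bigsum => i /h [].
rewrite (big_morph (lmul s) (lmulDr s) (lmul0 B s)).
by apply: eq_bigr => i /h [].
Qed.

Lemma tlift_linear M B (V : lmodType S^c) (phi : M -> B -> V) :
  balanced (@rmul k S M) (@lmul k S B) phi ->
  (forall m s b, phi m (s *: b) = s *: phi m b) ->
  linear (fun x : gtens M B => tlift phi (x : mtens M B)).
Proof.
move=> bal phiZ; apply: linear_intro => [x y|s x]; first exact: (tliftD bal).
apply: (mt_ext (f := fun x => tlift phi (s *: (x : gtens M B) : mtens M B))
  (g := fun x => s *: tlift phi x)) x => [x y|x y|m b].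
- by rewrite scalerDr; exact: (tliftD bal).
- by rewrite -scalerDr; congr (_ *: _); exact: (tliftD bal).
- by rewrite [_ *: _]mtZ !(tliftE bal).
Qed.

Lemma linear_gtens_ext M B (V : lmodType S^c) (f g : gtens M B -> V) :
  linear f -> linear g -> (forall m b, f (pt m b) = g (pt m b)) -> f =1 g.
Proof. by move=> fL gL; apply: mt_ext; exact: linD. Qed.

Lemma ptDl M B (m m' : M) (b : B) : pt (m + m') b = pt m b + pt m' b.
Proof. exact: tpureDl. Qed.
Lemma ptDr M B (m : M) (b b' : B) : pt m (b + b') = pt m b + pt m b'.
Proof. exact: tpureDr. Qed.
Lemma pt0l M B (b : B) : pt (0 : M) b = 0.
Proof. exact: tpure0l. Qed.
Lemma pt0r M B (m : M) : pt m (0 : B) = 0.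
Proof. exact: tpure0r. Qed.
Lemma pt_bal M B (m : M) s (b : B) : pt (rmul m s) b = pt m (lmul s b).
Proof. exact: tpure_bal. Qed.
Lemma pt_ksignl M B d (m : M) (b : B) : pt (ksign d m) b = ksign d (pt m b).
Proof.
by apply: (morph_ksign d m (f := fun m => pt m b)) => x y; rewrite ptDl.
Qed.
Lemma pt_ksignr M B d (m : M) (b : B) : pt m (ksign d b) = ksign d (pt m b).
Proof. by apply: morph_ksign => x y; rewrite ptDr. Qed.

Lemma tmapEl M M' B B' (f : M -> M') (g : B -> B') m b :
  linear f -> bml g -> tmap f g (pt m b) = pt (f m) (g b).
Proof. by move=> fL [gL gS]; apply: tmapE => //; exact: linD. Qed.

Lemma tmap_linear M M' B B' (f : M -> M') (g : B -> B') :
  linear f -> bml g -> linear (tmap f g).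
Proof.
move=> fL [gL gS]; apply: tlift_linear; first split.
- by move=> x y b; rewrite (linD fL) ptDl.
- by move=> x y b; rewrite (linD gL) ptDr.
- by move=> x s b; rewrite (lin_rmul fL) gS pt_bal.
- by move=> m s b; rewrite (linZ gL) [RHS]mtZ.
Qed.

Lemma tmap_bml A A' B B' (f : A -> A') (g : B -> B') :
  bml f -> bml g -> @bml (btens A B) (btens A' B') (tmap f g).
Proof.
move=> [fL fS] gB; have tL := tmap_linear fL gB; split=> // s.
apply: (@mt_ext _ _ A B _ (fun x => tmap f g (bt_lmul s x))
  (fun x => bt_lmul s (tmap f g x))) => [x y|x y|m b].
- by rewrite bt_lmulDr (linD tL).
- by rewrite (linD tL) bt_lmulDr.
- by rewrite bt_lmulE !tmapEl // bt_lmulE fS.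
Qed.

Lemma tassoc_linear M A B : linear (@tassoc k S M A B).
Proof.
have bal (m : M) := tassoc_inner A B m.
apply: tlift_linear; first split.
- move=> x y z; rewrite -tlift_addf; apply: eq_tlift => a b.
  by rewrite ptDl ptDl.
- move=> x z w; exact: (tliftD (bal x)).
- move=> x s; apply: (mt_ext (f := fun z : mtens A B => tlift
    (fun a b => pt (pt (rmul x s) a : gtens M A) b : mtens (gtens M A) B) z)
  (g := fun z : mtens A B => tlift
    (fun a b => pt (pt x a : gtens M A) b : mtens (gtens M A) B)
    (bt_lmul s z))) => [u v|u v|c d].
  + exact: (tliftD (bal (rmul x s))).
  + by rewrite bt_lmulDr; exact: (tliftD (bal x)).
  + by rewrite bt_lmulE [LHS](tliftE (bal _)) [RHS](tliftE (bal _)) pt_bal.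
- move=> x s; apply: (mt_ext (f := fun z : mtens A B => tlift
    (fun a b => pt (pt x a : gtens M A) b : mtens (gtens M A) B) (s *: z))
  (g := fun z : mtens A B => s *: (tlift
    (fun a b => pt (pt x a : gtens M A) b : mtens (gtens M A) B) z :
      mtens (gtens M A) B))) => [u v|u v|c d].
  + by rewrite scalerDr; exact: (tliftD (bal x)).
  + by rewrite -scalerDr; congr (_ *: _); exact: (tliftD (bal x)).
  + by rewrite mtZ [LHS](tliftE (bal _)) [in RHS](tliftE (bal _)) mtZ.
Qed.

Lemma tassoc_bml A B C :
  @bml (btens A (btens B C)) (btens (btens A B) C) (@tassoc k S A B C).
Proof.
have tL := @tassoc_linear A B C; split=> // s.
apply: (@mt_ext _ _ A (btens B C) _ (fun x => tassoc (bt_lmul s x))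
  (fun x => bt_lmul s (tassoc x : btens (btens A B) C))) => [x y|x y|a].
- by rewrite bt_lmulDr (linD tL).
- by rewrite (linD tL) bt_lmulDr.
move=> z; rewrite bt_lmulE; move: z.
apply: (@mt_ext _ _ B C (gtens (gtens A B) C)
    (fun z => tassoc (pt (lmul s a) (z : btens B C)))
    (fun z => bt_lmul s (tassoc (pt a (z : btens B C)) : btens (btens A B) C)) _ _ _) => [x y|x y|b c].
- by rewrite ptDr (linD tL).
- by rewrite ptDr (linD tL) bt_lmulDr.
by rewrite !tassocE [RHS]bt_lmulE /= bt_lmulE.
Qed.

Lemma koszul_bml A d : bml (@koszul k S A d).
Proof.
split=> [|s a]; first exact: koszul_linear.
rewrite {1}(gsuppE a) (big_morph (lmul s) (lmulDr s) (lmul0 A s)).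
rewrite (lin_sum (koszul_linear _)) [in RHS]/koszul /gsumf.
rewrite (big_morph (lmul s) (lmulDr s) (lmul0 A s)); apply: eq_bigr => i _.
rewrite (@koszulE k S A d i); last by rewrite /homog gpr_lmul gprK eqxx.
by rewrite (morph_ksign _ _ (lmulDr s)).
Qed.

Lemma koszulK (M : gmod S) d : involutive (@koszul k S M d).
Proof.
move=> m; rewrite {1}(gsuppE m) !(lin_sum (koszul_linear _)) [RHS]gsuppE.
apply: eq_bigr => i _; have hi := homog_gpr i m.
by rewrite (koszulE d hi) (lin_ksign (koszul_linear _)) (koszulE d hi) ksignK.
Qed.

Lemma ktens_linear d M M' B B' (f : M -> M') (g : B -> B') :
  linear f -> bml g -> linear (ktens d f g).
Proof.
by move=> fL gB; apply: tmap_linear => //; apply: linear_comp (koszul_linear _).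
Qed.
Lemma ktens_bml d A A' B B' (f : A -> A') (g : B -> B') :
  bml f -> bml g -> @bml (btens A B) (btens A' B') (ktens d f g).
Proof.
by move=> fB gB; apply: tmap_bml => //; apply: bml_comp => //; exact: koszul_bml.
Qed.
Lemma ktensEl d M M' B B' (f : M -> M') (g : B -> B') i m b :
  linear f -> bml g -> homog i m ->
  ktens d f g (pt m b) = ksign (d * i) (pt (f m) (g b) : gtens M' B').
Proof. by move=> fL [gL gS] hm; apply: ktensE => //; exact: linD. Qed.

Section DSum.
Variable F : nat -> gbimod S.

Lemma fcast_bml n n' : @bml (F n) (F n') (@fcast k S F n n').
Proof.
rewrite /fcast; case: eqP => [e|_]; last exact: bml_zero.
by case: _ / e; exact: bml_id.
Qed.

Lemma din_bml n : @bml (F n) (bdsum F) (@din k S F n).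
Proof.
split=> [s x y|s x]; apply: dsum_ext => m.
  by have [cL _] := fcast_bml n m; rewrite dvalD dvalZ; exact: cL.
by rewrite [RHS]dlmulE; case: (fcast_bml n m) => _; exact.
Qed.

(** [dlift] sums up to a bound chosen for each element. Additivity compares elements with different
    bounds, so any valid bound has to give the same value. *)
Lemma dlift_bound (V : zmodType) (phi : forall n, F n -> V) (x : bdsum F) (N : nat) :
  (forall n, phi n 0 = 0) -> (forall n, (N <= n)%N -> (x : dsum F) n = 0) ->
  dlift phi x = \sum_(n < N) phi n ((x : dsum F) n).
Proof.
move=> phi0 hN; rewrite /dlift -!(big_mkord xpredT (fun n => phi n ((x : dsum F) n))).
have big_max K : (forall n, (K <= n)%N -> (x : dsum F) n = 0) ->
    \sum_(0 <= n < K) phi n ((x : dsum F) n) =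
    \sum_(0 <= n < maxn K (maxn N (dbound x))) phi n ((x : dsum F) n).
  move=> hK; rewrite [RHS](@big_cat_nat _ _ _ K) //=; last by rewrite leq_maxl.
  rewrite [X in _ = _ + X]big_nat [X in _ = _ + X]big1 ?addr0 // => n /andP[Kn _].
  by rewrite hK // phi0.
rewrite (big_max _ (@dboundP _ _ _ x)) (big_max _ hN).
by rewrite [maxn N (dbound x)]maxnC !maxnA maxnn [maxn N (dbound x)]maxnC -maxnA maxnn.
Qed.

Section Lift.
Variables (V : zmodType) (phi : forall n, F n -> V).
Hypothesis phiD : forall n, {morph (@phi n) : x y / x + y}.

Let phi0 n : @phi n 0 = 0.
Proof. by apply: (addrI (phi (0 : F n))); rewrite -phiD !addr0. Qed.

Lemma dliftEd n (x : F n) : dlift (@phi) (din x) = phi x.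
Proof. exact: dliftE. Qed.

Lemma dliftD : {morph dlift (@phi) : x y / x + y}.
Proof.
move=> x y; pose N := maxn (dbound x) (dbound y).
have hx n : (N <= n)%N -> (x : dsum F) n = 0.
  by rewrite geq_max => /andP[h _]; exact: dboundP.
have hy n : (N <= n)%N -> (y : dsum F) n = 0.
  by rewrite geq_max => /andP[_ h]; exact: dboundP.
rewrite !(@dlift_bound _ (@phi) _ N) //; last first.
  by move=> n hn; rewrite dvalD hx ?hy ?addr0.
by rewrite -big_split; apply: eq_bigr => n _; rewrite dvalD phiD.
Qed.
End Lift.

Lemma dlift_linear (V : lmodType S^c) (phi : forall n, F n -> V) :
  (forall n, linear (phi n)) -> linear (dlift phi).
Proof.
move=> phiL; apply: linear_intro => [|s x]; first by apply: dliftD => n; exact: linD.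
have h n : ((dbound x) <= n)%N -> (x : dsum F) n = 0 by move=> hn; exact: dboundP.
rewrite !(@dlift_bound _ phi _ (dbound x)) //; try by move=> n; exact: lin0.
  by rewrite scaler_sumr; apply: eq_bigr => n _; rewrite dvalZ (linZ (phiL n)).
by move=> n hn; rewrite dvalZ h // scaler0.
Qed.

Lemma dlift_bml (B : gbimod S) (phi : forall n, F n -> B) :
  (forall n, bml (phi n)) -> @bml (bdsum F) B (dlift phi).
Proof.
move=> phiB; have phiL n : linear (phi n) by case: (phiB n).
split=> [|s x]; first exact: dlift_linear.
have h n : ((dbound x) <= n)%N -> (x : dsum F) n = 0 by move=> hn; exact: dboundP.
rewrite !(@dlift_bound _ phi _ (dbound x)) //; try by move=> n; exact: lin0.
  rewrite (big_morph (lmul s) (lmulDr s) (lmul0 B s)).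
  by apply: eq_bigr => n _; rewrite dlmulE; case: (phiB n) => _ ->.
by move=> n hn; rewrite dlmulE h // lmul0.
Qed.

Lemma bdsum_ind (P : bdsum F -> Prop) :
  P 0 -> (forall n (x : F n) y, P y -> P (din x + y)) -> forall x, P x.
Proof.
move=> P0 PD x.
have -> : x = \sum_(n < dbound x) din ((x : dsum F) n).
  apply: dsum_ext => n; rewrite dval_sum /=.
  have [lt_n|le_n] := ltnP n (dbound x).
    rewrite (bigD1 (Ordinal lt_n)) //= fcast_id big1 ?addr0 // => m /eqP mn.
    by rewrite fcast_neq // => e; apply: mn; apply: val_inj.
  rewrite (dboundP le_n) big1 // => m _; rewrite fcast_neq // => e.
  by have := leq_trans (ltn_ord m) le_n; rewrite -e ltnn.
by elim/big_rec: _ => // i y _; exact: PD.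
Qed.
End DSum.

Lemma tsplit_bml A p q : @bml (tpow A (p + q)) (btens (tpow A p) (tpow A q))
  (@tsplit k S A p q).
Proof.
elim: p => [|p IH] /=.
  split=> [s x y|s x].
    by rewrite ptDr; congr (_ + _); rewrite -mtZ.
  rewrite [RHS]bt_lmulE -pt_bal; congr pt.
  by rewrite /rmul /= /reg_lmul mulr1; exact: (@mul1r S).
apply: (@bml_comp (btens A (tpow A (p + q))) (btens A (btens (tpow A p) (tpow A q)))).
  exact: tassoc_bml.
by apply: tmap_bml.
Qed.

Lemma idtens_bml A r d p q (phi : tpow A p -> tpow A q) :
  bml phi -> bml (@idtens k S A r d p q phi).
Proof. by move=> hphi; elim: r => [//|r IH] /=; apply: ktens_bml. Qed.

Lemma insert_bml A r s t d (phi : tpow A s -> A) n :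
  bml phi -> bml (@insert k S A r s t d phi n).
Proof.
move=> hphi; apply: (bml_comp (f := @fcast k S (tpow A) n _)) => [|].
  apply: idtens_bml; apply: (bml_comp (B := btens (tpow A s) (tpow A t))).
    exact: tmap_bml.
  exact: tsplit_bml.
exact: fcast_bml.
Qed.

Lemma msplit_linear A M p q n : linear (@msplit k S A M p q n).
Proof.
apply: linear_comp; first exact: tassoc_linear.
apply: tmap_linear => //; apply: bml_comp; first exact: tsplit_bml.
exact: fcast_bml.
Qed.
End LinearMaps.

Arguments tsplit {k S A} p q x.
(** * Words in tensor powers *)

Section SplitSums.
Variables (T : Type) (V : zmodType).
Implicit Types (u v w a b c : seq T) (Phi : seq T -> seq T -> V).

(** The cuts range over all factorizations of the word, with either side possibly empty, as in the
    coproduct of the bar construction. Indexing by subwords instead of lengths turns the regrouping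
    of iterated sums into [deconc_coassoc]. *)
Definition deconc w Phi : V :=
  \sum_(p < (size w).+1) Phi (take p w) (drop p w).

Lemma deconc_nil Phi : deconc [::] Phi = Phi [::] [::].
Proof. by rewrite /deconc big_ord1. Qed.

Lemma deconc_cons x w Phi :
  deconc (x :: w) Phi = Phi [::] (x :: w) + deconc w (fun a b => Phi (x :: a) b).
Proof. by rewrite /deconc big_ord_recl /= ?take0 ?drop0. Qed.

Lemma eq_deconc w Phi Psi : (forall a b, w = a ++ b -> Phi a b = Psi a b) ->
  deconc w Phi = deconc w Psi.
Proof. by move=> h; apply: eq_bigr => p _; apply: h; rewrite cat_take_drop. Qed.

Lemma deconc_add w Phi Psi :
  deconc w (fun a b => Phi a b + Psi a b) = deconc w Phi + deconc w Psi.
Proof. exact: big_split. Qed.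

Lemma deconc_opp w Phi : deconc w (fun a b => - Phi a b) = - deconc w Phi.
Proof. by rewrite /deconc sumrN. Qed.

Lemma deconc_ksign d w Phi : deconc w (fun a b => ksign d (Phi a b)) = ksign d (deconc w Phi).
Proof. by rewrite /deconc ksign_sum. Qed.

Lemma deconc0 w Phi : (forall a b, w = a ++ b -> Phi a b = 0) -> deconc w Phi = 0.
Proof. by move=> h; rewrite (eq_deconc h) /deconc big1. Qed.

Lemma deconc_coassoc w (Phi : seq T -> seq T -> seq T -> V) :
  deconc w (fun a bc => deconc bc (Phi a)) = deconc w (fun ab c => deconc ab (fun a b => Phi a b c)).
Proof.
elim: w Phi => [|x w IH] Phi; first by rewrite !deconc_nil.
rewrite !deconc_cons IH deconc_nil -addrA; congr (_ + _); rewrite -deconc_add.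
by apply: eq_deconc => a b _; rewrite deconc_cons.
Qed.

(** A cut lies on one side or the other of the letter [x]. It is applied with [x] the value of an
    operation, to locate that letter relative to a cut. *)
Lemma deconc_cat_cons u x v Phi : deconc (u ++ x :: v) Phi =
  deconc u (fun a b => Phi a (b ++ x :: v)) +
  deconc v (fun a b => Phi (u ++ x :: a) b).
Proof.
elim: u Phi => [|y u IH] Phi /=; first by rewrite deconc_cons deconc_nil.
by rewrite !deconc_cons IH addrA.
Qed.

Lemma sum2_deconc n w (G : nat -> nat -> V) Phi : size w = n ->
  (forall a b, w = a ++ b -> G (size a) (size b) = Phi a b) ->
  sum2 n G = deconc w Phi.
Proof.
move=> <- h; rewrite /sum2 /deconc; apply: eq_bigr => p _.
rewrite (bigD1 (rev_ord p)) /=; last by rewrite subSS subnKC // -ltnS.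
rewrite big1 ?addr0 => [|i /andP[/eqP e /eqP ne]]; last first.
  by case: ne; apply: val_inj => /=; lia.
rewrite -h ?cat_take_drop // size_drop size_takel ?subSS //.
by rewrite -ltnS.
Qed.

(** [sum3] has windows of length s >= 1 only, whereas the nested deconcatenation also produces empty
    windows; the vanishing of Phi on those makes up the difference. *)
Lemma sum3_deconc n w (G : nat -> nat -> nat -> V) (Phi : seq T -> seq T -> seq T -> V) :
  size w = n ->
  (forall a c, w = a ++ c -> Phi a [::] c = 0) ->
  (forall a b c, w = a ++ b ++ c -> (0 < size b)%N ->
    G (size a) (size b) (size c) = Phi a b c) ->
  sum3 n G = deconc w (fun a bc => deconc bc (fun b c => Phi a b c)).
Proof.
move=> sw h0 h; rewrite /sum3 /deconc sw; apply: eq_bigr => r _.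
have rn : (r <= n)%N by rewrite -ltnS.
rewrite size_drop sw -(big_mkord xpredT (fun s =>
  Phi (take r w) (take s (drop r w)) (drop s (drop r w)))).
rewrite -(big_mkord (fun s => (0 < s)%N) (fun s =>
  \sum_(t < n.+1 | (r + s + t)%N == n) G r s t)).
rewrite (big_cat_nat (n := (n - r).+1)) //=; last by rewrite ltnS leq_subr.
rewrite [X in _ + X]big_nat_cond [X in _ + X]big1 ?addr0 => [|s]; last first.
  move=> /andP[/andP[s1 s2] _]; rewrite big1 // => t /eqP e; lia.
rewrite big_mkcond; rewrite !big_nat; apply: eq_bigr => s /andP[_ sr].
case: ltnP => [s0|]; last first.
  rewrite leqn0 => /eqP ->; rewrite take0 drop0 h0 //.
  by rewrite cat_take_drop.
have lt : (n - (r + s) < n.+1)%N by rewrite ltnS leq_subr.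
have le : (r + s <= n)%N by lia.
rewrite (bigD1 (Ordinal lt)) /=; last by rewrite subnKC.
rewrite big1 ?addr0 => [|t /andP[/eqP e /eqP ne]]; last first.
  by case: ne; apply: val_inj => /=; lia.
have sa : size (take r w) = r by rewrite size_takel // sw.
have sb : size (take s (drop r w)) = s by rewrite size_takel // size_drop sw; lia.
have sc : size (drop s (drop r w)) = (n - (r + s))%N.
  by rewrite !size_drop sw subnDA.
by rewrite -h ?sa ?sb ?sc // !cat_take_drop.
Qed.
End SplitSums.

Lemma deconc_map (T T' : Type) (V : zmodType) (f : T -> T') w
    (Phi : seq T' -> seq T' -> V) :
  deconc [seq f x | x <- w] Phi =
  deconc w (fun a b => Phi [seq f x | x <- a] [seq f x | x <- b]).
Proof.
by rewrite /deconc size_map; apply: eq_bigr => p _; rewrite map_take map_drop.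
Qed.

Lemma morph_deconc (T : Type) (V W : zmodType) (f : V -> W) w
    (Phi : seq T -> seq T -> V) :
  {morph f : x y / x + y} -> f (deconc w Phi) = deconc w (fun a b => f (Phi a b)).
Proof.
move=> fD; have f0 : f 0 = 0 by apply: (addrI (f 0)); rewrite -fD !addr0.
exact: (big_morph f fD f0).
Qed.

Section Words.
Variables (k : fieldType) (S : falgType k).
Implicit Types (M N : gmod S).

(** The degree is stored as data because 0 is homogeneous of every degree, while the sign formulas
    need a definite exponent. *)
Record hel M := Hel { hdeg : int; hval :> M; hvalP : homog hdeg hval }.

Lemma hel0P M d : homog d (0 : M). Proof. exact: gpr0. Qed.

Lemma homog_ksign M d e (x : M) : homog d x -> homog d (ksign e x).
Proof. by rewrite /homog (morph_ksign _ _ (@gprD _ _ M d)) => ->. Qed.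
Lemma homog_sum M d I (r : seq I) (P : pred I) (F : I -> M) :
  (forall i, P i -> homog d (F i)) -> homog d (\sum_(i <- r | P i) F i).
Proof. by move=> h; rewrite /homog gpr_big; apply: eq_bigr. Qed.
Lemma homog_deconc (T : Type) M d (u : seq T) (Phi : seq T -> seq T -> M) :
  (forall a b, u = a ++ b -> homog d (Phi a b)) -> homog d (deconc u Phi).
Proof.
by move=> h; apply: homog_sum => p _; apply: h; rewrite cat_take_drop.
Qed.
Lemma homog_pt M (B : gbimod S) i j (m : M) (b : B) :
  homog i m -> homog j b -> homog (i + j) (pt m b : gtens M B).
Proof. by move=> hm hb; rewrite /homog /= (mt_pr_homog _ hm hb) eqxx. Qed.
Lemma homog_1 : homog 0 (1 : breg S). Proof. by []. Qed.

Section Pure.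
Variable B : gbimod S.
Implicit Types (w : seq B) (h : seq (hel B)).

(** The length [n] is kept apart from the word, with value 0 on a mismatch: the type can then be
    changed along an equality of lengths while the word stays the same, and concatenations need no
    dependent casts. *)
Fixpoint pure_word n w : tpow B n :=
  match n return tpow B n with
  | 0 => if w is [::] then (1 : breg S) else 0
  | n'.+1 => if w is x :: w' then pt x (pure_word n' w') else 0
  end.

Definition vs h : seq B := [seq hval x | x <- h].
Definition wdeg h : int := \sum_(x <- h) hdeg x.

Lemma wdeg_cons (x : hel B) h : wdeg (x :: h) = hdeg x + wdeg h.
Proof. exact: big_cons. Qed.
Lemma wdeg_nil : wdeg [::] = 0. Proof. exact: big_nil. Qed.
Lemma wdeg_cat h h' : wdeg (h ++ h') = wdeg h + wdeg h'.
Proof. exact: big_cat. Qed.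
Lemma vs_cat h h' : vs (h ++ h') = vs h ++ vs h'. Proof. exact: map_cat. Qed.
Lemma vs_cons (x : hel B) h : vs (x :: h) = hval x :: vs h. Proof. by []. Qed.
Lemma size_vs h : size (vs h) = size h. Proof. exact: size_map. Qed.
Lemma deconc_vs (V : zmodType) h (Phi : seq B -> seq B -> V) :
  deconc (vs h) Phi = deconc h (fun a b => Phi (vs a) (vs b)).
Proof. exact: deconc_map. Qed.

Lemma pure_word_homog n h : homog (wdeg h) (pure_word n (vs h)).
Proof.
elim: n h => [|n IH] [|x h] /=; rewrite ?wdeg_nil; try exact: hel0P.
  exact: homog_1.
by rewrite wdeg_cons; apply: homog_pt; [exact: hvalP | exact: IH].
Qed.

Lemma pure_word_slotD n (a c : seq B) x y :
  pure_word n (a ++ (x + y) :: c) = pure_word n (a ++ x :: c) + pure_word n (a ++ y :: c).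
Proof.
elim: n a => [|n IH] [|z a] /=; rewrite ?addr0 //; first exact: ptDl.
by rewrite IH; exact: ptDr.
Qed.

Lemma fcast_pure_word n n' w : n = n' -> fcast n' (pure_word n w) = pure_word n' w.
Proof. by move=> <-; rewrite fcast_id. Qed.

Lemma tsplit_pure_word p q w : tsplit p q (pure_word (p + q) w) =
  pt (pure_word p (take p w)) (pure_word q (drop p w)) :> btens (tpow B p) (tpow B q).
Proof.
elim: p w => [|p IH] w; first by rewrite take0 drop0; case: w.
have tL := tmap_linear (@linear_id _ _ B) (@tsplit_bml k S B p q).
case: w => [|x w] /=; first by rewrite (lin0 tL) (lin0 (@tassoc_linear _ _ _ _ _)) pt0l.
by rewrite tmapEl ?IH ?tassocE //; exact: tsplit_bml.
Qed.

Lemma idtens_pure_word d p q (phi : tpow B p -> tpow B q) h w w' : bml phi ->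
  phi (pure_word p w) = pure_word q w' ->
  @idtens k S B (size h) d p q phi (pure_word (size h + p) (vs h ++ w)) =
    ksign (d * wdeg h) (pure_word (size h + q) (vs h ++ w')).
Proof.
move=> phiB phiw; elim: h => [|x h IH] /=; first by rewrite wdeg_nil mulr0.
rewrite (@ktensEl _ _ d _ _ _ _ _ _ (hdeg x)) //; last first.
- exact: hvalP.
- exact: idtens_bml.
by rewrite IH pt_ksignr -ksign_add wdeg_cons mulrDr.
Qed.

Lemma insert_pure_word d r s t n (phi : tpow B s -> B) a w : bml phi ->
  size a = r -> n = (r + (s + t))%N ->
  @insert k S B r s t d phi n (pure_word n (vs a ++ w)) =
    ksign (d * wdeg a)
      (pure_word (r + t.+1) (vs a ++ phi (pure_word s (take s w)) :: drop s w)).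
Proof.
move=> phiB <- e; rewrite /insert fcast_pure_word //; apply: idtens_pure_word.
  apply: (bml_comp (B := btens (tpow B s) (tpow B t))).
    exact: tmap_bml.
  exact: tsplit_bml.
by rewrite tsplit_pure_word tmapEl //; case: phiB.
Qed.

(** Restricted to positive length, because the elements of [tpow B 0], which is S, are not sums of
    empty words. In positive length the scalar in the final factor S is absorbed by the last
    letter. *)
Lemma tpow_ind n (P : tpow B n.+1 -> Prop) :
  P 0 -> (forall h, size h = n.+1 -> P (pure_word n.+1 (vs h))) ->
  (forall x y, P x -> P y -> P (x + y)) -> forall x, P x.
Proof.
elim: n P => [|n IH] P P0 Ph PD; apply: tens_ind => // b y x Px; apply: (PD) => //.
  have -> : tpure (@rmul _ _ B) (@lmul _ _ (tpow B 0)) b y =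
      pt (rmul b (y : S)) (1 : breg S) :> gtens B (tpow B 0).
    rewrite pt_bal; congr tpure; rewrite /= /reg_lmul.
    by rewrite (@mulr1 S).
  rewrite [rmul b _]gsuppE /pt tpure_suml; elim: (gsupp _) => [|i s IHs].
    by rewrite big_nil.
  rewrite big_cons; apply: (PD) => //.
  exact: (Ph [:: Hel (homog_gpr i (rmul b (y : S)))]).
have Q z : P (pt b z).
  move: z; apply: IH => [|h sh|z z' Pz Pz'].
  - by rewrite pt0r.
  - rewrite [b in pt b]gsuppE /pt tpure_suml; elim: (gsupp _) => [|i s IHs].
      by rewrite big_nil.
    rewrite big_cons; apply: (PD) => //.
    by apply: (Ph (Hel (homog_gpr i b) :: h)); rewrite /= sh.
  - by rewrite ptDr; exact: (PD).
exact: Q.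
Qed.

Section Module.
Variable M : gmod S.

Lemma msplit_pure_word p q n (m : M) w : n = (p + q)%N ->
  msplit p q (pt m (pure_word n w) : gtens M (tpow B n)) =
    pt (pt m (pure_word p (take p w)) : gtens M (tpow B p)) (pure_word q (drop p w)).
Proof.
move=> e; rewrite /msplit tmapEl //; last first.
  apply: bml_comp; first exact: tsplit_bml.
  exact: fcast_bml.
by rewrite fcast_pure_word // tsplit_pure_word tassocE.
Qed.

(** Length 0 is included here: the scalar is then absorbed by the element of M. *)
Lemma mtpow_ind n (P : gtens M (tpow B n) -> Prop) :
  P 0 -> (forall (m : hel M) h, size h = n -> P (pt (m : M) (pure_word n (vs h)))) ->
  (forall x y, P x -> P y -> P (x + y)) -> forall x, P x.
Proof.
move=> P0 Pm PD.
have red (m : M) (c : tpow B n) : (forall i, P (pt (gpr i m) c)) -> P (pt m c).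
  move=> Pi; rewrite [m]gsuppE /pt tpure_suml.
  elim: (gsupp m) => [|i s IH]; first by rewrite big_nil.
  by rewrite big_cons; apply: (PD) => //; exact: Pi.
apply: tens_ind => // m b x Px; apply: (PD) => //.
case: n P P0 Pm PD red b x Px => [|n] P P0 Pm PD red b x Px.
  have e (y : M) : pt y b = pt (rmul y (b : S)) (1 : breg S) :> gtens M (tpow B 0).
    by rewrite pt_bal; congr tpure; rewrite /= /reg_lmul (@mulr1 S).
  apply: red => i; rewrite e.
  have hi : homog i (rmul (gpr i m) (b : S)) by rewrite /homog gpr_rmul gprK eqxx.
  exact: (Pm (Hel hi) [::]).
suff Q c : P (pt m c) by exact: Q.
move: c; apply: tpow_ind => [|h sh|y z Py Pz].
- by rewrite pt0r.
- by apply: red => i; apply: (Pm (Hel (homog_gpr i m))).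
- by rewrite ptDr; apply: (PD).
Qed.

Lemma mtpow_ext n (V : zmodType) (f g : gtens M (tpow B n) -> V) :
  {morph f : x y / x + y} -> {morph g : x y / x + y} ->
  (forall (m : hel M) h, size h = n ->
    f (pt (m : M) (pure_word n (vs h))) = g (pt (m : M) (pure_word n (vs h)))) -> f =1 g.
Proof.
move=> fD gD fg; have f0 : f 0 = 0 by apply: (addrI (f 0)); rewrite -fD !addr0.
have g0 : g 0 = 0 by apply: (addrI (g 0)); rewrite -gD !addr0.
apply: mtpow_ind => [||x y ex ey]; [by rewrite f0 g0 | exact: fg |].
by rewrite fD gD ex ey.
Qed.

Definition bar_word w : bdsum (tpow B) := din (pure_word (size w) w).

Lemma bar_wordE n w : size w = n -> bar_word w = din (pure_word n w).
Proof. by move=> <-. Qed.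

Lemma bar_word_homog h : homog (wdeg h) (bar_word (vs h) : bdsum (tpow B)).
Proof.
apply: dsum_ext => n; rewrite [LHS]dprE /= /fcast; case: eqP => [e|_].
  by case: _ / e; exact: pure_word_homog.
exact: gpr0.
Qed.

Lemma mbar_ind (P : gtens M (bdsum (tpow B)) -> Prop) :
  P 0 -> (forall (m : hel M) h, P (pt (m : M) (bar_word (vs h)))) ->
  (forall x y, P x -> P y -> P (x + y)) -> forall x, P x.
Proof.
move=> P0 Pm PD; apply: tens_ind => // m b x Px; apply: (PD) => //.
suff Q c : P (pt m c) by exact: Q.
move: c; apply: bdsum_ind => [|n y c Pc]; first by rewrite pt0r.
rewrite ptDr; apply: (PD) => //.
have idL := @linear_id k S M; have dB := din_bml (tpow B) n.
have tL := tmap_linear idL dB.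
have Q z : P (tmap (fun m : M => m) (@din _ _ (tpow B) n) z).
  move: z; apply: mtpow_ind => [|m' h sh|z z' Pz Pz'].
  - by rewrite (lin0 tL).
  - by rewrite tmapEl // -bar_wordE ?size_vs.
  - by rewrite (linD tL); apply: (PD).
by have := Q (pt m y); rewrite tmapEl.
Qed.

Lemma mbar_ext (V : zmodType) (f g : gtens M (bdsum (tpow B)) -> V) :
  {morph f : x y / x + y} -> {morph g : x y / x + y} ->
  (forall (m : hel M) h, f (pt (m : M) (bar_word (vs h))) = g (pt (m : M) (bar_word (vs h)))) ->
  f =1 g.
Proof.
move=> fD gD fg; have f0 : f 0 = 0 by apply: (addrI (f 0)); rewrite -fD !addr0.
have g0 : g 0 = 0 by apply: (addrI (g 0)); rewrite -gD !addr0.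
apply: mbar_ind => [||x y ex ey]; [by rewrite f0 g0 | exact: fg |].
by rewrite fD gD ex ey.
Qed.

(** Preservation of homogeneous elements cannot be checked additively as it stands. Commutation with
    the projections, up to the shift by [d], is an equality of additive maps and can be checked on
    words. *)
Lemma mbar_rmor d (N : gmod S) (f : gtens M (bdsum (tpow B)) -> N) :
  linear f ->
  (forall (m : hel M) h, homog (hdeg m + wdeg h + d) (f (pt (m : M) (bar_word (vs h))))) ->
  rmor d f.
Proof.
move=> fL fh; split=> // i x hx.
suff e y : gpr (i + d) (f y) = f (gpr i y) by rewrite /homog e hx.
apply: (mbar_ext (f := fun y => gpr (i + d) (f y)) (g := fun y => f (gpr i y))) y
  => [x1 y|x1 y|m h].
- by rewrite (linD fL) gprD.
- by rewrite gprD (linD fL).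
have hm := hvalP m; rewrite [gpr i _](mt_pr_homog _ hm (bar_word_homog h)) -(fh m h) gprK.
rewrite (inj_eq (addIr d)); case: eqP => _; [exact: fh | exact: esym (lin0 fL)].
Qed.

Lemma mtpow_rmor d n (N : gmod S) (f : gtens M (tpow B n) -> N) :
  linear f ->
  (forall (m : hel M) h, size h = n ->
    homog (hdeg m + wdeg h + d) (f (pt (m : M) (pure_word n (vs h))))) ->
  rmor d f.
Proof.
move=> fL fh; split=> // i x hx.
suff e y : gpr (i + d) (f y) = f (gpr i y) by rewrite /homog e hx.
apply: (mtpow_ext (f := fun y => gpr (i + d) (f y)) (g := fun y => f (gpr i y))) y
  => [x1 y|x1 y|m h sh].
- by rewrite (linD fL) gprD.
- by rewrite gprD (linD fL).
have hm := hvalP m; rewrite [gpr i _](mt_pr_homog _ hm (pure_word_homog n h)) -(fh m h sh) gprK.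
rewrite (inj_eq (addIr d)); case: eqP => _; [exact: fh | exact: esym (lin0 fL)].
Qed.
End Module.
End Pure.
End Words.

(** * The operations on A[1] *)

Lemma deconc_exchange (T T' : Type) (V : zmodType) (u : seq T) (v : seq T')
    (Phi : seq T -> seq T -> seq T' -> seq T' -> V) :
  deconc u (fun a b => deconc v (Phi a b)) =
  deconc v (fun c d => deconc u (fun a b => Phi a b c d)).
Proof. exact: exchange_big. Qed.

Lemma inv_map_can (V W : zmodType) (f : V -> W) (g : W -> V) :
  cancel f g -> cancel g f -> inv_map f =1 g.
Proof.
move=> fK gK y; rewrite /inv_map; case: xgetP => [x _ /= <-|]; first by rewrite fK.
by move=> /(_ (g y)) /=; rewrite gK.
Qed.

Ltac odd_tac :=
  rewrite ?(odd_absD, odd_absM, abszN, absz_nat, oddD, oddM, oddS) /=;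
  repeat (case: (odd _) => //=).

Section OverA.
Variables (k : fieldType) (S : falgType k) (A : ainf_alg S).
Notation B := (bshift A).
Notation bar := (bar A).
Notation pwA := (@pure_word k S A).
Notation pwB := (@pure_word k S B).
Implicit Types (M N P : gmod S) (h : seq (hel B)).

Lemma ainf_op_linear n : (0 < n)%N -> linear (@ainf_op k S A n).
Proof. by move=> /(@ainf_op_mor k S A) [[]]. Qed.
Lemma ainf_op_bml n : (0 < n)%N -> bml (@ainf_op k S A n).
Proof. by move=> /(@ainf_op_mor k S A) [[fL _] fS]. Qed.

Definition unsigma (M : gmod S) (x : gshift M) : M := x.

Lemma sigpow_bml n : bml (@sigpow k S A n).
Proof. by elim: n => [|n IH] /=; [exact: bml_id | exact: ktens_bml]. Qed.

(** An explicit inverse of [sigpow]. The Koszul sign is an involution, so applying it again, with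
    the degrees read in A rather than A[1], removes it. *)
Fixpoint sigpowV (n : nat) : tpow B n -> tpow A n :=
  match n with
  | 0 => fun x => x
  | n'.+1 => tmap (fun m : B => koszul (- n'%:Z) (unsigma m)) (@sigpowV n')
  end.

Lemma koszul_unsigma_linear M d : linear (fun m : gshift M => koszul d (unsigma m)).
Proof. exact: (@koszul_linear k S M d). Qed.
Lemma koszul_unsigma_bml d : @bml k S B A (fun m : B => koszul d (unsigma m)).
Proof. exact: (@koszul_bml k S A d). Qed.

Lemma sigpowV_bml n : bml (@sigpowV n).
Proof.
elim: n => [|n IH] /=; first exact: bml_id.
by apply: tmap_bml => //; exact: koszul_unsigma_bml.
Qed.

Section TensorInverse.
Variables (M : gmod S) (n : nat) (C C' : gbimod S) (f : C -> C') (g : C' -> C) (d : int).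
Hypotheses (fB : bml f) (gB : bml g) (fK : cancel f g) (gK : cancel g f).
Let sM := @sigma k S M.
Let rM := fun m : gshift M => koszul d (unsigma m).

Lemma ktens_sigmaK : cancel (ktens d sM f) (tmap rM g).
Proof.
have rL := @koszul_unsigma_linear M d.
have tL := tmap_linear rL gB; have kL : linear (ktens d sM f).
  by apply: ktens_linear.
apply: linear_gtens_ext => [||m b]; first exact: linear_comp.
  exact: linear_id.
by rewrite /ktens !tmapEl // ?fK /rM /sM /unsigma /sigma ?koszulK //; exact: koszul_linear.
Qed.

Lemma ktens_sigmaVK : cancel (tmap rM g) (ktens d sM f).
Proof.
have rL := @koszul_unsigma_linear M d.
have tL := tmap_linear rL gB; have kL : linear (ktens d sM f).
  by apply: ktens_linear.
apply: linear_gtens_ext => [||m b]; first exact: linear_comp.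
  exact: linear_id.
by rewrite /ktens !tmapEl // ?gK /rM /sM /unsigma /sigma ?koszulK //; exact: koszul_linear.
Qed.
End TensorInverse.

Lemma sigpowK n : cancel (@sigpow k S A n) (@sigpowV n).
Proof.
elim: n => [//|n IH]; apply: (ktens_sigmaK (M := A)) => //.
  exact: sigpow_bml.
exact: sigpowV_bml.
Qed.
Lemma sigpowVK n : cancel (@sigpowV n) (@sigpow k S A n).
Proof.
elim: n => [//|n IH]; apply: (ktens_sigmaVK (M := A)) => //.
  exact: sigpow_bml.
exact: sigpowV_bml.
Qed.

Lemma inv_sigpow n : inv_map (@sigpow k S A n) =1 @sigpowV n.
Proof. by apply: inv_map_can; [exact: sigpowK | exact: sigpowVK]. Qed.

Lemma hat_op_bml n : (0 < n)%N -> bml (@hat_op k S A n).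
Proof.
move=> n0; have e : @hat_op k S A n = fun y => sigma (ainf_op (sigpowV y)).
  by apply/funext => y; rewrite /hat_op inv_sigpow.
rewrite e; apply: (bml_comp (g := @sigma k S A)) => //.
apply: bml_comp; [exact: ainf_op_bml | exact: sigpowV_bml].
Qed.

Definition unsh M (x : hel (gshift M)) : hel M :=
  @Hel k S M (hdeg x + 1) (hval x) (hvalP x).

Definition ush h : seq (hel A) := [seq unsh x | x <- h].

(* Exponent of the sign produced by sigma^{(x) n} on a word; the degrees in A
   are one more than those in A[1]. *)
Fixpoint esg h : int :=
  if h is x :: h' then (size h')%:Z * (hdeg x + 1) + esg h' else 0.

Lemma esg_cons x h : esg (x :: h) = (size h)%:Z * (hdeg x + 1) + esg h.
Proof. by []. Qed.
Lemma vs_ush h : vs (ush h) = vs h :> seq A.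
Proof. by rewrite /vs -map_comp. Qed.
Lemma wdeg_ush h : wdeg (ush h) = wdeg h + (size h)%:Z.
Proof.
elim: h => [|x h IH]; first by rewrite !wdeg_nil.
rewrite [ush _]/= !wdeg_cons IH /=; lia.
Qed.
Lemma size_ush h : size (ush h) = size h. Proof. exact: size_map. Qed.

(** The middle term comes from moving the suspensions of the second word past the first word, whose
    degree in A is wdeg h + size h. *)
Lemma esg_cat h h' :
  esg (h ++ h') = esg h + (size h')%:Z * (wdeg h + (size h)%:Z) + esg h'.
Proof.
elim: h => [|x h IH] /=; first by rewrite wdeg_nil /= addr0 mulr0 !add0r.
rewrite IH wdeg_cons size_cat PoszD -[(size h).+1]addn1 PoszD; ring.
Qed.

Lemma sigpowV_pure_word n h : size h = n ->
  sigpowV (pwB n (vs h)) = ksign (esg h) (pwA n (vs h)).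
Proof.
move=> <-; elim: h => [//|x h IH] /=.
rewrite tmapEl; [|exact: koszul_unsigma_linear|exact: sigpowV_bml].
rewrite (koszulE _ (hvalP (unsh x))) IH pt_ksignl pt_ksignr -ksign_add.
by rewrite [esg _]/=; apply: ksign_odd; rewrite !odd_absD !odd_absM abszN.
Qed.

Lemma pure_word_slot0 (C : gbimod S) n (a c : seq C) : @pure_word k S C n (a ++ 0 :: c) = 0.
Proof.
have := pure_word_slotD n a c 0 0; rewrite addr0 => h.
by apply: (addrI (@pure_word k S C n (a ++ 0 :: c))); rewrite -h addr0.
Qed.

Lemma pure_word_slot_ksign (C : gbimod S) n (a c : seq C) d x :
  @pure_word k S C n (a ++ ksign d x :: c) = ksign d (@pure_word k S C n (a ++ x :: c)).
Proof.
apply: (morph_ksign d x (f := fun x => @pure_word k S C n (a ++ x :: c))) => y z.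
exact: pure_word_slotD.
Qed.

(* The value 0 on the empty word lets the sums below range over all
   factorizations, with windows of any length. *)
Definition op_val h : B := if h is [::] then 0 else hat_op (pwB (size h) (vs h)).

(** In A a word of length n has degree wdeg h + n and m_n has degree 2 - n, so the value has degree
    wdeg h + 2 there and wdeg h + 1 in A[1], whatever n is. *)
Lemma op_valP h : homog (wdeg h + 1) (op_val h).
Proof.
case: h => [|x h]; first exact: hel0P.
set h' := x :: h; rewrite /op_val -/h'.
have [[_ hd] _] := @ainf_op_mor k S A (size h') isT.
have := hd _ _ (pure_word_homog (size h') (ush h')).
rewrite wdeg_ush vs_ush /hat_op inv_sigpow sigpowV_pure_word // => hh.
rewrite (lin_ksign (ainf_op_linear _)) //.
have : homog (wdeg h' + 1 + 1) (ainf_op (pwA (size h') (vs h'))).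
  by move: hh; congr homog; lia.
exact: (@homog_ksign k S A).
Qed.
Definition op h : hel B := Hel (op_valP h).

Lemma hdeg_op h : hdeg (op h) = wdeg h + 1. Proof. by []. Qed.
Lemma op_nil : op [::] = 0 :> B. Proof. by []. Qed.
Lemma opE h : h <> [::] ->
  op h = ksign (esg h) (ainf_op (pwA (size h) (vs h))) :> A.
Proof.
case: h => [//|x h] _; rewrite /= /hat_op inv_sigpow.
by rewrite (@sigpowV_pure_word _ (x :: h)) // (lin_ksign (ainf_op_linear _)).
Qed.

Lemma op_hat h : h <> [::] -> op h = hat_op (pwB (size h) (vs h)) :> B.
Proof. by case: h. Qed.

Lemma op_slot0 a c : op (a ++ op [::] :: c) = 0 :> B.
Proof.
rewrite op_hat; last by case: a.
rewrite vs_cat vs_cons op_nil pure_word_slot0 (lin0 (proj1 (hat_op_bml _))) //.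
by rewrite size_cat addnS.
Qed.

(* The A_infinity relations, in terms of the operations on A[1] *)
Lemma op_rel h :
  deconc h (fun a bc => deconc bc (fun b c =>
    ksign (wdeg a) (op (a ++ op b :: c) : B))) = 0.
Proof.
case: (posnP (size h)) => [/size0nil ->|h0].
  by rewrite !deconc_nil (@op_slot0 [::] [::]) ksign_0r.
have := ainf_rel h0 (pwA (size h) (vs h)).
(* Suspending the whole word contributes the sign [esg h] to every summand, so it factors out and
   leaves the sign [wdeg a]. *)
pose Phi a b c := ksign (esg h) (ksign (wdeg a) (op (a ++ op b :: c) : A)) : A.
rewrite (@sum3_deconc _ _ _ h _ Phi) //.
- rewrite /Phi => e; rewrite -[LHS](ksignK (esg h)) -[X in ksign _ X]deconc_ksign.
  have -> : deconc h (fun a bc => ksign (esg h) (deconc bc (fun b c =>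
      ksign (wdeg a) (op (a ++ op b :: c) : B)))) = 0.
    by rewrite -[RHS]e; apply: eq_deconc => a bc _; rewrite -deconc_ksign.
  by rewrite ksign_0r.
- by move=> a c _; rewrite /Phi (op_slot0 a c) !ksign_0r.
move=> a b c e b0; rewrite /Phi.
have bn : b <> [::] by move=> bn; rewrite bn in b0.
have sh : size h = (size a + (size b + size c))%N by rewrite e !size_cat.
have -> : vs h = vs (ush a) ++ vs (ush b) ++ vs (ush c) :> seq A.
  by rewrite e !vs_cat !vs_ush.
rewrite insert_pure_word ?size_ush //; last exact: ainf_op_bml.
rewrite take_size_cat ?size_vs ?size_ush // drop_size_cat ?size_vs ?size_ush //.
rewrite (opE (h := a ++ op b :: c)); last by case: (a).
rewrite (lin_ksign (ainf_op_linear _)) ?addnS //.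
rewrite -!ksign_add !vs_ush vs_cat vs_cons (opE bn).
rewrite pure_word_slot_ksign size_cat [size (_ :: _)]/= addnS.
rewrite (lin_ksign (ainf_op_linear _)) // -ksign_add; apply: ksign_odd.
rewrite e !esg_cat esg_cons hdeg_op wdeg_ush !size_cat.
odd_tac.
Qed.
End OverA.

(** * The bar construction on words *)

Section BarOperations.
Variables (k : fieldType) (S : falgType k) (A : ainf_alg S).
Notation B := (bshift A).
Notation bar := (bar A).
Notation pwA := (@pure_word k S A).
Notation pwB := (@pure_word k S B).
Implicit Types (M N P : gmod S) (h : seq (hel B)).

Notation bar_word := (@bar_word k S B).

Lemma bml_sum2 (C D : gbimod S) n (G : nat -> nat -> C -> D) :
  (forall r s, (r + s)%N = n -> bml (G r s)) ->
  bml (fun x => sum2 n (fun r s => G r s x)).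
Proof.
by move=> hG; apply: bml_sum => r _; apply: bml_sum => s /eqP; exact: hG.
Qed.
Lemma bml_sum3 (C D : gbimod S) n (G : nat -> nat -> nat -> C -> D) :
  (forall r s t, (0 < s)%N -> (r + s + t)%N = n -> bml (G r s t)) ->
  bml (fun x => sum3 n (fun r s t => G r s t x)).
Proof.
move=> hG; apply: bml_sum => r _; apply: bml_sum => s s0.
by apply: bml_sum => t /eqP; exact: hG.
Qed.

Lemma bar_mu_term_bml n p q : @bml k S (tpow B n) (btens bar bar)
  (fun x => tmap (@din k S (tpow B) p) (@din k S (tpow B) q)
      (tsplit p q (@fcast k S (tpow B) n (p + q) x))).
Proof.
apply: (bml_comp (B := btens (tpow B p) (tpow B q))).
  by apply: tmap_bml; exact: din_bml.
by apply: bml_comp; [exact: tsplit_bml | exact: fcast_bml].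
Qed.

Lemma bar_mu_bml : @bml k S bar (btens bar bar) (@bar_mu k S A).
Proof.
by apply: dlift_bml => n; apply: bml_sum2 => p q _; exact: bar_mu_term_bml.
Qed.

Lemma bar_word_slotD (a c : seq B) x y :
  bar_word (a ++ (x + y) :: c) = bar_word (a ++ x :: c) + bar_word (a ++ y :: c).
Proof.
have e z : bar_word (a ++ z :: c) = din (pwB (size a + (size c).+1) (a ++ z :: c)).
  by apply: bar_wordE; rewrite size_cat.
by rewrite !e pure_word_slotD (linD (proj1 (din_bml _ _))).
Qed.

Lemma bar_word_slot0 (a c : seq B) : bar_word (a ++ 0 :: c) = 0.
Proof.
have := bar_word_slotD a c 0 0; rewrite addr0 => e.
by apply: (addrI (bar_word (a ++ 0 :: c))); rewrite -e addr0.
Qed.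

Lemma bar_muE (w : seq B) : bar_mu (bar_word w : bar) =
  deconc w (fun a b => pt (bar_word a : bar) (bar_word b : bar) : gtens bar bar).
Proof.
rewrite /bar_mu (dliftEd (V := btens bar bar)); last first.
  move=> n; apply: linD.
  by case: (@bml_sum2 (tpow B n) (btens bar bar) n _
    (fun p q _ => bar_mu_term_bml n p q)).
apply: sum2_deconc => // a b e; rewrite fcast_pure_word ?e ?size_cat // tsplit_pure_word.
rewrite take_size_cat // drop_size_cat // tmapEl //; last exact: din_bml.
by case: (din_bml (tpow B) (size a)).
Qed.

Lemma bar_delta_term_bml n r s t : (0 < s)%N -> @bml k S (tpow B n) bar
  (fun x => @din k S (tpow B) _ (@insert k S B r s t 1 (@hat_op k S A s) n x)).
Proof.
move=> s0; apply: (bml_comp (B := tpow B (r + t.+1))); first exact: din_bml.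
by apply: insert_bml; exact: hat_op_bml.
Qed.

Lemma bar_delta_bml : @bml k S bar bar (@bar_delta k S A).
Proof.
apply: dlift_bml => n; apply: bml_sum3 => r s t s0 _.
exact: bar_delta_term_bml.
Qed.

Lemma bar_deltaE h : bar_delta (bar_word (vs h) : bar) =
  deconc h (fun a bc => deconc bc (fun b c =>
    ksign (wdeg a) (bar_word (vs a ++ (op b : B) :: vs c) : bar))).
Proof.
rewrite (bar_wordE (size_vs h)) /bar_delta (dliftEd (V := bar)); last first.
  move=> n; apply: linD.
  by case: (@bml_sum3 (tpow B n) bar n _
    (fun r s t s0 _ => @bar_delta_term_bml n r s t s0)).
apply: sum3_deconc => //.
  by move=> a c _; rewrite op_nil bar_word_slot0 ksign_0r.
move=> a b c e b0; have bn : b <> [::] by move=> bn; rewrite bn in b0.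
have -> : vs h = vs a ++ vs b ++ vs c by rewrite e !vs_cat.
rewrite insert_pure_word //; [|exact: hat_op_bml|by rewrite e !size_cat].
rewrite take_size_cat ?size_vs // drop_size_cat ?size_vs // mul1r.
rewrite (lin_ksign (proj1 (din_bml _ _))) -op_hat //; congr ksign.
by rewrite -bar_wordE // size_cat; congr (_ + _)%N; rewrite ?[size (_ :: _)]/=; [|congr _.+1]; exact: size_map.
Qed.

Lemma bar_eps_bml : @bml k S bar (breg S) (@bar_eps k S A).
Proof. by []. Qed.

Lemma bar_epsE (w : seq B) :
  bar_eps (bar_word w : bar) = if w is [::] then 1 else 0.
Proof.
rewrite /bar_eps /bar_word /=; case: w => [|x w] /=; first by rewrite fcast_id.
by rewrite fcast_neq.
Qed.

Lemma bar_comp_linear M N P (g : bar_arr A N P) (f : bar_arr A M N) :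
  linear g -> linear f -> linear (bar_comp g f).
Proof.
move=> gL fL; apply: (linear_comp gL).
apply: (linear_comp (V := gtens (gtens M bar) bar)); first exact: tmap_linear.
apply: (linear_comp (V := gtens M (btens bar bar))); first exact: tassoc_linear.
by apply: tmap_linear => //; exact: bar_mu_bml.
Qed.

Lemma bar_compE M N P (g : bar_arr A N P) (f : bar_arr A M N) m (w : seq B) :
  linear g -> linear f ->
  bar_comp g f (pt m (bar_word w : bar)) =
  deconc w (fun a b => g (pt (f (pt m (bar_word a : bar))) (bar_word b : bar))).
Proof.
move=> gL fL; rewrite /bar_comp tmapEl //; last exact: bar_mu_bml.
rewrite bar_muE (morph_deconc (f := fun z : btens bar bar =>
  g (tmap f (fun c => c) (tassoc (pt m z))))); last first.
  move=> x y; rewrite ptDr (linD (@tassoc_linear _ _ _ _ _)).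
  by rewrite (linD (tmap_linear fL (@bml_id _ _ _))) (linD gL).
by apply: eq_deconc => a b _; rewrite tassocE tmapEl.
Qed.

(** The differential without the sign (-1)^{d+1}, so that no degree has to be supplied; [bar_diff 1]
    is equal to it and [bar_diff 0] is its opposite. *)
Definition bar_dd M N (f : bar_arr A M N) : bar_arr A M N :=
  fun x => f (ktens 1 (fun m => m) (@bar_delta k S A) x).

Lemma bar_dd_linear M N (f : bar_arr A M N) : linear f -> linear (bar_dd f).
Proof.
move=> fL; apply: (linear_comp fL).
by apply: ktens_linear => //; exact: bar_delta_bml.
Qed.

Lemma bar_ddE M N (f : bar_arr A M N) (m : hel M) h : linear f ->
  bar_dd f (pt (m : M) (bar_word (vs h) : bar)) =
  deconc h (fun a bc => deconc bc (fun b c => ksign (hdeg m + wdeg a)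
    (f (pt (m : M) (bar_word (vs a ++ (op b : B) :: vs c) : bar))))).
Proof.
move=> fL; rewrite /bar_dd (ktensEl _ _ _ _ (hvalP m)) //; last exact: bar_delta_bml.
rewrite mul1r (lin_ksign fL) bar_deltaE.
have D : {morph (fun z : bar => f (pt (m : M) z)) : x y / x + y}.
  by move=> x y; rewrite ptDr (linD fL).
rewrite (morph_deconc _ _ D) -deconc_ksign; apply: eq_deconc => a bc _.
rewrite (morph_deconc _ _ D) -deconc_ksign; apply: eq_deconc => b c _.
by rewrite (morph_ksign _ _ D) -ksign_add.
Qed.

Lemma bar_ext M N (f g : bar_arr A M N) : linear f -> linear g ->
  (forall (m : hel M) h, f (pt (m : M) (bar_word (vs h) : bar)) =
                         g (pt (m : M) (bar_word (vs h) : bar))) -> f = g.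
Proof.
by move=> fL gL fg; apply/funext; apply: mbar_ext => //; exact: linD.
Qed.

(** On words this is the coassociativity of deconcatenation. *)
Lemma bar_compA M N P Q (f3 : bar_arr A P Q) (f2 : bar_arr A N P)
    (f1 : bar_arr A M N) : linear f3 -> linear f2 -> linear f1 ->
  bar_comp f3 (bar_comp f2 f1) = bar_comp (bar_comp f3 f2) f1.
Proof.
move=> L3 L2 L1; have L21 := bar_comp_linear L2 L1.
have L32 := bar_comp_linear L3 L2.
apply: bar_ext => [||m h]; try exact: bar_comp_linear.
rewrite !bar_compE // (eq_deconc (Psi := fun ab c => deconc ab (fun a b =>
  f3 (pt (f2 (pt (f1 (pt (m : M) (bar_word a : bar))) (bar_word b : bar))) (bar_word c : bar))))).
  by rewrite -deconc_coassoc; apply: eq_deconc => a bc _; rewrite bar_compE.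
move=> ab c _; rewrite bar_compE //.
by apply: (morph_deconc (f := fun x => f3 (pt x (bar_word c : bar)))) => x y; rewrite ptDl (linD L3).
Qed.

Lemma bar_id_bal M : balanced (@rmul k S M) (@lmul k S bar)
  (fun m c => rmul m (bar_eps c)).
Proof.
split.
- by move=> m m' c; rewrite rmulDl.
- by move=> m c c'; rewrite (linD (proj1 bar_eps_bml)) rmulDr.
- by move=> m s c; rewrite rmulA (proj2 bar_eps_bml).
Qed.

Lemma bar_id_linear M : linear (@bar_id k S A M).
Proof.
apply: (tlift_linear (bar_id_bal M)) => m s c.
by rewrite /rmul scalerA.
Qed.

Lemma bar_idE M (m : M) (w : seq B) :
  bar_id (pt m (bar_word w : bar)) = if w is [::] then m else 0.
Proof.
rewrite /bar_id (tliftE (bar_id_bal M)) bar_epsE.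
by case: w => [|_ _]; [exact: rmul1 | rewrite /rmul scale0r].
Qed.
End BarOperations.

Lemma deconc_last (T : Type) (V : zmodType) (w : seq T) (Phi : seq T -> V) :
  deconc w (fun a b => if b is [::] then Phi a else 0) = Phi w.
Proof.
elim: w Phi => [|x w IH] Phi; first by rewrite deconc_nil.
by rewrite deconc_cons IH add0r.
Qed.

Lemma deconc_first (T : Type) (V : zmodType) (w : seq T) (Phi : seq T -> V) :
  deconc w (fun a b => if a is [::] then Phi b else 0) = Phi w.
Proof.
case: w => [|x w]; first by rewrite deconc_nil.
by rewrite deconc_cons deconc0 ?addr0.
Qed.

(** * Bar arrows form a differential graded category *)

Section BarDG.
Variables (k : fieldType) (S : falgType k) (A : ainf_alg S).
Notation B := (bshift A).
Notation bar := (bar A).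
Notation bar_word := (@bar_word k S B).
Implicit Types (M N P : gmod S) (h : seq (hel B)).

Lemma bar_addE M N (f g : bar_arr A M N) x : (f + g) x = f x + g x.
Proof. by []. Qed.
Lemma bar_oppE M N (f : bar_arr A M N) x : (- f) x = - f x.
Proof. by []. Qed.
Lemma bar_zeroE M N x : (0 : bar_arr A M N) x = 0.
Proof. by []. Qed.

Lemma bar_comp1l M N (f : bar_arr A M N) :
  linear f -> bar_comp (@bar_id k S A N) f = f.
Proof.
move=> fL; have iL := @bar_id_linear k S A N.
apply: bar_ext => // [|m h]; first exact: bar_comp_linear.
rewrite bar_compE // -[RHS](deconc_last (vs h) (fun a => f (pt (m : M) (bar_word a : bar)))).
by apply: eq_deconc => a b _; rewrite bar_idE.
Qed.

Lemma bar_comp1r M N (f : bar_arr A M N) :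
  linear f -> bar_comp f (@bar_id k S A M) = f.
Proof.
move=> fL; have iL := @bar_id_linear k S A M.
apply: bar_ext => // [|m h]; first exact: bar_comp_linear.
rewrite bar_compE // -[RHS](deconc_first (vs h) (fun a => f (pt (m : M) (bar_word a : bar)))).
apply: eq_deconc => -[|x a] b _; rewrite bar_idE //.
by rewrite pt0l (lin0 fL).
Qed.

Lemma bar_compDl M N P (g g' : bar_arr A N P) (f : bar_arr A M N) :
  bar_comp (g + g') f = bar_comp g f + bar_comp g' f.
Proof. by []. Qed.

Lemma bar_compDr M N P (g : bar_arr A N P) (f f' : bar_arr A M N) :
  linear g -> linear f -> linear f' ->
  bar_comp g (f + f') = bar_comp g f + bar_comp g f'.
Proof.
move=> gL fL f'L; have ffL : linear (f + f' : bar_arr A M N) by exact: linear_add.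
apply: bar_ext => [||m h]; [exact: bar_comp_linear | |].
  by apply: linear_add; exact: bar_comp_linear.
rewrite [RHS]bar_addE !bar_compE // -deconc_add; apply: eq_deconc => a b _.
by rewrite -(linD gL) -ptDl.
Qed.

Lemma rmor_word d M N (f : bar_arr A M N) (m : hel M) h : rmor d f ->
  homog (hdeg m + wdeg h + d) (f (pt (m : M) (bar_word (vs h) : bar))).
Proof.
by move=> [_ fh]; apply: fh; apply: homog_pt; [exact: hvalP | exact: bar_word_homog].
Qed.

(** Keeps the value on a word as a homogeneous element with its degree, so that the formulas on
    words apply to it in turn. *)
Definition hel_app d M N (f : bar_arr A M N) (fd : rmor d f) (m : hel M) h :
  hel N := Hel (rmor_word m h fd).

Lemma rmor_comp d e M N P (g : bar_arr A N P) (f : bar_arr A M N) :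
  rmor d g -> rmor e f -> rmor (d + e) (bar_comp g f).
Proof.
move=> gd fd; have [gL _] := gd; have [fL _] := fd.
apply: mbar_rmor => [|m h]; first exact: bar_comp_linear.
rewrite bar_compE // deconc_vs; apply: homog_deconc => a b ->.
have := rmor_word (hel_app fd m a) b gd; rewrite /= wdeg_cat; congr homog.
by ring.
Qed.

Lemma rmor_id M : rmor 0 (@bar_id k S A M).
Proof.
apply: mbar_rmor => [|m h]; first exact: bar_id_linear.
rewrite bar_idE; case: h => [|x h] /=; last exact: hel0P.
by rewrite wdeg_nil !addr0; exact: hvalP.
Qed.

Lemma rmorB d M N (f g : bar_arr A M N) : rmor d f -> rmor d g -> rmor d (f - g).
Proof.
move=> [fL fh] [gL gh]; split.
  by apply: linear_add => //; exact: linear_opp.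
move=> i x hx; rewrite /homog bar_addE bar_oppE gprD.
have gN (y : N) : gpr (i + d) (- y) = - gpr (i + d) y.
  by rewrite -[- y]scaleN1r gprZ scaleN1r.
by rewrite gN fh // gh.
Qed.

Lemma rmor0 d M N : rmor d (0 : bar_arr A M N).
Proof. by split=> [|i x _]; [exact: linear_zero | exact: hel0P]. Qed.

Lemma rmor_dd M N (f : bar_arr A M N) d : rmor d f -> rmor (d + 1) (bar_dd f).
Proof.
move=> fd; have [fL _] := fd.
apply: mbar_rmor => [|m h]; first exact: bar_dd_linear.
rewrite bar_ddE //; apply: homog_deconc => a bc e; apply: homog_deconc => b c e'.
apply: homog_ksign; have := rmor_word m (a ++ op b :: c) fd.
rewrite vs_cat; congr homog.
by rewrite e e' !wdeg_cat wdeg_cons hdeg_op; ring.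
Qed.

Lemma bar_ddD M N (f g : bar_arr A M N) : bar_dd (f + g) = bar_dd f + bar_dd g.
Proof. by []. Qed.

(** The letter produced by delta is consumed either by [f] or by [g]. In the second case [bar_dd g]
    counts the sign from f(m (x) p), of degree |m| + |p| + d, where the left side counts it from |m|
    + |p|; this accounts for (-1)^d. *)
Lemma bar_ddM d M N P (g : bar_arr A N P) (f : bar_arr A M N) :
  linear g -> rmor d f ->
  bar_dd (bar_comp g f) = fun x => bar_comp g (bar_dd f) x +
    ksign d (bar_comp (bar_dd g) f x).
Proof.
move=> gL fd; have [fL _] := fd; have gfL := bar_comp_linear gL fL.
have dfL := bar_dd_linear fL; have dgL := bar_dd_linear gL.
apply: bar_ext => [||m h]; first exact: bar_dd_linear.
  by apply: linear_add; [|apply: linear_ksign]; exact: bar_comp_linear.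
rewrite bar_ddE // !bar_compE //.
pose F a w := g (pt (f (pt (m : M) (bar_word a : bar))) (bar_word w : bar)).
have FD w : {morph (fun y : bar => g (pt (f (pt (m : M) y)) (bar_word w : bar))) : x y / x + y}.
  by move=> x y; rewrite ptDr (linD fL) ptDl (linD gL).
have lhs a b c : bar_comp g f (pt (m : M) (bar_word (vs a ++ (op b : B) :: vs c) : bar)) =
    deconc a (fun p q => F (vs p) (vs q ++ (op b : B) :: vs c)) +
    deconc c (fun p q => F (vs a ++ (op b : B) :: vs p) (vs q)).
  by rewrite bar_compE // deconc_cat_cons !deconc_vs.
transitivity (
  deconc h (fun a bc => deconc bc (fun b c => ksign (hdeg m + wdeg a)
    (deconc c (fun p q => F (vs a ++ (op b : B) :: vs p) (vs q))))) +
  deconc h (fun a bc => deconc bc (fun b c => ksign (hdeg m + wdeg a)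
    (deconc a (fun p q => F (vs p) (vs q ++ (op b : B) :: vs c)))))).
  rewrite -deconc_add; apply: eq_deconc => a bc _; rewrite -deconc_add; apply: eq_deconc => b c _.
  by rewrite lhs ksignD addrC.
congr (_ + _).
  rewrite deconc_vs; transitivity (deconc h (fun ac q => deconc ac (fun a bp => deconc bp (fun b p =>
      ksign (hdeg m + wdeg a) (F (vs a ++ (op b : B) :: vs p) (vs q)))))).
    rewrite -(deconc_coassoc h (fun a bp q => deconc bp (fun b p =>
      ksign (hdeg m + wdeg a) (F (vs a ++ (op b : B) :: vs p) (vs q))))).
    apply: eq_deconc => a bc _; rewrite -deconc_coassoc; apply: eq_deconc => b c _.
    by rewrite -deconc_ksign.
  apply: eq_deconc => x q _; rewrite bar_ddE //.
  have D : {morph (fun y => g (pt y (bar_word (vs q) : bar))) : x y / x + y}.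
    by move=> y z; rewrite ptDl (linD gL).
  rewrite (morph_deconc _ _ D); apply: eq_deconc => a bp _.
  rewrite (morph_deconc _ _ D); apply: eq_deconc => b p _.
  by rewrite (morph_ksign _ _ D).
rewrite deconc_vs -deconc_ksign.
transitivity (deconc h (fun p y => deconc y (fun q bc => deconc bc (fun b c =>
    ksign (hdeg m + wdeg (p ++ q)) (F (vs p) (vs q ++ (op b : B) :: vs c)))))).
  rewrite [RHS]deconc_coassoc; apply: eq_deconc => a bc _.
  rewrite [RHS]deconc_exchange; apply: eq_deconc => b c _; rewrite -deconc_ksign.
  by apply: eq_deconc => p q ->.
apply: eq_deconc => p y _.
rewrite (bar_ddE (hel_app fd m p)) // -deconc_ksign; apply: eq_deconc => q bc _.
rewrite -deconc_ksign; apply: eq_deconc => b c _; rewrite -ksign_add wdeg_cat.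
by apply: ksign_odd; rewrite /=; lia.
Qed.

(** Two successive operations with nested windows cancel by the A_infinity relations; those with
    disjoint windows cancel in pairs, because the operations have degree 1. *)
Lemma bar_dd_dd M N (f : bar_arr A M N) : linear f -> bar_dd (bar_dd f) = 0.
Proof.
move=> fL; have dL := bar_dd_linear fL.
apply: bar_ext => [||m h]; [exact: bar_dd_linear | exact: linear_zero |].
rewrite [RHS]bar_zeroE bar_ddE //.
pose F (w : seq B) := f (pt (m : M) (bar_word w : bar)).
have FD (a c : seq B) : {morph (fun x => F (a ++ x :: c)) : x y / x + y}.
  by move=> x y; rewrite /F bar_word_slotD ptDr (linD fL).
pose G1 a b c a' b' c' := ksign (wdeg a + wdeg a') 
  (F (vs a ++ (op b : B) :: vs c ++ (op b' : B) :: vs c')).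
have inner a b c : bar_dd f (pt (m : M) (bar_word (vs a ++ (op b : B) :: vs c) : bar)) =
    deconc (a ++ op b :: c) (fun a' bc' => deconc bc' (fun b' c' =>
      ksign (hdeg m + wdeg a') (F (vs a' ++ (op b' : B) :: vs c')))).
  by rewrite -vs_cons -vs_cat bar_ddE.
(* The window of the second operation is to the left of the letter produced by
   the first one, contains it, or is to the right of it. *)
transitivity (
  deconc h (fun a bc => deconc bc (fun b c => deconc a (fun a' y => deconc y (fun b' c' =>
    ksign (wdeg a + wdeg a')
      (F (vs a' ++ (op b' : B) :: vs c' ++ (op b : B) :: vs c)))))) +
  deconc h (fun a bc => deconc bc (fun b c => deconc a (fun a' y => deconc c (fun p c' =>
    ksign (wdeg a + wdeg a')
      (F (vs a' ++ (op (y ++ op b :: p) : B) :: vs c')))))) -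
  deconc h (fun a bc => deconc bc (fun b c => deconc c (fun a' y => deconc y (fun b' c' =>
    ksign (wdeg b + wdeg a')
      (F (vs a ++ (op b : B) :: vs a' ++ (op b' : B) :: vs c'))))))).
  rewrite -deconc_opp -!deconc_add; apply: eq_deconc => a bc _.
  rewrite -deconc_opp -!deconc_add; apply: eq_deconc => b c _.
  rewrite inner deconc_cat_cons ksignD; congr (_ + _).
    rewrite -deconc_add -deconc_ksign; apply: eq_deconc => a' y _.
    rewrite deconc_cat_cons ksignD; congr (_ + _); rewrite -deconc_ksign;
      apply: eq_deconc => b' c' _; rewrite -ksign_add ?vs_cat ?vs_cons;
      by apply: ksign_odd; lia.
  rewrite -deconc_ksign -deconc_opp; apply: eq_deconc => a' y _.
  rewrite -deconc_ksign -deconc_opp; apply: eq_deconc => b' c' _.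
  rewrite -ksign_add -ksignS vs_cat vs_cons -catA; apply: ksign_odd.
  by rewrite wdeg_cat wdeg_cons hdeg_op; lia.
rewrite addrAC; apply/eqP; rewrite addr_eq0; apply/eqP.
transitivity (0 : N); last first.
  apply/esym/eqP; rewrite oppr_eq0; apply/eqP.
  (* The nested terms are regrouped by the outer window [Z]; the sum over the inner one is then
     [op_rel Z] inserted into a word. *)
  transitivity (deconc h (fun a' z => deconc z (fun Z c' => deconc Z (fun y bp => deconc bp (fun b p =>
    ksign (wdeg y) (F (vs a' ++ (op (y ++ op b :: p) : B) :: vs c'))))))); last first.
    apply: deconc0 => a' z _; apply: deconc0 => Z c' _.
    have := op_rel Z => /(congr1 (fun x => F (vs a' ++ x :: vs c'))).
    have F0 : F (vs a' ++ 0 :: vs c') = 0.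
      by rewrite /F bar_word_slot0 pt0r (lin0 fL).
    rewrite F0 (morph_deconc _ _ (FD _ _)) => <-; apply: eq_deconc => y bp _.
    rewrite (morph_deconc _ _ (FD _ _)); apply: eq_deconc => b p _.
    by rewrite (morph_ksign _ _ (FD _ _)).
  transitivity (deconc h (fun a bc => deconc a (fun a' y => deconc bc (fun b c => deconc c (fun p c' =>
      ksign (wdeg y) (F (vs a' ++ (op (y ++ op b :: p) : B) :: vs c'))))))).
    apply: eq_deconc => a bc _; rewrite deconc_exchange; apply: eq_deconc => a' y e.
    apply: eq_deconc => b c _; apply: eq_deconc => p c' _; apply: ksign_odd.
    by rewrite e wdeg_cat; lia.
  rewrite -deconc_coassoc; apply: eq_deconc => a' z _.
  rewrite -deconc_coassoc; apply: eq_deconc => y bc _.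
  by rewrite -deconc_coassoc.
apply/eqP; rewrite subr_eq0; apply/eqP.
transitivity (deconc h (fun a bc => deconc bc (fun b z => deconc z (fun c y => deconc y (fun b' c' =>
  ksign (wdeg b + wdeg c)
   (F (vs a ++ (op b : B) :: vs c ++ (op b' : B) :: vs c'))))))); last by [].
(* Both remaining sums run over the choices of two disjoint windows in [h]; coassociativity brings
   them to the same order, and the signs agree modulo 2. *)
transitivity (deconc h (fun a bc => deconc a (fun a' y => deconc y (fun b' c' => deconc bc (fun b c => 
    ksign (wdeg b' + wdeg c')
      (F (vs a' ++ (op b' : B) :: vs c' ++ (op b : B) :: vs c))))))).
  apply: eq_deconc => a bc _; rewrite deconc_exchange; apply: eq_deconc => a' y e.
  rewrite deconc_exchange; apply: eq_deconc => b' c' e'; apply: eq_deconc => b c _.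
  apply: ksign_odd; rewrite e e' !wdeg_cat; lia.
rewrite -(deconc_coassoc h (fun a' y bc => deconc y (fun b' c' => deconc bc (fun b c => 
    ksign (wdeg b' + wdeg c')
      (F (vs a' ++ (op b' : B) :: vs c' ++ (op b : B) :: vs c)))))).
apply: eq_deconc => a' z _; by rewrite -deconc_coassoc.
Qed.
End BarDG.

(** * Graded modules over a semisimple ring *)

Section GradedModules.
Variables (k : fieldType) (S : falgType k).
Implicit Types M N : gmod S.

Lemma rmor0P M N (f : M -> N) :
  rmor 0 f <-> linear f /\ forall i m, f (gpr i m) = gpr i (f m).
Proof.
split=> [[fL fh]|[fL fg]]; split=> // i m; last first.
  by move=> hm; rewrite /homog addr0 -fg hm.
rewrite {2}[m]gsuppE (lin_sum fL) gpr_big {1}[m]gsuppE gpr_big (lin_sum fL).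
apply: eq_bigr => j _; rewrite gprK.
have hj : gpr j (f (gpr j m)) = f (gpr j m) by have := fh j _ (homog_gpr j m); rewrite addr0.
by rewrite -[in RHS]hj gprK; case: eqP => [_|_]; [rewrite hj | rewrite (lin0 fL)].
Qed.

Section SplitIdempotent.
Variables (M : gmod S) (e : M -> M).
Hypotheses (e0 : rmor 0 e) (ee : forall m, e (e m) = e m).

Let eL : linear e. Proof. by case: e0. Qed.
Let eg i m : e (gpr i m) = gpr i (e m). Proof. by case/rmor0P: e0 => _ ->. Qed.

(** The image of the idempotent is encoded by its fixed points, so that membership is an
    equation. *)
Record fixpt := FixPt { fval : M; fvalP : e fval = fval }.
HB.instance Definition _ := gen_eqMixin fixpt.
HB.instance Definition _ := gen_choiceMixin fixpt.

Lemma fixpt_ext (x y : fixpt) : fval x = fval y -> x = y.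
Proof.
case: x y => [x hx] [y hy] /= xy; case: _ / xy hy => hy.
by congr FixPt; exact: Prop_irrelevance.
Qed.

Definition fix_proj (m : M) : fixpt := FixPt (ee m).
Lemma fix_addP (x y : fixpt) : e (fval x + fval y) = fval x + fval y.
Proof. by rewrite (linD eL) !fvalP. Qed.
Lemma fix_zeroP : e 0 = 0. Proof. exact: lin0. Qed.
Lemma fix_oppP (x : fixpt) : e (- fval x) = - fval x.
Proof. by rewrite (linN eL) fvalP. Qed.
Lemma fix_scaleP (s : S^c) (x : fixpt) : e (s *: fval x) = s *: fval x.
Proof. by rewrite (linZ eL) fvalP. Qed.
Lemma fix_gprP i (x : fixpt) : e (gpr i (fval x)) = gpr i (fval x).
Proof. by rewrite eg fvalP. Qed.

Definition fix_add x y := FixPt (fix_addP x y).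
Definition fix_zero := FixPt fix_zeroP.
Definition fix_opp x := FixPt (fix_oppP x).
Definition fix_scale s x := FixPt (fix_scaleP s x).
Definition fix_gpr i x := FixPt (fix_gprP i x).

Lemma fix_addA : associative fix_add.
Proof. by move=> x y z; apply: fixpt_ext; rewrite /= addrA. Qed.
Lemma fix_addC : commutative fix_add.
Proof. by move=> x y; apply: fixpt_ext; rewrite /= addrC. Qed.
Lemma fix_add0 : left_id fix_zero fix_add.
Proof. by move=> x; apply: fixpt_ext; rewrite /= add0r. Qed.
Lemma fix_addN : left_inverse fix_zero fix_opp fix_add.
Proof. by move=> x; apply: fixpt_ext; rewrite /= addNr. Qed.
HB.instance Definition _ :=
  GRing.isZmodule.Build fixpt fix_addA fix_addC fix_add0 fix_addN.

Lemma fix_scaleA s t x : fix_scale s (fix_scale t x) = fix_scale (s * t) x.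
Proof. by apply: fixpt_ext; rewrite /= scalerA. Qed.
Lemma fix_scale1 : left_id 1 fix_scale.
Proof. by move=> x; apply: fixpt_ext; rewrite /= scale1r. Qed.
Lemma fix_scaleDr : right_distributive fix_scale +%R.
Proof. by move=> s x y; apply: fixpt_ext; rewrite /= scalerDr. Qed.
Lemma fix_scaleDl x : {morph fix_scale^~ x : s t / s + t}.
Proof. by move=> s t; apply: fixpt_ext; rewrite /= scalerDl. Qed.
HB.instance Definition _ := GRing.Zmodule_isLmodule.Build S^c fixpt
  fix_scaleA fix_scale1 fix_scaleDr fix_scaleDl.

Lemma fix_gpr_linear i : linear (fix_gpr i).
Proof. by move=> s x y; apply: fixpt_ext; exact: gpr_linear. Qed.
Lemma fix_gprK i j x :
  fix_gpr i (fix_gpr j x) = if i == j then fix_gpr j x else 0.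
Proof.
by apply: fixpt_ext; rewrite /= gprK; case: (i == j).
Qed.
Lemma fval_sum I (r : seq I) (F : I -> fixpt) :
  fval (\sum_(i <- r) F i) = \sum_(i <- r) fval (F i).
Proof. exact: (big_morph fval (fun x y => erefl) erefl). Qed.
Lemma fix_gpr_sum x :
  exists2 s : seq int, uniq s & x = \sum_(i <- s) fix_gpr i x.
Proof.
exists (gsupp (fval x)); first exact: gsupp_uniq.
by apply: fixpt_ext; rewrite fval_sum; exact: gsuppE.
Qed.
Definition fix_gmod : gmod S := GMod fix_gpr_linear fix_gprK fix_gpr_sum.

Lemma gmod_split : exists (Z : gmod S) (p : M -> Z) (i : Z -> M),
  [/\ rmor 0 p, rmor 0 i, forall m, i (p m) = e m & forall z, p (i z) = z].
Proof.
exists fix_gmod, fix_proj, fval; split=> //.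
- apply/rmor0P; split=> [s x y|i m]; apply: fixpt_ext => /=; first exact: eL.
  exact: eg.
- by apply/rmor0P; split.
- by move=> z; apply: fixpt_ext; exact: fvalP.
Qed.
End SplitIdempotent.

Section DirectSum2.
Variables M N : gmod S.
Let car : lmodType S^c := (M * N)%type.
Definition prod_gpr i (x : car) : car := (gpr i x.1, gpr i x.2).
Lemma prod_gpr_linear i : linear (prod_gpr i).
Proof. by move=> s x y; congr (_, _); exact: gpr_linear. Qed.
Lemma prod_gprK i j x :
  prod_gpr i (prod_gpr j x) = if i == j then prod_gpr j x else 0.
Proof. by rewrite /prod_gpr /= !gprK; case: (i == j). Qed.
Lemma prod_gpr_sum x :
  exists2 s : seq int, uniq s & x = \sum_(i <- s) prod_gpr i x.
Proof.
case: x => x y; set s := undup (gsupp x ++ gsupp y).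
have us : uniq s by exact: undup_uniq.
exists s => //.
have sumE (r : seq int) : \sum_(i <- r) prod_gpr i (x, y) =
    (\sum_(i <- r) gpr i x, \sum_(i <- r) gpr i y).
  by elim: r => [|i r IH]; rewrite ?big_nil // !big_cons IH.
rewrite sumE; congr (_, _).
  rewrite {1}[x]gsuppE; apply: (@gsumf_sub _ _ _ _ (fun _ z => z)) => // i hi.
  by rewrite mem_undup mem_cat hi.
rewrite {1}[y]gsuppE; apply: (@gsumf_sub _ _ _ _ (fun _ z => z)) => // i hi.
by rewrite mem_undup mem_cat hi orbT.
Qed.
Definition prod_gmod : gmod S := GMod prod_gpr_linear prod_gprK prod_gpr_sum.

Lemma gmod_sum : exists (P : gmod S) (i : M -> P) (j : N -> P) (p : P -> M)
    (q : P -> N),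
  [/\ rmor 0 i, rmor 0 j, rmor 0 p & rmor 0 q] /\
  [/\ forall m, p (i m) = m, forall n, q (j n) = n, forall n, p (j n) = 0,
      forall m, q (i m) = 0 & forall x, i (p x) + j (q x) = x].
Proof.
exists prod_gmod, (fun m => (m, 0)), (fun n => (0, n)), fst, snd.
split; split=> //; try by apply/rmor0P; split.
- apply/rmor0P; split=> [s x y|i m]; congr (_, _); rewrite /= ?scaler0 ?addr0 //.
  by rewrite gpr0.
- apply/rmor0P; split=> [s x y|i m]; congr (_, _); rewrite /= ?scaler0 ?addr0 //.
  by rewrite gpr0.
- by case=> x y; congr (_, _); rewrite /= ?addr0 ?add0r.
Qed.
End DirectSum2.

(** * Complements of graded submodules *)

Local Open Scope classical_set_scope.

Definition graded_sub M (P : set M) : Prop :=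
  [/\ P 0, forall x y, P x -> P y -> P (x + y), forall (s : S^c) x, P x -> P (s *: x)
    & forall i x, P x -> P (gpr i x)].

Lemma graded_subN M (P : set M) x : graded_sub P -> P x -> P (- x).
Proof. by move=> [_ _ PZ _] Px; rewrite -scaleN1r; exact: PZ. Qed.
Lemma graded_subB M (P : set M) x y : graded_sub P -> P x -> P y -> P (x - y).
Proof. by move=> gP Px Py; case: (gP) => _ PD _ _; apply: PD => //; exact: graded_subN. Qed.

(* A complement is a graded submodule maximal among those meeting P trivially:
   if a homogeneous m is not in P + K, then m J can be added to K, where J is a
   complement of the right ideal of those s with m s in P + K. *)
Lemma graded_complement (ss : semisimple_ring S) M (P : set M) :
  graded_sub P -> exists K : set M,
    [/\ graded_sub K, forall x, P x -> K x -> x = 0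
      & forall x, exists a b, [/\ P a, K b & x = a + b]].
Proof.
move=> gP; have [P0 PD PZ Pg] := gP.
(* Zero is adjoined because the union of the empty chain is the empty set. *)
pose good (X : set M) := graded_sub (X `|` [set 0]) /\
  forall x, X x -> P x -> x = 0.
have [K [[gK KP] Kmax]] : exists K, good K /\ forall X, K `<` X -> ~ good X.
  apply: Zorn_bigcup => F Fgood tot; split; last first.
    by move=> x [X FX Xx]; have [_ h] := Fgood X FX; exact: h.
  split.
  - by right.
  - move=> x y [[X FX Xx]|->]; last by rewrite add0r.
    move=> [[Y FY Yy]|->]; last by rewrite addr0; left; exists X.
    have [Z [FZ Zx Zy]] : exists Z, [/\ F Z, Z x & Z y].
      by have [XY|YX] := tot X Y FX FY; [exists Y | exists X]; split=> //; [exact: XY | exact: YX].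
    have [[_ ZD _ _] _] := Fgood Z FZ.
    have [Zxy|->] := ZD x y (or_introl Zx) (or_introl Zy); last by right.
    by left; exists Z.
  - move=> s x [[X FX Xx]|->]; last by right; rewrite scaler0.
    have [[_ _ XZ _] _] := Fgood X FX.
    have [h|->] := XZ s x (or_introl Xx); last by right.
    by left; exists X.
  - move=> i x [[X FX Xx]|->]; last by right; rewrite gpr0.
    have [[_ _ _ Xg] _] := Fgood X FX.
    have [h|->] := Xg i x (or_introl Xx); last by right.
    by left; exists X.
set K0 := K `|` [set 0] in gK; have [K00 KD KZ Kg] := gK.
have K0P x : P x -> K0 x -> x = 0 by move=> Px [Kx|//]; exact: KP.
exists K0; split=> //.
pose Q : set M := [set x | exists a b, [/\ P a, K0 b & x = a + b]].
have QD x y : Q x -> Q y -> Q (x + y).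
  move=> [a [b [Pa Kb ->]]] [a' [b' [Pa' Kb' ->]]].
  by exists (a + a'), (b + b'); split; [exact: PD | exact: KD | rewrite addrACA].
have QZ (s : S^c) x : Q x -> Q (s *: x).
  move=> [a [b [Pa Kb ->]]]; exists (s *: a), (s *: b).
  by split; [exact: PZ | exact: KZ | rewrite scalerDr].
have Q0 : Q 0 by exists 0, 0; split=> //; rewrite addr0.
suff Qh i m : homog i m -> Q m.
  move=> x; change (Q x); rewrite [x]gsuppE; elim: (gsupp x) => [|i s IH].
    by rewrite big_nil.
  by rewrite big_cons; apply: QD => //; apply: (Qh i); exact: homog_gpr.
move=> hm; case: (pselect (Q m)) => // nQ; exfalso.
have [|J [[J0 JD JM] IJ IJ1]] := ss [set s : S | Q (rmul m s)].
  split=> [|s t Qs Qt|s t Qs] /=; rewrite /rmul.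
  - by rewrite scale0r.
  - by rewrite scalerDl; exact: QD.
  - by have := QZ (t : S^c) _ Qs; rewrite /rmul scalerA.
(* Here m a lies in P + K. If the enlarged set K' were contained in K, then m b would lie in K, and
   m = m a + m b in P + K. *)
have [a [b [Qa Jb e1]]] := IJ1 1.
pose K' : set M := [set x | exists c s, [/\ K0 c, J s & x = c + rmul m s]].
have K'K x : K0 x -> K' x.
  by move=> Kx; exists x, 0; split=> //; rewrite /rmul scale0r addr0.
have gK' : graded_sub K'.
  split.
  - exact: K'K.
  - move=> x y [c [s [Kc Js ->]]] [c' [s' [Kc' Js' ->]]].
    exists (c + c'), (s + s'); split; [exact: KD | exact: JD |].
    by rewrite rmulDr addrACA.
  - move=> t x [c [s [Kc Js ->]]]; exists (t *: c), (s * (t : S)).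
    split; [exact: KZ | exact: JM |].
    by rewrite scalerDr; congr (_ + _); rewrite -[LHS]/(rmul (rmul m s) t) rmulA.
  - move=> j x [c [s [Kc Js ->]]].
    exists (gpr j c), (if j == i then s else 0); split; first exact: Kg.
      by case: ifP.
    rewrite gprD gpr_rmul -hm gprK hm; case: eqP => [->|_] //.
    by rewrite /rmul scaler0 scale0r.
have K'0 : K' `|` [set 0] = K'.
  by apply/seteqP; split=> x; [case=> [//|->]; case: gK' | left].
apply: (Kmax K').
  split; first by move=> x Kx; apply: K'K; left.
  move=> /(_ (rmul m b)) Kb'; have Kb : K (rmul m b).
    by apply: Kb'; exists 0, b; split=> //; rewrite add0r.
  apply: nQ; rewrite -[m]rmul1 e1 rmulDr.
  by apply: QD => //; exists 0, (rmul m b); split=> //; [left | rewrite add0r].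
split; first by rewrite K'0.
move=> x [c [s [Kc Js ex]]] Px.
(* Hence [s] lies both in the right ideal and in its complement [J], so it vanishes, and [x] lies in
   P and in [K0]. *)
have Qs : Q (rmul m s).
  exists x, (- c); split=> //; first exact: graded_subN.
  by rewrite ex addrAC subrr add0r.
have s0 := IJ s Qs Js.
by apply: K0P => //; rewrite ex s0 /rmul scale0r addr0.
Qed.

Lemma graded_projection (ss : semisimple_ring S) M (P : set M) :
  graded_sub P -> exists e : M -> M,
    [/\ rmor 0 e, forall m, P (e m) & forall m, P m -> e m = m].
Proof.
move=> gP; have [K [gK PK PK1]] := graded_complement ss gP.
have [P0 PD PZ Pg] := gP; have [K0 KD KZ Kg] := gK.
have ex m : exists a, P a /\ K (m - a).
  by have [a [b [Pa Kb ->]]] := PK1 m; exists a; rewrite addrC addKr.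
pose e m := projT1 (cid (ex m)).
have eP m : P (e m) /\ K (m - e m) := projT2 (cid (ex m)).
have eU m a : P a -> K (m - a) -> e m = a.
  move=> Pa Ka; have [Pe Ke] := eP m; apply/eqP; rewrite -subr_eq0; apply/eqP.
  apply: PK; first exact: graded_subB.
  have -> : e m - a = (m - a) - (m - e m).
    by rewrite opprB [RHS]addrC addrA subrK.
  exact: graded_subB.
exists e; split.
- apply/rmor0P; split=> [s x y|i m].
    apply: eU; first by apply: PD; [apply: PZ; case: (eP x) | case: (eP y)].
    rewrite opprD addrACA -scalerBr; apply: KD; last by case: (eP y).
    by apply: KZ; case: (eP x).
  apply: eU; first by apply: Pg; case: (eP m).
  have -> : gpr i m - gpr i (e m) = gpr i (m - e m).
    by rewrite gprD -scaleN1r -gprZ scaleN1r.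
  by apply: Kg; case: (eP m).
- by move=> m; case: (eP m).
- by move=> m Pm; apply: eU => //; rewrite subrr.
Qed.

Lemma graded_retraction (ss : semisimple_ring S) M N (f : M -> N) :
  rmor 0 f -> injective f ->
  exists r : N -> M, rmor 0 r /\ forall m, r (f m) = m.
Proof.
move=> f0 fI; have [fL fg] := (rmor0P f).1 f0.
have [|e [e0 eP eid]] := graded_projection ss (P := [set n | exists m, f m = n]).
  split=> /=.
  - by exists 0; exact: lin0.
  - by move=> _ _ [x <-] [y <-]; exists (x + y); exact: linD.
  - by move=> s _ [x <-]; exists (s *: x); exact: linZ.
  - by move=> i _ [x <-]; exists (gpr i x); exact: fg.
have [eL eg] := (rmor0P e).1 e0.
pose r n := projT1 (cid (eP n)).
have rP n : f (r n) = e n := projT2 (cid (eP n)).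
exists r; split; last by move=> m; apply: fI; rewrite rP eid //; exists m.
apply/rmor0P; split=> [s x y|i x]; apply: fI; first by rewrite fL !rP eL.
by rewrite fg !rP eg.
Qed.

(** For a preimage t of n, the element t - e(t) does not depend on the choice of t: two preimages
    differ by an element of the kernel, which [e] fixes. This independence makes the section linear
    and graded. *)
Lemma graded_section (ss : semisimple_ring S) M N (g : M -> N) :
  rmor 0 g -> (forall n, exists m, g m = n) ->
  exists s : N -> M, rmor 0 s /\ forall n, g (s n) = n.
Proof.
move=> g0 gS; have [gL gg] := (rmor0P g).1 g0.
have [|e [e0 eP eid]] := graded_projection ss (P := [set m | g m = 0]).
  split=> /=.
  - exact: lin0.
  - by move=> x y hx hy; rewrite (linD gL) hx hy addr0.
  - by move=> s x hx; rewrite (linZ gL) hx scaler0.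
  - by move=> i x hx; rewrite gg hx gpr0.
have [eL eg] := (rmor0P e).1 e0.
pose t n := projT1 (cid (gS n)).
have tP n : g (t n) = n := projT2 (cid (gS n)).
pose s n := t n - e (t n).
have sU n m : g m = n -> s n = m - e m.
  move=> gm; have h : e (t n) - e m = t n - m.
    by rewrite -(linB eL) eid //= (linB gL) tP gm subrr.
  apply/eqP; rewrite -subr_eq0 opprD addrACA -opprD h.
  by rewrite subrr.
have gs n : g (s n) = n by rewrite (linB gL) [g (e _)]eP subr0.
exists s; split=> //; apply/rmor0P; split=> [a x y|i x].
  rewrite (sU _ (a *: t x + t y)); last by rewrite gL !tP.
  by rewrite eL opprD addrACA -scalerBr.
rewrite (sU _ (gpr i (t x))); last by rewrite gg tP.
by rewrite eg [in RHS]gprD -[- e (t x)]scaleN1r gprZ scaleN1r.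
Qed.
End GradedModules.

(** * Local nilpotence and splittings *)

Section BarCategory.
Variables (k : fieldType) (S : falgType k) (A : ainf_alg S).
Notation B := (bshift A).
Notation bar := (bar A).
Notation bar_word := (@bar_word k S B).
Implicit Types (M N P : gmod S) (h : seq (hel B)).

Section Bundle.
Variables M N : gmod S.

(** [bar_arr] consists of all functions, whereas laws such as [bar_compA] and [bar_compDr] hold for
    linear ones and [dglaws] quantifies over every arrow. *)
Record barlin := BarLin { blval :> bar_arr A M N; blvalP : linear blval }.
HB.instance Definition _ := gen_eqMixin barlin.
HB.instance Definition _ := gen_choiceMixin barlin.

Lemma barlin_ext (f g : barlin) : blval f = blval g -> f = g.
Proof.
case: f g => [f hf] [g hg] /= fg; case: _ / fg hg => hg.
by congr BarLin; exact: Prop_irrelevance.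
Qed.

Definition bl_add (f g : barlin) : barlin :=
  @BarLin (blval f + blval g) (linear_add (blvalP f) (blvalP g)).
Definition bl_zero : barlin := @BarLin 0 (@linear_zero k S _ _).
Definition bl_opp (f : barlin) : barlin :=
  @BarLin (- blval f) (linear_opp (blvalP f)).

Lemma bl_addA : associative bl_add.
Proof. by move=> f g h; apply: barlin_ext; rewrite /= addrA. Qed.
Lemma bl_addC : commutative bl_add.
Proof. by move=> f g; apply: barlin_ext; rewrite /= addrC. Qed.
Lemma bl_add0 : left_id bl_zero bl_add.
Proof. by move=> f; apply: barlin_ext; rewrite /= add0r. Qed.
Lemma bl_addN : left_inverse bl_zero bl_opp bl_add.
Proof. by move=> f; apply: barlin_ext; rewrite /= addNr. Qed.
HB.instance Definition _ :=
  GRing.isZmodule.Build barlin bl_addA bl_addC bl_add0 bl_addN.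
End Bundle.

Definition bl_id M : barlin M M := BarLin (@bar_id_linear k S A M).
Definition bl_comp M N P (g : barlin N P) (f : barlin M N) : barlin M P :=
  BarLin (bar_comp_linear (blvalP g) (blvalP f)).
Definition bl_dd M N (f : barlin M N) : barlin M N :=
  BarLin (bar_dd_linear (blvalP f)).

Definition barDG : dgdata :=
  @DGData (gmod S) (fun M N => barlin M N) bl_id bl_comp
    (fun d M N f => rmor d (blval f)) bl_dd.

Lemma barDG_laws : dglaws barDG.
Proof.
split=> /=.
- by move=> X Y Z W h g f; apply: barlin_ext; apply: bar_compA; exact: blvalP.
- by move=> X Y f; apply: barlin_ext; apply: bar_comp1l; exact: blvalP.
- by move=> X Y f; apply: barlin_ext; apply: bar_comp1r; exact: blvalP.
- by move=> X Y Z g g' f; apply: barlin_ext; exact: bar_compDl.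
- by move=> X Y Z g f f'; apply: barlin_ext; apply: bar_compDr; exact: blvalP.
- by move=> X; exact: rmor_id.
- by move=> i X Y; exact: rmor0.
- by move=> i X Y f g; exact: rmorB.
- by move=> i j X Y Z g f; exact: rmor_comp.
- by move=> X Y f /rmor_dd.
- by move=> X Y f g; apply: barlin_ext; exact: bar_ddD.
- move=> X Y Z g f f0; apply: barlin_ext.
  exact: (@bar_ddM _ _ _ 0 _ _ _ (blval g) (blval f) (blvalP g)).
- move=> X Y Z g f f1; apply: barlin_ext.
  exact: (@bar_ddM _ _ _ 1 _ _ _ (blval g) (blval f) (blvalP g)).
- by move=> X Y f; apply: barlin_ext; apply: bar_dd_dd; exact: blvalP.
Qed.
Let CL := barDG_laws.

Definition bfst M N (f : @dghom barDG M N) : M -> N := bar_first (blval f).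

Lemma bfstE M N (f : @dghom barDG M N) m : bfst f m = blval f (pt m (bar_word [::] : bar)).
Proof. by []. Qed.
Lemma bfst_comp M N P (g : @dghom barDG N P) (f : @dghom barDG M N) m :
  bfst (g ** f) m = bfst g (bfst f m).
Proof. by rewrite bfstE /= bar_compE ?deconc_nil //; exact: blvalP. Qed.
Lemma bfst_id M m : bfst (@dgid barDG M) m = m.
Proof. by rewrite bfstE /= bar_idE. Qed.
Lemma bfstD M N (f g : @dghom barDG M N) m : bfst (f + g) m = bfst f m + bfst g m.
Proof. by []. Qed.
Lemma bfstB M N (f g : @dghom barDG M N) m : bfst (f - g) m = bfst f m - bfst g m.
Proof. by []. Qed.
Lemma bar_word_nil_central (s : S) : lmul s (bar_word [::] : bar) = rmul (bar_word [::] : bar) s.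
Proof.
rewrite -(proj2 (din_bml (tpow B) 0)) -(lin_rmul (proj1 (din_bml (tpow B) 0))).
by congr din; rewrite /= /reg_lmul mulr1; exact: (esym (mul1r s)).
Qed.

Lemma pt_nil_linear M : linear (fun m : M => pt m (bar_word [::] : bar) : gtens M bar).
Proof.
by move=> s x y; rewrite ptDl [in RHS]mtZ -[s *: x]/(rmul x s) pt_bal bar_word_nil_central.
Qed.

Lemma bar_first_rmor d M N (f : bar_arr A M N) : rmor d f -> rmor d (bar_first f).
Proof.
move=> [fL fh]; split; first exact: linear_comp fL (@pt_nil_linear M).
move=> i m hm; apply: fh; rewrite -[i]addr0; apply: homog_pt => //.
by have := @bar_word_homog k S B [::]; rewrite wdeg_nil.
Qed.

(** A map of graded modules seen as an arrow that vanishes on nonempty words; this carries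
    splittings from graded modules to the bar construction. *)
Definition strict M N (f0 : M -> N) (f0L : linear f0) : @dghom barDG M N :=
  @BarLin M N (fun x => f0 (@bar_id k S A M x))
    (linear_comp f0L (@bar_id_linear k S A M)).

Section Strict.
Variables (M N : gmod S) (f0 : M -> N) (f0L : linear f0).

Lemma strictE m (w : seq B) :
  blval (strict f0L) (pt m (bar_word w : bar)) = if w is [::] then f0 m else 0.
Proof. by rewrite /= bar_idE; case: w => //= *; rewrite (lin0 f0L). Qed.

Lemma bfst_strict m : bfst (strict f0L) m = f0 m.
Proof. by rewrite bfstE strictE. Qed.

Lemma strict_deg : rmor 0 f0 -> dgdeg 0 (strict f0L).
Proof.
move=> [_ fh]; split; first exact: blvalP.
move=> i x hx; apply: fh; have [_ h] := @rmor_id k S A M.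
by have := h _ _ hx; rewrite addr0.
Qed.

(** Every word produced by delta contains the value of an operation, hence is nonempty, and strict
    arrows vanish on it. *)
Lemma strict_dd : dgd (strict f0L) = 0.
Proof.
apply: barlin_ext; apply: bar_ext => [||m h]; [exact: blvalP.. |].
transitivity (bar_dd (blval (strict f0L)) (pt (m : M) (bar_word (vs h) : bar))).
  by [].
rewrite bar_ddE; last exact: (blvalP (strict f0L)).
apply: deconc0 => a bc _; apply: deconc0 => b c _; rewrite strictE.
by case: (vs a) => [|x v] /=; rewrite ksign_0r.
Qed.

Lemma strict_comp P (g : @dghom barDG P M) x :
  blval (strict f0L ** g) x = f0 (blval g x).
Proof.
have gL := blvalP g; have gfL : linear (fun x => f0 (blval g x)) by exact: linear_comp.
suff -> : blval (strict f0L ** g) = fun x => f0 (blval g x) by [].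
apply: bar_ext => // [|m h]; first exact: blvalP.
transitivity (bar_comp (blval (strict f0L)) (blval g) (pt (m : P) (bar_word (vs h) : bar))).
  by [].
rewrite bar_compE //; last exact: (blvalP (strict f0L)).
rewrite -[RHS](deconc_last (vs h) (fun a => f0 (blval g (pt (m : P) (bar_word a : bar))))).
by apply: eq_deconc => a b _; rewrite (strictE _ b).
Qed.
End Strict.

Lemma strict_strict M N P (g0 : N -> P) (g0L : linear g0) (f0 : M -> N)
    (f0L : linear f0) (h0L : linear (fun m => g0 (f0 m))) :
  strict g0L ** strict f0L = strict h0L.
Proof. by apply: barlin_ext; apply/funext => x; rewrite strict_comp. Qed.

Lemma strict_idE M (f0 : M -> M) (f0L : linear f0) :
  (forall m, f0 m = m) -> strict f0L = @dgid barDG M.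
Proof. by move=> h; apply: barlin_ext; apply/funext => x /=; rewrite h. Qed.

Lemma strict_zero M N (f0 : M -> N) (f0L : linear f0) :
  (forall m, f0 m = 0) -> strict f0L = 0.
Proof. by move=> h; apply: barlin_ext; apply/funext => x /=; rewrite h. Qed.

(* Evaluated on a word, n ** n only involves n on shorter words or n^0. *)
Lemma dg_idem0 M (n : @dghom barDG M M) :
  n ** n = n -> (forall m, bfst n m = 0) -> n = 0.
Proof.
move=> nn n0; have nL := blvalP n.
apply: barlin_ext; apply: bar_ext => [||m h]; [exact: blvalP.. |].
suff H (w : seq B) (x : M) : blval n (pt x (bar_word w : bar)) = 0 by rewrite H.
have [K] := ubnP (size w); elim: K w x => // K IH w x wK.
rewrite -nn /= bar_compE //; apply: deconc0 => a b e.
case: b e => [|y b] e; first exact: n0.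
rewrite (IH a) ?pt0l ?(lin0 nL) //.
by move: wK; rewrite e size_cat /= addnS !ltnS; apply: leq_ltn_trans; exact: leq_addr.
Qed.

(** * Inverting arrows whose first component is the identity *)

Section Inverse.
Variables (M : gmod S) (n : @dghom barDG M M).
Hypotheses (nd : dgdeg 0 n) (n0 : forall m, bfst n m = 0).
Let nL : linear (blval n). Proof. exact: blvalP. Qed.

Definition dgpow i : @dghom barDG M M := iter i (fun g => g ** n) (@dgid barDG M).

Lemma dgpow_deg i : dgdeg 0 (dgpow i).
Proof.
elim: i => [|i IH]; first exact: (dgdeg_id CL).
exact: (dgdeg00 CL IH nd).
Qed.

(** As [n] vanishes on the empty word, each of the [i] factors has to consume at least one
    letter. *)
Lemma dgpow_word i (w : seq B) x : (size w < i)%N ->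
  blval (dgpow i) (pt x (bar_word w : bar)) = 0.
Proof.
elim: i w x => // i IH w x wi; rewrite /= bar_compE //; last exact: blvalP.
apply: deconc0 => -[|y a] b e.
  by have := n0 x; rewrite bfstE => ->; rewrite pt0l (lin0 (blvalP _)).
by apply: IH; move: wi; rewrite e size_cat /= addSn ltnS; apply: leq_ltn_trans; exact: leq_addl.
Qed.

Lemma dgpow_bound x : exists K, forall i, (K <= i)%N -> blval (dgpow i) x = 0.
Proof.
move: x; apply: mbar_ind => [|m h|x y [K hK] [L hL]].
- by exists 0%N => i _; exact: (lin0 (blvalP _)).
- by exists (size (vs h)).+1 => i; exact: dgpow_word.
exists (maxn K L) => i; rewrite geq_max => /andP[Ki Li].
by rewrite (linD (blvalP _)) hK ?hL ?addr0.
Qed.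

Let bd x := projT1 (cid (dgpow_bound x)).
(** The geometric series of [n], a finite sum on each element. The truncation depends on the
    element; [geomE] frees it from the chosen bound. *)
Definition geom : bar_arr A M M := fun x => \sum_(i < bd x) blval (dgpow i) x.

Lemma geomE x K : (forall i, (K <= i)%N -> blval (dgpow i) x = 0) ->
  geom x = \sum_(i < K) blval (dgpow i) x.
Proof.
move=> hK; have hb : forall i, (bd x <= i)%N -> blval (dgpow i) x = 0.
  exact: (projT2 (cid (dgpow_bound x))).
have E L : (forall i, (L <= i)%N -> blval (dgpow i) x = 0) ->
    \sum_(i < L) blval (dgpow i) x = \sum_(i < maxn K (bd x)) blval (dgpow i) x \/
    (maxn K (bd x) < L)%N.
  move=> hL; case: (leqP L (maxn K (bd x))) => le; last by right.
  left; rewrite (big_ord_widen_cond _ xpredT (fun i => blval (dgpow i) x) le).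
  rewrite big_mkcond /=; apply: eq_bigr => i _; case: ltnP => // Li.
  by rewrite hL.
rewrite /geom; have [-> |] := E _ hb; last by rewrite ltnNge leq_maxr.
by have [-> |] := E _ hK; last by rewrite ltnNge leq_maxl.
Qed.

Lemma geom_linear : linear geom.
Proof.
move=> s x y; have [K hK] := dgpow_bound x; have [L hL] := dgpow_bound y.
have hx i : (maxn K L <= i)%N -> blval (dgpow i) x = 0.
  by rewrite geq_max => /andP[h _]; exact: hK.
have hy i : (maxn K L <= i)%N -> blval (dgpow i) y = 0.
  by rewrite geq_max => /andP[_ h]; exact: hL.
rewrite (geomE hx) (geomE hy) (@geomE _ (maxn K L)) => [|i hi]; last first.
  by rewrite (blvalP (dgpow i)) hx ?hy // scaler0 addr0.
rewrite scaler_sumr -big_split; apply: eq_bigr => i _.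
exact: (blvalP (dgpow i)).
Qed.

Definition geom_bl : @dghom barDG M M := BarLin geom_linear.

Lemma geom_deg : dgdeg 0 geom_bl.
Proof.
split; first exact: blvalP.
move=> i x hx; apply: homog_sum => j _; have [_ h] := dgpow_deg j.
exact: h.
Qed.

Lemma geom_left : geom_bl ** (@dgid barDG M - n) = @dgid barDG M.
Proof.
rewrite (dgBr CL) (dg1r CL); apply/eqP; rewrite subr_eq addrC; apply/eqP.
apply: barlin_ext; apply/funext => x.
(* For every arrow, composing with [n] and evaluating at [x] is evaluating at [y]; thus the series
   at [y] is the series at [x] without its first term. *)
pose y := tmap (blval n) (fun c : bar => c) (tassoc (tmap (fun m : M => m) (@bar_mu k S A) x)).
have [K hK] := dgpow_bound x; have [L hL] := dgpow_bound y.
have hx i : ((maxn K L).+1 <= i)%N -> blval (dgpow i) x = 0.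
  by move/ltnW; rewrite geq_max => /andP[h _]; exact: hK.
have hy i : (maxn K L <= i)%N -> blval (dgpow i) y = 0.
  by rewrite geq_max => /andP[_ h]; exact: hL.
transitivity (geom y + @bar_id k S A M x); last by [].
by rewrite [LHS](geomE hx) (geomE hy) big_ord_recl addrC.
Qed.
End Inverse.

Lemma dg_left_inverse M (v : @dghom barDG M M) : dgdeg 0 v ->
  (forall m, bfst v m = m) ->
  exists w : @dghom barDG M M,
    [/\ dgdeg 0 w, w ** v = @dgid barDG M & forall m, bfst w m = m].
Proof.
move=> vd v1; have nd : dgdeg 0 (@dgid barDG M - v).
  by apply: (dgdegB CL) => //; exact: (dgdeg_id CL).
have n0 m : bfst (@dgid barDG M - v) m = 0 by rewrite bfstB bfst_id v1 subrr.
have gv : geom_bl n0 ** v = @dgid barDG M by have := geom_left n0; rewrite subKr.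
exists (geom_bl n0); split=> //; first exact: geom_deg.
by move=> m; have := bfst_comp (geom_bl n0) v m; rewrite gv bfst_id v1.
Qed.

(** The left inverse [w] again has first component the identity, so it has a left inverse itself,
    which is then equal to [v]. *)
Lemma dg_inverse M (v : @dghom barDG M M) : dgdeg 0 v ->
  (forall m, bfst v m = m) ->
  exists w : @dghom barDG M M,
    [/\ dgdeg 0 w, w ** v = @dgid barDG M, v ** w = @dgid barDG M & forall m, bfst w m = m].
Proof.
move=> vd v1; have [w [wd wv w1]] := dg_left_inverse vd v1.
have [w' [_ w'w _]] := dg_left_inverse wd w1.
exists w; split=> //; have <- : w' = v; last exact: w'w.
by rewrite -[w'](dg1r CL) -wv (dgA CL) w'w (dg1l CL).
Qed.

(** A splitting (p0, i0) of e^0 gives p' = p0 e and i' = e i0, and p' i' has first component the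
    identity. With its inverse c, the arrow i' c p' is an idempotent absorbed by [e] on both sides,
    so its difference from [e] is an idempotent; the first component of that is 0, and [dg_idem0]
    applies. *)
Lemma bar_split_idem (X : dgob barDG) (e : dghom X X) : dgdeg 0 e -> e ** e = e ->
  exists (Z : dgob barDG) (p : dghom X Z) (i : dghom Z X),
    [/\ dgdeg 0 p, dgdeg 0 i, i ** p = e & p ** i = dgid Z].
Proof.
move=> ed ee; have e0 := bar_first_rmor ed.
have ee0 m : bfst e (bfst e m) = bfst e m by rewrite -bfst_comp ee.
have [Z [p0 [i0 [pd id ip pi]]]] := gmod_split e0 ee0.
have {}ip m : i0 (p0 m) = bfst e m := ip m.
have [pL _] := pd; have [iL _] := id.
pose p' := strict pL ** e; pose i' := e ** strict iL.
have p'd : dgdeg 0 p' by apply: (dgdeg00 CL) => //; exact: strict_deg.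
have i'd : dgdeg 0 i' by apply: (dgdeg00 CL) => //; exact: strict_deg.
have [|z|c [cd cpi pic c1]] := @dg_inverse Z (p' ** i').
- exact: (dgdeg00 CL).
- by rewrite !bfst_comp !bfst_strict !ee0 -ip !pi.
have cp'i' : c ** p' ** i' = @dgid barDG Z by rewrite -(dgA CL).
exists Z, (c ** p'), i'; split=> //; first exact: (dgdeg00 CL).
have eq : e ** (i' ** (c ** p')) = i' ** (c ** p') by rewrite !(dgA CL) ee.
have qe : i' ** (c ** p') ** e = i' ** (c ** p').
  by rewrite -!(dgA CL) ee.
have qq : i' ** (c ** p') ** (i' ** (c ** p')) = i' ** (c ** p').
  by rewrite (dgA CL) (dgK CL _ cp'i') (dg1r CL).
set q := i' ** (c ** p') in eq qe qq *.
apply/eqP; rewrite eq_sym -subr_eq0; apply/eqP; apply: dg_idem0.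
  by rewrite (dgBl CL) !(dgBr CL) ee eq qe qq subrr subr0.
by move=> m; rewrite bfstB /q /i' /p' !bfst_comp !bfst_strict c1 ip !ee0 subrr.
Qed.

Lemma bar_sum (X Y : dgob barDG) : exists (P : dgob barDG) (i : dghom X P)
    (j : dghom Y P) (p : dghom P X) (q : dghom P Y),
  [/\ [/\ dgdeg 0 i, dgdeg 0 j, dgdeg 0 p & dgdeg 0 q],
      [/\ dgd i = 0, dgd j = 0, dgd p = 0 & dgd q = 0]
    & [/\ p ** i = dgid X, q ** j = dgid Y, p ** j = 0, q ** i = 0
        & i ** p + j ** q = dgid P]].
Proof.
have [P [i [j [p [q [[id jd pd qd] [pi qj pj qi e]]]]]]] := gmod_sum X Y.
have [iL _] := id; have [jL _] := jd; have [pL _] := pd; have [qL _] := qd.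
exists P, (strict iL), (strict jL), (strict pL), (strict qL).
split; split; try exact: strict_deg; try exact: strict_dd.
- by rewrite (strict_strict _ _ (linear_comp pL iL)); exact: strict_idE.
- by rewrite (strict_strict _ _ (linear_comp qL jL)); exact: strict_idE.
- by rewrite (strict_strict _ _ (linear_comp pL jL)); exact: strict_zero.
- by rewrite (strict_strict _ _ (linear_comp qL iL)); exact: strict_zero.
apply: barlin_ext; apply/funext => x.
transitivity (blval (strict iL ** strict pL) x + blval (strict jL ** strict qL) x).
  by [].
by rewrite !strict_comp /= e.
Qed.

Lemma bar_inhabited : exists X : dgob barDG, True.
Proof. by exists (greg S). Qed.

Section Semisimple.
Hypothesis ss : semisimple_ring S.

(** A graded retraction of f^0, read as a strict arrow, composes with [f] to an invertible
    endomorphism; composing it with the inverse corrects it. *)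
Lemma bar_retraction (X Y : dgob barDG) (f : dghom X Y) :
  dgdeg 0 f -> injective (bfst f) ->
  exists r : dghom Y X, dgdeg 0 r /\ r ** f = dgid X.
Proof.
move=> fd fI; have [r0 [rd rf]] := graded_retraction ss (bar_first_rmor fd) fI.
have [rL _] := rd; have rsd := strict_deg rL rd.
have [|m|w [wd wv _ _]] := @dg_inverse X (strict rL ** f).
- exact: (dgdeg00 CL).
- by rewrite bfst_comp bfst_strict; exact: rf.
by exists (w ** strict rL); split; [exact: (dgdeg00 CL) | rewrite -(dgA CL)].
Qed.

Lemma bar_section (Y Z : dgob barDG) (g : dghom Y Z) :
  dgdeg 0 g -> (forall z, exists y, bfst g y = z) ->
  exists s : dghom Z Y, dgdeg 0 s /\ g ** s = dgid Z.
Proof.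
move=> gd gS; have [s0 [sd gs]] := graded_section ss (bar_first_rmor gd) gS.
have [sL _] := sd; have ssd := strict_deg sL sd.
have [|m|w [wd _ vw _]] := @dg_inverse Z (g ** strict sL).
- exact: (dgdeg00 CL).
- by rewrite bfst_comp bfst_strict; exact: gs.
by exists (strict sL ** w); split; [exact: (dgdeg00 CL) | rewrite (dgA CL)].
Qed.

Lemma bar_splitP (X Y Z : dgob barDG) (f : dghom X Y) (g : dghom Y Z) :
  dgdeg 0 f -> dgdeg 0 g ->
  (g ** f = 0 /\ short_exact (bfst f) (bfst g)) <-> dgsplit f g.
Proof.
move=> fd gd; split=> [[gf [fI ex gS]]|[gf [r [s [rd sd rf gs e]]]]].
  have [r [rd rf]] := bar_retraction fd fI.
  have [s' [s'd gs']] := bar_section gd gS.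
  (* The section is corrected to satisfy r s = 0, which makes f r + s g an idempotent. *)
  pose s := (dgid Y - f ** r) ** s'.
  have sd : dgdeg 0 s.
    apply: (dgdeg00 CL) => //; apply: (dgdegB CL); first exact: (dgdeg_id CL).
    exact: (dgdeg00 CL).
  have gs : g ** s = dgid Z.
    by rewrite (dgA CL) (dgBr CL) (dg1r CL) (dgA CL) gf (dg0l CL) subr0.
  have rs : r ** s = 0.
    by rewrite (dgA CL) (dgBr CL) (dg1r CL) (dgA CL) rf (dg1l CL) subrr (dg0l CL).
  clearbody s; split=> //; exists r, s; split=> //.
  apply/esym/eqP; rewrite -subr_eq0; apply/eqP.
  set q := f ** r + s ** g.
  have fq : q ** f = f.
    by rewrite (dgDl CL) (dgK CL _ rf) (dgK CL _ gf) (dg1r CL) (dg0r CL) addr0.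
  have sq : q ** s = s.
    by rewrite (dgDl CL) (dgK CL _ rs) (dgK CL _ gs) (dg1r CL) (dg0r CL) add0r.
  have qq : q ** q = q by rewrite {2}/q (dgDr CL) !(dgA CL) fq sq.
  apply: dg_idem0 => [|y].
    by rewrite (dgBl CL) (dg1l CL) (dgBr CL) (dg1r CL) qq subrr subr0.
  have rq : r ** q = r by rewrite (dgDr CL) !(dgA CL) rf rs (dg1l CL) (dg0l CL) addr0.
  have gq : g ** q = g by rewrite (dgDr CL) !(dgA CL) gf gs (dg1l CL) (dg0l CL) add0r.
  (* Since g (1 - q) = 0, exactness gives (1 - q)^0 y = f^0 x for some x, and r (1 - q) = 0 forces x
     = 0. *)
  have [x fx] : exists x, bfst f x = bfst (dgid Y - q) y.
    by apply/ex; rewrite -bfst_comp (dgBr CL) gq (dg1r CL) subrr.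
  have x0 : x = 0.
    rewrite -[x]bfst_id -rf bfst_comp fx -bfst_comp (dgBr CL) rq (dg1r CL).
    by rewrite subrr.
  by rewrite -fx x0; exact: (lin0 (proj1 (bar_first_rmor fd))).
split=> //; have rf0 x : bfst r (bfst f x) = x by rewrite -bfst_comp rf bfst_id.
have gs0 z : bfst g (bfst s z) = z by rewrite -bfst_comp gs bfst_id.
split.
- by move=> x x' /(congr1 (bfst r)); rewrite !rf0.
- move=> y; split=> [gy|[x <-]]; last by rewrite -bfst_comp gf.
  exists (bfst r y); rewrite -[RHS]bfst_id -e bfstD !bfst_comp gy.
  have -> : bfst s 0 = 0 := lin0 (proj1 (bar_first_rmor sd)).
  by rewrite addr0.
- by move=> z; exists (bfst s z).
Qed.
End Semisimple.
End BarCategory.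

(** * The bijection between families and bar arrows *)

Section Hat.
Variables (k : fieldType) (S : falgType k) (A : ainf_alg S).
Notation B := (bshift A).
Notation bar := (bar A).
Notation bar_word := (@bar_word k S B).
Notation pwA := (@pure_word k S A).
Notation pwB := (@pure_word k S B).
Implicit Types (M N P : gmod S) (h : seq (hel B)).

Definition fam_linear M N (f : mfamily A M N) : Prop := forall j, linear (f j).

Lemma fam_deg_linear d M N (f : mfamily A M N) : fam_deg d f -> fam_linear f.
Proof. by move=> fd j; case: (fd j). Qed.

Section HatDef.
Variables M N : gmod S.

Definition sig_map n : gtens M (tpow A n) -> gtens (gshift M) (tpow B n) :=
  ktens (- n%:Z) (@sigma k S M) (@sigpow k S A n).
Definition sig_mapV n : gtens (gshift M) (tpow B n) -> gtens M (tpow A n) :=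
  tmap (fun m : gshift M => koszul (- n%:Z) (unsigma m)) (@sigpowV k S A n).

Lemma sig_mapK n : cancel (@sig_map n) (@sig_mapV n).
Proof.
exact: (@ktens_sigmaK k S M (tpow A n) (tpow B n) _ _ (- n%:Z)
  (@sigpow_bml k S A n) (@sigpowV_bml k S A n) (@sigpowK k S A n)).
Qed.
Lemma sig_mapVK n : cancel (@sig_mapV n) (@sig_map n).
Proof.
exact: (@ktens_sigmaVK k S M (tpow A n) (tpow B n) _ _ (- n%:Z)
  (@sigpow_bml k S A n) (@sigpowV_bml k S A n) (@sigpowVK k S A n)).
Qed.
Lemma sig_map_linear n : linear (@sig_map n).
Proof. by apply: ktens_linear => //; exact: sigpow_bml. Qed.
Lemma sig_mapV_linear n : linear (@sig_mapV n).
Proof. by apply: tmap_linear; [exact: koszul_unsigma_linear | exact: sigpowV_bml]. Qed.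

Lemma hat_compE (f : mfamily A M N) n y : hat_comp f y = f n (sig_mapV y).
Proof. by rewrite /hat_comp (inv_map_can (@sig_mapK n) (@sig_mapVK n)). Qed.

Section LinearFamily.
Variable f : mfamily A M N.
Hypothesis fL : fam_linear f.

Lemma hat_comp_linear n : linear (fun y => @hat_comp k S A M N f n y).
Proof.
have -> : (fun y => @hat_comp k S A M N f n y) = fun y => f (sig_mapV y).
  by apply/funext => y; rewrite hat_compE.
exact: (@linear_comp k S _ _ (gshift N) (@f n) _ (@fL n) (@sig_mapV_linear n)).
Qed.

Let phi (m : gshift M) (n : nat) (b : tpow B n) : gshift N := hat_comp f (pt m b).

Lemma hat_phiD m n : {morph (fun b => @phi m n b) : x y / x + y}.
Proof. by move=> x y; rewrite /phi ptDr (linD (@hat_comp_linear n)). Qed.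
Let phi0 m n : @phi m n 0 = 0.
Proof. by rewrite /phi pt0r (lin0 (@hat_comp_linear n)). Qed.

Lemma hat_bal : balanced (@rmul k S (gshift M)) (@lmul k S bar)
  (fun m c => dlift (fun n b => @phi m n b) c).
Proof.
split=> [m m' c|m c c'|m s c].
- rewrite -big_split; apply: eq_bigr => n _.
  by rewrite /phi ptDl (linD (@hat_comp_linear n)).
- by apply: dliftD => n; exact: hat_phiD.
have hc n : (dbound c <= n)%N -> (c : dsum (tpow B)) n = 0 by exact: dboundP.
rewrite !(@dlift_bound _ _ _ _ _ _ (dbound c)) //; try exact: phi0.
- by apply: eq_bigr => n _; rewrite /phi pt_bal.
- by move=> n hn; rewrite dlmulE hc // lmul0.
Qed.

Lemma hat_ptE m c : hat f (pt m c) = dlift (fun n b => @phi m n b) c.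
Proof. exact: (tliftE hat_bal). Qed.

Lemma hat_linear : linear (hat f).
Proof.
apply: tlift_linear; first exact: hat_bal.
move=> m s c; have hc n : (dbound c <= n)%N -> (c : dsum (tpow B)) n = 0 by exact: dboundP.
rewrite !(@dlift_bound _ _ _ _ _ _ (dbound c)) //; try exact: phi0.
- rewrite scaler_sumr; apply: eq_bigr => n _.
  by rewrite dvalZ -mtZ (linZ (@hat_comp_linear n)).
- by move=> n hn; rewrite dvalZ hc // scaler0.
Qed.

Lemma hat_din n (z : gtens (gshift M) (tpow B n)) :
  hat f (tmap (fun m : gshift M => m) (@din k S (tpow B) n) z) = hat_comp f z.
Proof.
have dB := din_bml (tpow B) n; have tL := tmap_linear (@linear_id k S (gshift M)) dB.
move: z; apply: mt_ext => [x y|x y|m b].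
- by rewrite (linD tL) (linD hat_linear).
- exact: (linD (@hat_comp_linear n)).
by rewrite tmapEl // hat_ptE dliftEd // => j; exact: hat_phiD.
Qed.

(** This is [esg] with [m] as an additional first letter, of degree hdeg m + 1 before the shift. *)
Definition esgm (m : hel (gshift M)) h : int :=
  (size h)%:Z * (hdeg m + 1) + esg h.

Lemma hatE (m : hel (gshift M)) h n : size h = n ->
  hat f (pt (m : gshift M) (bar_word (vs h) : bar)) =
  ksign (esgm m h) (f (pt (m : M) (pwA n (vs h)) : gtens M (tpow A n))).
Proof.
move=> sh; have e : bar_word (vs h) = din (pwB n (vs h)) by rewrite (bar_wordE (etrans (size_vs h) sh)).
rewrite e hat_ptE dliftEd; last by move=> j; exact: hat_phiD.
rewrite /phi hat_compE /sig_mapV tmapEl; last first.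
- exact: sigpowV_bml.
- exact: koszul_unsigma_linear.
rewrite (koszulE _ (hvalP (unsh m))) sigpowV_pure_word // pt_ksignl pt_ksignr -ksign_add.
rewrite (lin_ksign (@fL n)) /esgm sh; apply: ksign_odd.
by rewrite !odd_absD !odd_absM abszN.
Qed.
End LinearFamily.

Definition unhat (u : bar_arr A (gshift M) (gshift N)) : mfamily A M N :=
  fun n x => unsigma (u (tmap (fun m : gshift M => m) (@din k S (tpow B) n) (sig_map x))).

Lemma unhat_linear (u : bar_arr A (gshift M) (gshift N)) : linear u -> fam_linear (unhat u).
Proof.
move=> uL n; have tL := tmap_linear (@linear_id k S (gshift M)) (din_bml (tpow B) n).
exact: (@linear_comp k S _ _ N u _ uL (linear_comp tL (@sig_map_linear n))).
Qed.

Lemma hatK (f : mfamily A M N) : fam_linear f -> unhat (hat f) = f.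
Proof.
move=> fL; apply: fam_ext => n x.
by rewrite /unhat hat_din // hat_compE sig_mapK.
Qed.

Lemma unhatK (u : bar_arr A (gshift M) (gshift N)) : linear u -> hat (unhat u) = u.
Proof.
move=> uL; have nL := unhat_linear uL.
apply/funext; apply: mt_ext => [x y|x y|m].
- exact: (linD (hat_linear nL)).
- exact: (linD uL).
apply: bdsum_ind => [|n x y IH].
  by rewrite pt0r (lin0 uL) (lin0 (hat_linear nL)).
rewrite ptDr (linD uL) (linD (hat_linear nL)) IH; congr (_ + _).
have dB := din_bml (tpow B) n.
have := hat_din nL (pt m x : gtens (gshift M) (tpow B n)).
by rewrite tmapEl // hat_compE /unhat sig_mapVK tmapEl.
Qed.

Lemma hatD (f g : mfamily A M N) : hat (f + g) = hat f + hat g.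
Proof.
apply/funext => x; rewrite /hat [RHS]bar_addE -tlift_addf.
apply: eq_tlift => m c; rewrite /dlift -big_split; apply: eq_bigr => n _.
by rewrite !hat_compE.
Qed.

Lemma hat_inj (f g : mfamily A M N) :
  fam_linear f -> fam_linear g -> hat f = hat g -> f = g.
Proof. by move=> fL gL e; rewrite -(hatK fL) -(hatK gL) e. Qed.

Lemma hat_deg d (f : mfamily A M N) : fam_deg d f -> rmor d (hat f).
Proof.
move=> fd; have fL := fam_deg_linear fd.
apply: mbar_rmor => [|m h]; first exact: hat_linear.
rewrite (hatE fL m (erefl (size h))).
apply: (@homog_ksign k S (gshift N)).
have [_ hh] := fd (size h).
have := hh _ _ (homog_pt (hvalP (unsh m)) (pure_word_homog (size h) (ush h))).
rewrite vs_ush wdeg_ush => H.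
change (homog (hdeg m + wdeg h + d + 1) (f (size h) (pt (m : M) (pwA (size h) (vs h))))).
by move: H; congr homog; rewrite /=; ring.
Qed.

Lemma shl_homog (P : gmod S) (x : hel P) : homog (hdeg x - 1) (hval x : gshift P).
Proof. by rewrite /homog /= subrK; exact: hvalP. Qed.
Definition shl (P : gmod S) (x : hel P) : hel (gshift P) := Hel (shl_homog x).

Lemma unhat_deg d (u : bar_arr A (gshift M) (gshift N)) : rmor d u -> fam_deg d (unhat u).
Proof.
move=> ud n; have [uL _] := ud; have nL := unhat_linear uL.
apply: mtpow_rmor => [|m h sh]; first exact: nL.
(* The letters of a word in A are read in A[1], each losing one degree, so that [hatE] expresses
   [unhat u] through [u] up to sign. *)
pose h' : seq (hel B) := [seq shl x | x <- h].
have sh' : size h' = n by rewrite size_map.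
have vh : vs h' = vs h :> seq A by rewrite /vs -map_comp.
have wh : wdeg h' = wdeg h - n%:Z.
  rewrite -sh /h'; elim: (h) => [|x w IH] /=; first by rewrite !wdeg_nil.
  by rewrite !wdeg_cons IH /=; lia.
have := hatE nL (shl m) sh'; rewrite (unhatK uL) => e.
have := rmor_word (shl m) h' ud; rewrite e wh vh => H.
have {}H := @homog_ksign k S (gshift N) _ (esgm (shl m) h') _ H.
rewrite ksignK in H.
have : homog (hdeg (shl m) + (wdeg h - n%:Z) + d + 1)
  (unhat u (pt (m : M) (pwA n (vs h)) : gtens M (tpow A n))) by exact: H.
by congr homog; rewrite /=; ring.
Qed.
End HatDef.

Lemma koszul0 M (m : M) : koszul 0 m = m.
Proof.
rewrite [RHS]gsuppE {1}(gsuppE m) (lin_sum (koszul_linear _)).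
by apply: eq_bigr => i _; rewrite (koszulE _ (homog_gpr i m)) mul0r.
Qed.

Lemma fam_first_hat M N (f : mfamily A M N) : fam_linear f ->
  bar_first (hat f) = fam_first f.
Proof.
move=> fL; apply/funext => m; rewrite /bar_first.
have -> : hat f (pt (m : gshift M) (din (1 : tpow B 0) : bar)) =
    hat_comp f (pt (m : gshift M) (1 : tpow B 0)).
  rewrite -(hat_din fL) tmapEl //; exact: din_bml.
rewrite hat_compE /sig_mapV tmapEl //=; last exact: koszul_unsigma_linear.
congr (f 0%N (pt _ _)); exact: (@koszul0 M m).
Qed.
End Hat.

(** * Compatibility of the hat with composition and with the operations *)

Section HatOperations.
Variables (k : fieldType) (S : falgType k) (A : ainf_alg S).
Notation B := (bshift A).
Notation bar := (bar A).
Notation bar_word := (@bar_word k S B).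
Notation pwA := (@pure_word k S A).
Notation pwB := (@pure_word k S B).
Implicit Types (M N P : gmod S) (h : seq (hel B)).

Lemma linear_sum2 (U V : lmodType S^c) n (G : nat -> nat -> U -> V) :
  (forall r s, linear (G r s)) -> linear (fun x => sum2 n (fun r s => G r s x)).
Proof. by move=> hG; apply: linear_bigsum => r _; apply: linear_bigsum => s _. Qed.
Lemma linear_sum3 (U V : lmodType S^c) n (G : nat -> nat -> nat -> U -> V) :
  (forall r s t, (0 < s)%N -> linear (G r s t)) ->
  linear (fun x => sum3 n (fun r s t => G r s t x)).
Proof.
move=> hG; apply: linear_bigsum => r _; apply: linear_bigsum => s s0.
by apply: linear_bigsum => t _; exact: hG.
Qed.

(* The common shape of [fam_comp] and [fam_mod], for a sign exponent c *)
Definition fam_compg (c : nat -> nat -> nat) M N P (g : mfamily A N P)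
    (f : mfamily A M N) : mfamily A M P := fun j x =>
  sum2 j (fun r s => ksign (c r s)
    (g s (tmap (f r) (fun b => b) (@msplit k S A M r s j x)))).

Lemma fam_compg_linear c M N P (g : mfamily A N P) (f : mfamily A M N) :
  fam_linear g -> fam_linear f -> fam_linear (fam_compg c g f).
Proof.
move=> gL fL j; apply: linear_sum2 => r s; apply: linear_ksign.
apply: (linear_comp (gL s)).
apply: (linear_comp (V := gtens (gtens M (tpow A r)) (tpow A s))).
  by apply: tmap_linear.
exact: msplit_linear.
Qed.

Lemma hat_hel_homog d M N (f : mfamily A M N) (fd : fam_deg d f)
    (m : hel (gshift M)) h :
  homog (hdeg m + wdeg h + d) (hat f (pt (m : gshift M) (bar_word (vs h) : bar))).
Proof. exact: rmor_word (hat_deg fd). Qed.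

(** The exponent s (r + d) is the sign of moving the map f_{r+1}, of degree d - r, past the
    suspensions of the [s] letters left for [g]. *)
Lemma hat_fam_compg c d M N P (g : mfamily A N P) (f : mfamily A M N) :
  (forall r s, odd (c r s) = odd (absz (s%:Z * (r%:Z + d)))) ->
  fam_linear g -> fam_deg d f ->
  hat (fam_compg c g f) = bar_comp (hat g) (hat f).
Proof.
move=> hc gL fd; have fL := fam_deg_linear fd.
have cL := fam_compg_linear c gL fL.
have hgL := hat_linear gL; have hfL := hat_linear fL.
apply: bar_ext => [||m h]; [exact: hat_linear | exact: bar_comp_linear |].
rewrite bar_compE // deconc_vs (hatE cL m (erefl (size h))).
pose Phi (a b : seq (hel B)) := ksign (c (size a) (size b)) (g (size b)
  (pt (f (size a) (pt (m : M) (pwA (size a) (vs a)))) (pwA (size b) (vs b)))) : P.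
rewrite [X in ksign _ X](sum2_deconc (w := h) (Phi := Phi)) //; last first.
  move=> a b e; rewrite /Phi; congr (ksign _ (g _ _)).
  rewrite msplit_pure_word; last by rewrite e size_cat.
  have -> : vs h = vs a ++ vs b by rewrite e vs_cat.
  rewrite (take_size_cat _ (size_vs a)) (drop_size_cat _ (size_vs a)).
  by rewrite tmapEl //; exact: fL.
rewrite -[LHS](@deconc_ksign _ P); apply: eq_deconc => a b e.
pose m' := Hel (hat_hel_homog fd m a).
have m'E : hval m' = ksign (esgm m a)
    (f (size a) (pt (m : M) (pwA (size a) (vs a)))) :> N.
  exact: (hatE fL m (erefl (size a))).
transitivity (hat g (pt (m' : gshift N) (bar_word (vs b) : bar))); last by [].
rewrite (hatE gL m' (erefl (size b))) m'E pt_ksignl (lin_ksign (gL _)).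
rewrite /Phi -!ksign_add; apply: ksign_odd.
rewrite e /esgm esg_cat size_cat /= !odd_absD absz_nat hc.
by odd_tac.
Qed.

Lemma fam_alg_linear M N (f : mfamily A M N) :
  fam_linear f -> fam_linear (fam_alg f).
Proof.
move=> fL j; apply: linear_sum3 => r s t s0; apply: linear_ksign.
apply: (linear_comp (fL _)); apply: ktens_linear => //.
by apply: insert_bml; exact: ainf_op_bml.
Qed.

(** Inserting the operations m_s into a family becomes precomposition with delta; the suspensions
    absorb (-1)^{r+st}, as in [op_rel], now with [m] counted among the letters on the left. *)
Lemma hat_fam_alg M N (f : mfamily A M N) : fam_linear f ->
  hat (fam_alg f) = bar_dd (hat f).
Proof.
move=> fL; have aL := fam_alg_linear fL; have hfL := hat_linear fL.
apply: bar_ext => [||m h]; [exact: hat_linear | exact: bar_dd_linear |].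
rewrite bar_ddE // (hatE aL m (erefl (size h))).
have slot0 n (a c : seq A) : f n (pt (m : M) (pwA n (a ++ 0 :: c))) = 0.
  by rewrite pure_word_slot0 pt0r (lin0 (fL n)).
pose n3 (a c : seq (hel B)) := (size a + (size c).+1)%N.
(* The empty window is given the value 0, in accordance with [op_nil]. *)
pose Phi (a b c : seq (hel B)) := ksign ((size a).+1 + size b * size c)%N
  (ksign ((2 - (size b)%:Z) * (hdeg m + 1 + wdeg (ush a)))
    (f (n3 a c) (pt (m : M) (pwA (n3 a c) (vs a ++
      (if b is [::] then 0 else ainf_op (pwA (size b) (vs b))) :: vs c))))) : N.
rewrite [X in ksign _ X](sum3_deconc (w := h) (Phi := Phi)) //; first last.
- move=> a b c e b0; rewrite /Phi; congr (ksign _ _).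
  have bn : b <> [::] by move=> bn; rewrite bn in b0.
  have -> : vs h = vs (ush a) ++ vs (ush b) ++ vs (ush c) :> seq A.
    by rewrite e !vs_cat !vs_ush.
  have iB : bml (@insert k S A (size a) (size b) (size c) (2 - (size b)%:Z)
      (@ainf_op k S A (size b)) (size h)).
    by apply: insert_bml; exact: ainf_op_bml.
  rewrite (ktensEl _ _ (@linear_id k S M) iB (hvalP (unsh m))).
  rewrite insert_pure_word ?size_ush //; [|exact: ainf_op_bml|by rewrite e !size_cat].
  have sb : size (vs (ush b)) = size b by rewrite size_vs size_ush.
  rewrite (take_size_cat _ sb) (drop_size_cat _ sb) !vs_ush.
  rewrite pt_ksignr -ksign_add (lin_ksign (fL _)) [hdeg _]/= -mulrDr.
  by congr (ksign _ _); case: b bn {e b0 iB sb}.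
- by move=> a c _; rewrite /Phi slot0 !ksign_0r.
rewrite -[LHS](@deconc_ksign _ N); apply: eq_deconc => a bc e.
rewrite -[LHS](@deconc_ksign _ N); apply: eq_deconc => b c e'.
pose w := a ++ op b :: c.
have sw : size w = n3 a c by rewrite size_cat.
transitivity (ksign (hdeg m + wdeg a) (hat f (pt (m : gshift M) (bar_word (vs w) : bar))));
  last by rewrite /w vs_cat vs_cons.
rewrite (hatE fL m sw) /Phi; case: (pselect (b = [::])) => [b0|bn].
  have -> : vs w = vs a ++ 0 :: vs c :> seq A by rewrite /w b0 vs_cat vs_cons op_nil.
  by rewrite b0 slot0 !ksign_0r.
have -> : vs w = vs a ++ ksign (esg b) (ainf_op (pwA (size b) (vs b))) :: vs c :> seq A.
  by rewrite /w vs_cat vs_cons opE.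
rewrite pure_word_slot_ksign pt_ksignr (lin_ksign (fL _)).
have -> : (if b is [::] then 0 else ainf_op (pwA (size b) (vs b))) =
    ainf_op (pwA (size b) (vs b)) by case: (b) bn.
rewrite -!ksign_add; apply: ksign_odd.
rewrite e e' /esgm /w !esg_cat esg_cons hdeg_op wdeg_ush !size_cat /=.
odd_tac.
Qed.
End HatOperations.

(** * The equivalence of exact categories *)

Section GradedShift.
Variables (k : fieldType) (S : falgType k).

Lemma gmod_eq (V : lmodType S^c) (p q : int -> V -> V) pL pK pS qL qK qS :
  (forall i m, p i m = q i m) -> @GMod k S V p pL pK pS = @GMod k S V q qL qK qS.
Proof.
move=> pq; have {}pq : p = q.
  by apply: functional_extensionality_dep => i; apply/funext; exact: pq.
case: _ / pq qL qK qS => qL qK qS.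
by congr GMod; exact: Prop_irrelevance.
Qed.

Section Unshift.
Variable N : gmod S.
Lemma unshift_linear i : linear (@gpr k S N (i - 1)).
Proof. exact: gpr_linear. Qed.
Lemma unshift_gprK i j (m : N) :
  gpr (i - 1) (gpr (j - 1) m) = if i == j then gpr (j - 1) m else 0.
Proof. by rewrite gprK (inj_eq (addIr _)). Qed.
Lemma unshift_sum (m : N) :
  exists2 s : seq int, uniq s & m = \sum_(i <- s) gpr (i - 1) m.
Proof.
exists [seq i + 1 | i <- gsupp m].
  by rewrite (map_inj_uniq (addIr _)) gsupp_uniq.
rewrite big_map {1}(gsuppE m); apply: eq_bigr => i _; by rewrite addrK.
Qed.
Definition gunshift : gmod S := GMod unshift_linear unshift_gprK unshift_sum.

(** The underlying module is unchanged and the projections are indexed by i + 1 - 1, so this is an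
    equality of records; it makes the functor G surjective on objects and not only up to
    isomorphism. *)
Lemma gunshiftK : gshift gunshift = N.
Proof.
rewrite /gshift /gunshift /=.
case: N unshift_linear unshift_gprK unshift_sum => V p pL pK pS /= uL uK uS.
by apply: gmod_eq => i m; rewrite /= addrK.
Qed.
End Unshift.
End GradedShift.

Lemma dgtw_eq (C : dgdata) (X : dgob C) (u u' : dghom X X) ud mc ud' mc' :
  u = u' -> @DGTw C X u ud mc = @DGTw C X u' ud' mc'.
Proof.
move=> e; case: _ / e ud' mc' => ud' mc'.
by congr DGTw; exact: Prop_irrelevance.
Qed.

Lemma tgmod_eq (k : fieldType) (S : falgType k) (A : ainf_alg S) (M : gmod S)
    (u u' : bar_arr A M M) (t : twisted u) (t' : twisted u') :
  u = u' -> TGMod t = TGMod t'.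
Proof.
by move=> e; case: _ / e t' => t'; congr TGMod; exact: Prop_irrelevance.
Qed.

(** * The functors from modules to twisted objects *)

Section Assembly.
Variables (k : fieldType) (S : falgType k) (A : ainf_alg S).
Notation B := (bshift A).
Notation bar := (bar A).
Notation bar_word := (@bar_word k S B).
Notation pwA := (@pure_word k S A).
Notation barDG := (barDG A).
Let CL := barDG_laws A.

(* Arrows of [TGMod0 A] need not be linear: those which are not go to 0. *)
Definition bl_of (M N : gmod S) (f : bar_arr A M N) : @dghom barDG M N :=
  match pselect (linear f) with
  | left fL => BarLin fL
  | right _ => 0
  end.

Lemma bl_ofE (M N : gmod S) (f : bar_arr A M N) : linear f -> blval (bl_of f) = f.
Proof. by rewrite /bl_of; case: pselect. Qed.

Lemma bl_of_val (M N : gmod S) (f : @dghom barDG M N) : bl_of (blval f) = f.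
Proof. by apply: barlin_ext; rewrite bl_ofE //; exact: blvalP. Qed.

Lemma bl_of_comp (M N P : gmod S) (g : bar_arr A N P) (f : bar_arr A M N) :
  linear g -> linear f -> bl_of (bar_comp g f) = bl_of g ** bl_of f.
Proof.
move=> gL fL; apply: barlin_ext; rewrite bl_ofE /= ?bl_ofE //.
exact: bar_comp_linear.
Qed.

Lemma bl_of_add (M N : gmod S) (f g : bar_arr A M N) :
  linear f -> linear g -> bl_of (f + g) = bl_of f + bl_of g.
Proof.
move=> fL gL; apply: barlin_ext; rewrite bl_ofE /= ?bl_ofE //.
exact: linear_add.
Qed.

Lemma bl_of_id (M : gmod S) : bl_of (@bar_id k S A M) = @dgid barDG M.
Proof. exact: (bl_of_val (@dgid barDG M)). Qed.

Lemma bl_of_inj (M N : gmod S) (f g : bar_arr A M N) :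
  linear f -> linear g -> bl_of f = bl_of g -> f = g.
Proof. by move=> fL gL e; rewrite -(bl_ofE fL) -(bl_ofE gL) e. Qed.

Lemma bar_diff0E (M N : gmod S) (f : bar_arr A M N) x : bar_diff 0 f x = - bar_dd f x.
Proof. by []. Qed.

Lemma tdiff_linear (T : tgmod A) : linear (tdiff T).
Proof. by case: (tdiffP T) => -[]. Qed.

Lemma tdiff_mc (T : tgmod A) : dgd (BarLin (@tdiff_linear T) : @dghom barDG T T) +
  (BarLin (@tdiff_linear T) : @dghom barDG T T) ** BarLin (@tdiff_linear T) = 0.
Proof. by apply: barlin_ext; apply/funext => x; case: (tdiffP T) => _ /(_ x). Qed.

Lemma tdiff_deg (T : tgmod A) : dgdeg 1 (BarLin (@tdiff_linear T) : @dghom barDG T T).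
Proof. by case: (tdiffP T). Qed.

Definition tw_of (T : tgmod A) : dgtw barDG := DGTw (tdiff_deg T) (tdiff_mc T).

(** [TGMod0] differs from [TW] only in that its ambient arrows may be nonlinear; on morphisms
    [bl_of] is an identification. *)
Definition tw_functor : functor_data (TGMod0 A) (TW barDG) :=
  @FunctorData (TGMod0 A) (TW barDG) tw_of (fun X Y f => bl_of f).

Lemma tg_morP (X Y : tgmod A) (f : bar_arr A X Y) :
  tg_mor f <-> linear f /\ @cmor (TW barDG) (tw_of X) (tw_of Y) (bl_of f).
Proof.
split=> [[f0 fd]|[fL [f0 fd]]].
  have [fL _] := f0; split=> //; split; first by rewrite /= bl_ofE.
  apply: barlin_ext; apply/funext => x.
  have := fd x; rewrite bar_diff0E -addrA addrC => /eqP.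
  rewrite subr_eq0 => /eqP /esym e.
  by move: e; rewrite /= bl_ofE.
split; first by rewrite /= bl_ofE in f0.
move=> x; have := congr1 (fun g => blval g x) fd; rewrite /= bl_ofE // => e.
rewrite bar_diff0E -addrA addrC; apply/eqP; rewrite subr_eq0; apply/eqP.
exact: esym e.
Qed.

Lemma tw_functor_ffs : ff_surjection tw_functor.
Proof.
have PT := TW_preadditive CL.
have lin (X Y : tgmod A) (f : bar_arr A X Y) : @tg_mor k S A X Y f -> linear f.
  by case=> -[].
have cl (X Y : tgmod A) (f : bar_arr A X Y) : @tg_mor k S A X Y f ->
    @cmor (TW barDG) (tw_of X) (tw_of Y) (bl_of f).
  by case/tg_morP.
split=> /=.
- move=> X; apply/tg_morP; split; first exact: bar_id_linear.
  by rewrite bl_of_id; exact: (cmor_id PT (tw_of X)).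
- move=> X Y Z g f cg cf; have gL := lin _ _ _ cg; have fL := lin _ _ _ cf.
  apply/tg_morP; split; first exact: bar_comp_linear.
  rewrite bl_of_comp //.
  exact: (@cmor_comp _ PT (tw_of X) (tw_of Y) (tw_of Z) _ _ (cl _ _ _ cg) (cl _ _ _ cf)).
- move=> X Y; apply/tg_morP; split; first exact: linear_zero.
  rewrite -[0]/(blval (0 : @dghom barDG X Y)) bl_of_val.
  exact: (cmor0 PT (tw_of X) (tw_of Y)).
- move=> X Y f g cf cg; have gL := lin _ _ _ cg; have fL := lin _ _ _ cf.
  have gNL : linear (- g : bar_arr A X Y) by exact: linear_opp.
  apply/tg_morP; split; first by apply: linear_add.
  rewrite bl_of_add //; have -> : bl_of (- g : bar_arr A X Y) = - bl_of g.
    by apply: barlin_ext; rewrite bl_ofE //= bl_ofE.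
  exact: (@cmorB _ PT (tw_of X) (tw_of Y) _ _ (cl _ _ _ cf) (cl _ _ _ cg)).
- split=> /=.
  + by move=> X Y f /cl.
  + by move=> X; exact: bl_of_id.
  + by move=> X Y Z g f /lin gL /lin fL; exact: bl_of_comp.
  + by move=> X Y f g /lin fL /lin gL; exact: bl_of_add.
- move=> X Y g cg; exists (blval g); last exact: bl_of_val.
  by apply/tg_morP; rewrite bl_of_val; split=> //; exact: blvalP.
- by move=> X Y f g /lin fL /lin gL; exact: bl_of_inj.
- move=> [M u ud mc]; have tw : twisted (blval u).
    split=> // x; have := congr1 (fun g => blval g x) mc; exact.
  by exists (TGMod tw); apply: dgtw_eq; exact: barlin_ext.
Qed.

Section Semisimple.
Hypothesis ss : semisimple_ring S.

Lemma E_tw_split (X Y Z : tgmod A) (f : bar_arr A X Y) (g : bar_arr A Y Z) :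
  E_tw A f g <-> [/\ tg_mor f, tg_mor g
    & @Esplit barDG (tw_of X) (tw_of Y) (tw_of Z) (bl_of f) (bl_of g)].
Proof.
have aux : tg_mor f -> tg_mor g ->
    (@ccomp (TGMod0 A) X Y Z g f = 0 /\ short_exact (bar_first f) (bar_first g)) <->
    dgsplit (bl_of f) (bl_of g).
  move=> [[fL fh] _] [[gL gh] _].
  rewrite -bar_splitP //; [|by rewrite /= bl_ofE..].
  rewrite /bfst !bl_ofE // -bl_of_comp //.
  have e0 : (bl_of (bar_comp g f) = 0) <-> (bar_comp g f = 0).
    have gfL : linear (bar_comp g f) by exact: bar_comp_linear.
    split=> e; last by apply: barlin_ext; rewrite bl_ofE.
    by have := congr1 (fun h : @dghom barDG X Z => blval h) e; rewrite bl_ofE.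
  by split=> -[h1 h2]; split=> //; apply/e0.
split=> [[cf cg gf se]|[cf cg [_ _ spl]]].
  have [_ tf] := (tg_morP f).1 cf; have [_ tg] := (tg_morP g).1 cg.
  by split=> //; split=> //; apply/aux.
by have [gf se] := (aux cf cg).2 spl; split.
Qed.

Lemma TW_exact : exact_category (@Esplit barDG).
Proof.
exact: (Esplit_exact CL (@bar_inhabited k S A) (@bar_split_idem k S A)
  (@bar_sum k S A)).
Qed.

Lemma E_tw_exact : exact_category (@E_tw k S A).
Proof.
exact: (ffs_exact tw_functor_ffs (TW_preadditive CL) E_tw_split TW_exact).
Qed.
End Semisimple.

Lemma hat0 (M N : gmod S) : hat (0 : mfamily A M N) = 0.
Proof. by apply: (addrI (hat (0 : mfamily A M N))); rewrite -hatD !addr0. Qed.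
Lemma hatN (M N : gmod S) (f : mfamily A M N) : hat (- f) = - hat f.
Proof. by apply: (addrI (hat f)); rewrite -hatD !subrr hat0. Qed.

Lemma fam_linear0 (M N : gmod S) : fam_linear (0 : mfamily A M N).
Proof. by move=> j; exact: linear_zero. Qed.
Lemma fam_linearD (M N : gmod S) (f g : mfamily A M N) :
  fam_linear f -> fam_linear g -> fam_linear (f + g).
Proof. by move=> fL gL j; exact: linear_add. Qed.
Lemma fam_linearN (M N : gmod S) (f : mfamily A M N) :
  fam_linear f -> fam_linear (- f).
Proof. by move=> fL j; exact: linear_opp. Qed.

Lemma fam_comp_linear (M N P : gmod S) (g : mfamily A N P) (f : mfamily A M N) :
  fam_linear g -> fam_linear f -> fam_linear (fam_comp g f).
Proof. exact: (@fam_compg_linear k S A (fun r s => (r.+2 * s)%N)). Qed.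
Lemma fam_mod_linear (M N : gmod S) (f : mfamily A M N) (m : mfamily A M M) :
  fam_linear f -> fam_linear m -> fam_linear (fam_mod f m).
Proof. exact: (@fam_compg_linear k S A (fun r s => (r.+1 * s)%N)). Qed.

Lemma hat_fam_comp (M N P : gmod S) (g : mfamily A N P) (f : mfamily A M N) :
  fam_linear g -> fam_deg 0 f -> hat (fam_comp g f) = bar_comp (hat g) (hat f).
Proof.
move=> gL fd; apply: (hat_fam_compg (c := fun r s => (r.+2 * s)%N) _ gL fd).
by move=> r s; rewrite addr0 abszM !absz_nat !oddM /= negbK andbC.
Qed.
Lemma hat_fam_mod (M N : gmod S) (f : mfamily A M N) (m : mfamily A M M) :
  fam_linear f -> fam_deg 1 m -> hat (fam_mod f m) = bar_comp (hat f) (hat m).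
Proof.
move=> fL md; apply: (hat_fam_compg (c := fun r s => (r.+1 * s)%N) _ fL md).
by move=> r s; rewrite -[1]/(1%N%:Z) -PoszD -PoszM absz_nat addn1 mulnC.
Qed.

Lemma fam_id_bal (M : gmod S) :
  balanced (@rmul k S M) (@lmul k S (breg S)) (fun m s => rmul m (s : S)).
Proof.
split=> [m m' s|m s s'|m s t]; first exact: rmulDl.
- exact: rmulDr.
- by rewrite rmulA.
Qed.

Lemma fam_id_linear (M : gmod S) : fam_linear (@fam_id k S A M).
Proof.
case=> [|j]; last exact: linear_zero.
by apply: (tlift_linear (fam_id_bal M)) => m s b; rewrite /rmul scalerA.
Qed.

Lemma hat_fam_id (M : gmod S) : hat (@fam_id k S A M) = @bar_id k S A (gshift M).
Proof.
apply: bar_ext => [||m h].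
- exact: (hat_linear (@fam_id_linear M)).
- exact: bar_id_linear.
rewrite (hatE (@fam_id_linear M) m (erefl (size h))) bar_idE.
case: h => [|x h]; last by rewrite ksign_0r.
by rewrite /esgm mul0r addr0 ksign0 /= (tliftE (fam_id_bal M)); exact: rmul1.
Qed.

Lemma fam_deg_hat d (M N : gmod S) (f : mfamily A M N) : fam_linear f ->
  (fam_deg d f <-> rmor d (hat f)).
Proof.
move=> fL; split; first exact: hat_deg.
by move=> h; rewrite -(hatK fL); exact: unhat_deg.
Qed.

Lemma mop_linear (M : ainf_mod A) : fam_linear (mop M).
Proof. exact: fam_deg_linear (@mop_deg k S A M). Qed.

(** The hat turns [fam_alg] into the differential and [fam_mod] into the product, and it is
    injective on linear families, so the module relations and the twist equation are the same
    equation. *)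
Lemma hat_mc (M : gmod S) (m : mfamily A M M) : fam_deg 1 m ->
  (forall j x, fam_alg m j x + fam_mod m m j x = 0) <-> twisted (hat m).
Proof.
move=> md; have mL := fam_deg_linear md.
have e : hat (fam_alg m + fam_mod m m) = bar_dd (hat m) + bar_comp (hat m) (hat m).
  by rewrite hatD hat_fam_alg // hat_fam_mod.
split=> [rel|[_ mc]].
  split; first exact: hat_deg.
  have rel0 : fam_alg m + fam_mod m m = 0 by apply: fam_ext => j x; exact: rel.
  by move=> x; have := congr1 (fun g => g x) e; rewrite rel0 hat0 => /esym.
suff rel0 : fam_alg m + fam_mod m m = 0.
  by move=> j x; have := congr1 (fun g => g j x) rel0.
apply: hat_inj; [|exact: fam_linear0|].
  by apply: fam_linearD; [exact: fam_alg_linear | exact: fam_mod_linear].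
by rewrite e hat0; apply/funext => x; exact: mc.
Qed.

Lemma hat_twisted (M : ainf_mod A) : twisted (hat (mop M)).
Proof. by apply/hat_mc; [exact: mop_deg | exact: mop_rel]. Qed.

Definition hat_ob (M : ainf_mod A) : tgmod A := TGMod (hat_twisted M).

Lemma hat_mor (M N : ainf_mod A) (f : mfamily A M N) : fam_linear f ->
  ainf_mor f <-> @tg_mor k S A (hat_ob M) (hat_ob N) (hat f).
Proof.
move=> fL; have mL := @mop_linear M; have nL := @mop_linear N.
have dL := @fam_deg_hat 0 _ _ _ fL.
have key : fam_deg 0 f ->
    hat (fam_alg f + fam_mod f (mop M) - fam_comp (mop N) f) =
    - ((fun x => bar_diff 0 (hat f) x) + bar_comp (hat (mop N)) (hat f) -
       bar_comp (hat f) (hat (mop M)) : bar_arr A _ _).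
  move=> f0; rewrite !hatD hatN hat_fam_alg // hat_fam_mod //; last exact: mop_deg.
  rewrite hat_fam_comp //; apply/funext => x.
  rewrite !(bar_addE, bar_oppE) bar_diff0E !opprD !opprK.
  by rewrite addrAC.
split=> -[f0 rel].
  split; first exact/dL.
  have rel0 : fam_alg f + fam_mod f (mop M) - fam_comp (mop N) f = 0.
    by apply: fam_ext => j x; exact: rel.
  move=> x; have := congr1 (fun g => g x) (key f0).
  rewrite rel0 hat0 bar_oppE => /eqP; rewrite eq_sym oppr_eq0 => /eqP; exact.
have {}f0 : fam_deg 0 f by apply/dL.
split=> //; suff rel0 : fam_alg f + fam_mod f (mop M) - fam_comp (mop N) f = 0.
  by move=> j x; have := congr1 (fun g => g j x) rel0.
apply: hat_inj; [|exact: fam_linear0|].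
  apply: fam_linearD; last by apply: fam_linearN; exact: fam_comp_linear.
  by apply: fam_linearD; [exact: fam_alg_linear | exact: fam_mod_linear].
rewrite (key f0) hat0; apply/eqP; rewrite oppr_eq0; apply/eqP/funext => x.
exact: rel.
Qed.

Lemma ainf_mor_linear (M N : ainf_mod A) (f : mfamily A M N) :
  ainf_mor f -> fam_linear f.
Proof. by case=> /fam_deg_linear. Qed.

Lemma gshift_surj (N : gmod S) : exists M, gshift M = N.
Proof. by exists (gunshift N); exact: gunshiftK. Qed.

Notation G := (functor_G hat_twisted).

Lemma TGMod0_preadditive : preadditive (TGMod0 A).
Proof. exact: (ffs_preadditive tw_functor_ffs (TW_preadditive CL)). Qed.

Lemma functor_G_ffs : ff_surjection G.
Proof.
have PT := TGMod0_preadditive; have lin := ainf_mor_linear.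
have cl (X Y : ainf_mod A) (f : mfamily A X Y) : ainf_mor f ->
    @tg_mor k S A (hat_ob X) (hat_ob Y) (hat f).
  by move=> cf; apply/hat_mor => //; exact: lin.
split=> /=.
- move=> X; apply/(hat_mor (@fam_id_linear X)); rewrite hat_fam_id.
  exact: (cmor_id PT (hat_ob X)).
- move=> X Y Z g f cg cf; have gL := lin _ _ _ cg; have fL := lin _ _ _ cf.
  apply/hat_mor; first exact: fam_comp_linear.
  rewrite hat_fam_comp //; last by case: cf.
  exact: (@cmor_comp _ PT (hat_ob X) (hat_ob Y) (hat_ob Z) _ _ (cl _ _ _ cg) (cl _ _ _ cf)).
- move=> X Y; apply/hat_mor; first exact: fam_linear0.
  by rewrite hat0; exact: (cmor0 PT (hat_ob X) (hat_ob Y)).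
- move=> X Y f g cf cg; have gL := lin _ _ _ cg; have fL := lin _ _ _ cf.
  apply/hat_mor; first by apply: fam_linearD => //; exact: fam_linearN.
  rewrite hatD hatN.
  exact: (@cmorB _ PT (hat_ob X) (hat_ob Y) _ _ (cl _ _ _ cf) (cl _ _ _ cg)).
- split=> /=.
  + by move=> X Y f /cl.
  + by move=> X; exact: hat_fam_id.
  + by move=> X Y Z g f /lin gL [f0 _]; exact: hat_fam_comp.
  + by move=> X Y f g _ _; exact: hatD.
- move=> X Y g cg; have gL : linear g by case: cg => -[].
  exists (unhat g); last exact: unhatK.
  by apply/hat_mor; [exact: unhat_linear | rewrite unhatK].
- by move=> X Y f g /lin fL /lin gL; exact: hat_inj.
(* [N] is replaced by a shift, with which [u] is an arrow between shifted modules and can be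
   unhatted. *)
- move=> [N u tu]; have [M e] := gshift_surj N; case: _ / e u tu => u tu.
  have [[uL _] _] := tu; have [u1 _] := tu.
  have md : fam_deg 1 (unhat u) := unhat_deg u1.
  have rel : forall j x, fam_alg (unhat u) j x + fam_mod (unhat u) (unhat u) j x = 0.
    by apply/(hat_mc md); rewrite unhatK.
  exists (AInfMod md rel); apply: tgmod_eq; exact: unhatK.
Qed.

Lemma E_inf_tw (M E N : ainf_mod A) (f : mfamily A M E) (g : mfamily A E N) :
  E_inf A f g <-> [/\ ainf_mor f, ainf_mor g
    & @E_tw k S A (hat_ob M) (hat_ob E) (hat_ob N) (hat f) (hat g)].
Proof.
have FA := ffs_functor functor_G_ffs.
have aux : ainf_mor f -> ainf_mor g ->
    (fam_comp g f = 0 <-> bar_comp (hat g) (hat f) = 0).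
  move=> cf cg; have fL := ainf_mor_linear cf; have gL := ainf_mor_linear cg.
  rewrite -hat_fam_comp //; last by case: cf.
  split=> [->|e]; first exact: hat0.
  apply: hat_inj; [exact: fam_comp_linear | exact: fam_linear0 |].
  by rewrite hat0.
have first : ainf_mor f -> ainf_mor g ->
    bar_first (hat f) = fam_first f /\ bar_first (hat g) = fam_first g.
  by move=> cf cg; split; apply: fam_first_hat; exact: ainf_mor_linear.
split=> [[cf cg gf se]|[cf cg [_ _ gf se]]].
  have [e1 e2] := first cf cg.
  split=> //; split; [exact: (farr_mor FA cf) | exact: (farr_mor FA cg) | |].
    by apply/aux.
  by move: se; rewrite /= e1 e2.
have [e1 e2] := first cf cg.
split=> //; first by apply/aux.
by move: se; rewrite /= e1 e2.
Qed.
End Assembly.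

(** * Splittings in the category of graded modules *)

Section GradedCategory.
Variables (k : fieldType) (S : falgType k) (A : ainf_alg S).
Notation barDG := (barDG A).
Let CL := barDG_laws A.

(** The untwisted degree 0 part of the bar category, as a target for the hat on [GMod0]:
    preadditivity is pulled back from it. *)
Definition bar0 : catdata :=
  @CatData (gmod S) (fun M N => bar_arr A M N) (fun M N f => rmor 0 f)
    (fun M => @bar_id k S A M) (fun M N P => @bar_comp k S A M N P).

Lemma bar0_preadditive : preadditive bar0.
Proof.
split=> /=.
- by move=> X; exact: rmor_id.
- by move=> X Y Z g f; exact: rmor_comp.
- by move=> X Y; exact: rmor0.
- by move=> X Y f g; exact: rmorB.
- by move=> X Y Z W h g f [hL _] [gL _] [fL _]; exact: bar_compA.
- by move=> X Y f [fL _]; exact: bar_comp1l.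
- by move=> X Y f [fL _]; exact: bar_comp1r.
- by [].
- by move=> X Y Z g f f' [gL _] [fL _] [fL' _]; exact: bar_compDr.
Qed.

Definition hat_functor : functor_data (GMod0 A) bar0 :=
  @FunctorData (GMod0 A) bar0 (@gshift k S) (fun M N f => @hat k S A M N f).

Lemma hat_functor_ffs : ff_surjection hat_functor.
Proof.
have PB := bar0_preadditive; have lin := @fam_deg_linear k S A 0.
split=> /=.
- move=> X; apply/(fam_deg_hat 0 (@fam_id_linear k S A X)).
  by rewrite hat_fam_id; exact: rmor_id.
- move=> X Y Z g f cg cf; have gL := lin _ _ _ cg; have fL := lin _ _ _ cf.
  apply/(fam_deg_hat 0 (fam_comp_linear gL fL)); rewrite hat_fam_comp //.
  exact: (rmor_comp (hat_deg cg) (hat_deg cf)).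
- by move=> X Y j; split=> [|i x _]; [exact: linear_zero | exact: hel0P].
- move=> X Y f g cf cg; have gL := lin _ _ _ cg; have fL := lin _ _ _ cf.
  apply/fam_deg_hat; first by apply: fam_linearD => //; exact: fam_linearN.
  by rewrite hatD hatN; apply: rmorB; exact: hat_deg.
- split=> /=.
  + by move=> X Y f; exact: hat_deg.
  + by move=> X; exact: hat_fam_id.
  + by move=> X Y Z g f /lin gL; exact: hat_fam_comp.
  + by move=> X Y f g _ _; exact: hatD.
- move=> X Y g cg; have [gL _] := cg.
  by exists (unhat g); [exact: unhat_deg | exact: unhatK].
- by move=> X Y f g /lin fL /lin gL; exact: hat_inj.
- exact: gshift_surj.
Qed.

Lemma GMod0_preadditive : preadditive (GMod0 A).
Proof. exact: (ffs_preadditive hat_functor_ffs bar0_preadditive). Qed.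

Lemma GMod0_splitP (M E N : gmod S) (f : mfamily A M E) (g : mfamily A E N) :
  fam_deg 0 f -> fam_deg 0 g ->
  @split_exact (GMod0 A) M E N f g <->
  dgsplit (bl_of (hat f)) (bl_of (hat g)).
Proof.
move=> f0 g0; have FF := hat_functor_ffs; have lin := @fam_deg_linear k S A 0.
have fL := lin _ _ _ f0; have gL := lin _ _ _ g0.
have compE (X Y Z : gmod S) (b : mfamily A Y Z) (a : mfamily A X Y) :
    fam_deg 0 b -> fam_deg 0 a ->
    bl_of (hat b) ** bl_of (hat a) = bl_of (hat (fam_comp b a)).
  move=> bd ad; rewrite hat_fam_comp //; last exact: lin.
  by rewrite bl_of_comp //; apply: hat_linear; exact: lin.
have inj (X Y : gmod S) (a b : mfamily A X Y) : fam_deg 0 a -> fam_deg 0 b ->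
    bl_of (hat a) = bl_of (hat b) <-> a = b.
  move=> ad bd; have aL := lin _ _ _ ad; have bL := lin _ _ _ bd.
  split=> [/bl_of_inj e|->//]; apply: hat_inj => //.
  by apply: e; exact: hat_linear.
have cc (X Y Z : gmod S) (b : mfamily A Y Z) (a : mfamily A X Y) :
    fam_deg 0 b -> fam_deg 0 a -> fam_deg 0 (fam_comp b a).
  exact: (ffs_comp FF).
have c0 (X Y : gmod S) : fam_deg 0 (0 : mfamily A X Y) := ffs_0 FF X Y.
have c1 (X : gmod S) : fam_deg 0 (@fam_id k S A X) := ffs_id FF X.
have idE X : @dgid barDG (gshift X) = bl_of (hat (@fam_id k S A X)).
  by rewrite hat_fam_id bl_of_id.
have zE (X Y : gmod S) : (0 : @dghom barDG (gshift X) (gshift Y)) = bl_of (hat (0 : mfamily A X Y)).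
  rewrite hat0; apply: barlin_ext; rewrite bl_ofE //; exact: linear_zero.
split=> [[_ _ gf [[r r0] [[s s0] /= [rf gs e]]]]|[gf [r [s [rd sd rf gs e]]]]].
  split; first by rewrite compE // zE; apply/inj => //; exact: cc.
  exists (bl_of (hat r)), (bl_of (hat s)); split.
  - by rewrite /= bl_ofE; [exact: hat_deg | exact: hat_linear (lin _ _ _ r0)].
  - by rewrite /= bl_ofE; [exact: hat_deg | exact: hat_linear (lin _ _ _ s0)].
  - by rewrite compE // idE; apply/inj => //; exact: cc.
  - by rewrite compE // idE; apply/inj => //; exact: cc.
  rewrite !compE // -bl_of_add -?hatD ?e ?idE //.
  + by apply: hat_linear; apply: lin; apply: (cc _ _ _ _ _ f0 r0).
  + by apply: hat_linear; apply: lin; apply: (cc _ _ _ _ _ s0 g0).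
have rE : bl_of (hat (unhat (blval r))) = r.
  by rewrite unhatK ?bl_of_val //; exact: blvalP.
have sE : bl_of (hat (unhat (blval s))) = s.
  by rewrite unhatK ?bl_of_val //; exact: blvalP.
have r0 := unhat_deg rd; have s0 := unhat_deg sd.
split=> //.
  by apply/inj; [exact: (cc _ _ _ _ _ g0 f0) | exact: c0 | rewrite -compE // gf zE].
exists (@CHom (GMod0 A) _ _ _ r0), (@CHom (GMod0 A) _ _ _ s0); split=> /=.
- by apply/inj; [exact: (cc _ _ _ _ _ r0 f0) | exact: c1 | rewrite -compE // rE rf idE].
- by apply/inj; [exact: (cc _ _ _ _ _ g0 s0) | exact: c1 | rewrite -compE // sE gs idE].
have d1 := cc _ _ _ _ _ f0 r0; have d2 := cc _ _ _ _ _ s0 g0.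
apply/inj; [exact: (ffs_D FF d1 d2) | exact: c1 |].
rewrite hatD bl_of_add; [|exact: hat_linear (lin _ _ _ _)..].
by rewrite -!compE // rE sE e idE.
Qed.
End GradedCategory.

Theorem proposition9p7 (k : fieldType) (S : falgType k)
    (S_semisimple : semisimple_ring S)
    (Se_semisimple : semisimple_ring (envalg S))
    (A : ainf_alg S) :
  (additive_category (Mod_inf A) /\ split_idempotents (Mod_inf A)) /\
  (* (1) *)
  (exact_category (E_inf A) /\
   preadditive (GMod0 A) /\
   forall (M E N : ob (Mod_inf A)) (f : arr M E) (g : arr E N),
     E_inf A f g <-> E_forget_split A f g) /\
  (* (2) *)
  (forall (M E : ainf_mod A) (f : @chom (Mod_inf A) M E),
     inflation (E_inf A) f <-> injective (fam_first (harr f))) /\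
  (* (3) *)
  (forall (E N : ainf_mod A) (g : @chom (Mod_inf A) E N),
     deflation (E_inf A) g <->
     (forall n : N, exists e : E, fam_first (harr g) e = n)) /\
  (* (4) *)
  (exists wd : forall M : ainf_mod A, twisted (hat (mop M)),
     exact_equivalence (E_inf A) (E_tw A) (functor_G wd)).
Proof.
have ss := S_semisimple; have CL := barDG_laws A.
have FG := functor_G_ffs A; have FT := tw_functor_ffs A.
have PG := TGMod0_preadditive A; have PT := TW_preadditive CL.
have XT := E_tw_exact A ss; have XW := TW_exact A.
have XI := ffs_exact FG PG (@E_inf_tw k S A) XT.
have ET := @E_tw_split k S A ss.
have infl := inflationP CL (@bar_split_idem k S A).
have defl := deflationP CL (@bar_split_idem k S A).
have linf (M N : ainf_mod A) (f : @chom (Mod_inf A) M N) : linear (hat (harr f)).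
  exact: (hat_linear (@ainf_mor_linear k S A M N _ (harrP f))).
have firstE (M N : ainf_mod A) (f : @chom (Mod_inf A) M N) :
    bfst (bl_of (hat (harr f))) = fam_first (harr f).
  rewrite /bfst bl_ofE; last exact: linf.
  exact: (fam_first_hat (@ainf_mor_linear k S A M N _ (harrP f))).
have tgf (M N : ainf_mod A) (f : @chom (Mod_inf A) M N) :
    @tg_mor k S A (hat_ob M) (hat_ob N) (hat (harr f)).
  exact: (farr_mor (ffs_functor FG) (harrP f)).
split.
  split; first exact: (exact_additive XI).
  (* Two transfers: from [TW] to [TGMod0], then along G to [Mod_inf]. *)
  apply: (ffs_split_idempotents FG); apply: (ffs_split_idempotents FT).
  exact: (TW_split_idempotents CL (@bar_split_idem k S A)).
split.
  split=> //; split; first exact: GMod0_preadditive.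
  move=> M E N f g; rewrite E_inf_tw.
  split=> [[cf cg /ET [_ _ [_ _ spl]]]|[cf cg spl]].
    by split=> //; apply/GMod0_splitP; [case: cf | case: cg |].
  have [f0 _] := cf; have [g0 _] := cg.
  have cf' := farr_mor (ffs_functor FG) cf; have cg' := farr_mor (ffs_functor FG) cg.
  split=> //; apply/ET; split=> //.
  have [_ tf] := (tg_morP _).1 cf'; have [_ tg] := (tg_morP _).1 cg'.
  by split=> //; exact: (GMod0_splitP f0 g0).1 spl.
split.
  (* Through both functors an inflation becomes a closed arrow with a degree 0 retraction. First
     components then give injectivity, and [bar_retraction] gives the converse. *)
  move=> M E f; rewrite (ffs_inflation FG (@E_inf_tw k S A) XT).
  rewrite (ffs_inflation FT ET XW) infl -firstE.
  have [_ tf] := (tg_morP _).1 (tgf _ _ f).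
  split=> [[_ [_ [_ [r [_ rf]]]]]|fI].
    have {}rf : (r : @dghom (barDG A) _ _) ** bl_of (hat (harr f)) = dgid _ := rf.
    by move=> x y /(congr1 (bfst r)); rewrite -!bfst_comp rf !bfst_id.
  split; first exact: harrP.
  split; first exact: tgf.
  by split=> //; apply: bar_retraction => //; case: tf.
split.
  move=> E N g; rewrite (ffs_deflation FG (@E_inf_tw k S A) XT).
  rewrite (ffs_deflation FT ET XW) defl -firstE.
  have [_ tg] := (tg_morP _).1 (tgf _ _ g).
  split=> [[_ [_ [_ [s [_ gs]]]]]|gS].
    have {}gs : bl_of (hat (harr g)) ** (s : @dghom (barDG A) _ _) = dgid _ := gs.
    by move=> n; exists (bfst s n); rewrite -bfst_comp gs bfst_id.
  split; first exact: harrP.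
  split; first exact: tgf.
  by split=> //; apply: bar_section => //; case: tg.
exists (@hat_twisted k S A).
exact: (ffs_equivalence FG PG (@E_inf_tw k S A) XT).
Qed.
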